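(* Let $\{s_j\}_{j\ge0}$ be real random variables and let $S_n=\mathrm{Scirc}(s_0,s_1,\dots,s_{n-1})$ be the $n\times n$ skew-circulant matrix. Then the following hold. (i) If the $s_j$ are independent with $\mathbb{E}s_j=0$, $\mathbb{E}s_j^2=1$ and $\sup_j\mathbb{E}|s_j|^k<\infty$ for every $k\ge1$, then $n^{-1/2}S_n$, as an element of the NCP $(\mathcal{M}_n,n^{-1}\mathbb{E}\,\mathrm{Tr})$, converges in $*$-distribution to a standard complex Gaussian variable. (ii) If the $s_j$ are independent with $\mathbb{E}s_j=0$, $\mathbb{E}s_j^2=1$ and $\sup_j\mathbb{E}|s_j|^{2+\delta}<\infty$ for some $\delta>0$, then the ESD of $n^{-1/2}S_n$ converges weakly in probability to the bivariate Gaussian distribution with mean $0$ and covariance matrix $\Sigma$, where $\Sigma$ is diagonal with diagonal entries $1/2$.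
   Context: $\iota=\sqrt{-1}$. The skew-circulant matrix $\mathrm{Scirc}(s_0,\dots,s_{n-1})$ has $(i,j)$ entry ($0\le i,j\le n-1$) equal to $s_{j-i}$ if $j\ge i$ and $-s_{n+j-i}$ if $j<i$. For a matrix with eigenvalues $\lambda_0,\dots,\lambda_{n-1}\in\mathbb{C}$, the ESD (empirical spectral distribution) is the random probability measure $n^{-1}\sum_{j}\delta_{\lambda_j}$, viewed on $\mathbb{R}^2\cong\mathbb{C}$ via $(\mathrm{Re}\,\lambda_j,\mathrm{Im}\,\lambda_j)$. An NCP (non-commutative $*$-probability space) $(\mathcal{A},\varphi)$ is a unital complex $*$-algebra with a complex linear functional $\varphi$ satisfying $\varphi(1_{\mathcal{A}})=1$. $\mathcal{M}_n$ is the $*$-algebra of $n\times n$ random matrices all of whose entries have finite moments of all orders. Elements $a_n$ of NCPs $(\mathcal{A}_n,\varphi_n)$ converge in $*$-distribution to $a\in\mathcal{A}$ if $\varphi_n(Q(a_n))\to\varphi(Q(a))$ for every monomial $Q$ in the non-commuting indeterminates $x,x^*$. A variable $a\in\mathcal{A}$ is a standard complex Gaussian variable if it is normal ($aa^*=a^*a$) and $\varphi(a^k a^{*l})=\mathbb{E}[G^k\overline{G}^{\,l}]$ for all $k,l\ge 0$, where $G=X+\iota Y$ with $X,Y$ independent real Gaussian random variables of mean $0$ and variance $1/2$. *)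

(* Defs.v *)
(* Random matrices over the complex numbers R[i], R : realType, on top of
   MathComp-Analysis and the construction of R[i] in mathcomp-real-closed. *)
From HB Require Import structures.
From mathcomp Require Import all_boot all_order all_algebra.
From mathcomp Require Import all_classical all_reals all_analysis.
From mathcomp Require Import measurable_realfun complex.

Set Implicit Arguments.
Unset Strict Implicit.
Unset Printing Implicit Defensive.

Import Order.TTheory GRing.Theory Num.Theory.
Import numFieldNormedType.Exports.
Import Normc.

Local Open Scope classical_set_scope.
Local Open Scope ring_scope.
Local Open Scope complex_scope.

Section Ncp.
Variable C : numClosedFieldType.

Record ncp := Ncp {
  ncp_alg :> algType C;
  star : ncp_alg -> ncp_alg;
  starK : involutive star;
  starD : {morph star : a b / a + b};
  starZ : forall (c : C) a, star (c *: a) = Num.conj c *: star a;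
  starM : forall a b, star (a * b) = star b * star a;
  phi : {scalar ncp_alg};
  phi1 : phi 1 = 1 }.

Arguments phi {A} : rename.

(* A monomial in the non-commuting indeterminates x, x^* is a word over bool:
   [false] stands for x and [true] for x^*. *)
Definition eval_monomial (A : ncp) (Q : seq bool) (a : A) : A :=
  \prod_(b <- Q) (if b then star a else a).

Definition cvg_star_distribution
    (A_ : nat -> ncp) (a_ : forall n, A_ n) (A : ncp) (a : A) : Prop :=
  forall Q : seq bool,
    phi (eval_monomial Q (a_ n)) @[n --> \oo] --> phi (eval_monomial Q a).

End Ncp.

Arguments phi {C A} : rename.

Section ComplexExpectation.
Context d (T : measurableType d) (R : realType).

Definition cexpectation (mu : {measure set T -> \bar R}) (Z : T -> R[i]) : R[i] :=
  (\int[mu]_w complex.Re (Z w)) +i* (\int[mu]_w complex.Im (Z w)).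

Definition finite_moments (P : probability T R) (Z : T -> R[i]) : Prop :=
  [/\ measurable_fun setT (fun w => complex.Re (Z w)),
      measurable_fun setT (fun w => complex.Im (Z w)) &
      forall k : nat, ('E_P[fun w => (normc (Z w) ^+ k)%R] < +oo)%E].

End ComplexExpectation.

(* R^2 with its Borel sets. The carrier [measurableTypeR R] is R itself, in the
   form in which the library equips it with Lebesgue and normal measures. *)
Notation plane R := (measurableTypeR R * measurableTypeR R)%type.

Section ComplexGaussian.
Variable R : realType.

(* The law of (X, Y), for X, Y independent real Gaussian variables of mean 0 and
   variance 1/2; the second parameter of [normal_prob] is the standard
   deviation. *)
Definition gauss_XY : probability (plane R) R :=
  (normal_prob 0 (Num.sqrt 2^-1) \x normal_prob 0 (Num.sqrt 2^-1))%E.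

(* G = X + iY, with X and Y realised as the coordinates of the plane. *)
Definition gauss_G (z : plane R) : R[i] := z.1 +i* z.2.

Definition std_complex_gaussian (A : ncp R[i]) (a : A) : Prop :=
  a * star a = star a * a /\
  forall k l : nat,
    phi (a ^+ k * star a ^+ l) =
    cexpectation gauss_XY (fun z => gauss_G z ^+ k * (gauss_G z)^* ^+ l).

End ComplexGaussian.

Section RandomMatrices.
Context d (T : measurableType d) (R : realType) (P : probability T R).
Local Notation fm := (finite_moments P).

Lemma normc_meas (Z : T -> R[i]) : measurable_fun setT (fun w => complex.Re (Z w)) ->
  measurable_fun setT (fun w => complex.Im (Z w)) ->
  measurable_fun setT (fun w => normc (Z w)).
Proof.
move=> mr mi.
have -> : (fun w => normc (Z w)) =
  (fun w => Num.sqrt (complex.Re (Z w) ^+ 2 + complex.Im (Z w) ^+ 2)).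
  by apply/funext => w; case: (Z w).
apply: (@measurableT_comp _ _ _ _ _ _ (@Num.sqrt R)).
  by apply: continuous_measurable_fun; exact: sqrt_continuous.
by apply: measurable_funD; apply: measurable_funX.
Qed.

Lemma normc_ge0 (z : R[i]) : 0 <= normc z.
Proof. by case: z => a b; rewrite /= sqrtr_ge0. Qed.

Lemma fm_bound (Z : T -> R[i]) : measurable_fun setT (fun w => complex.Re (Z w)) ->
  measurable_fun setT (fun w => complex.Im (Z w)) ->
  (forall k, exists g : T -> R, [/\ measurable_fun setT g, ('E_P[g] < +oo)%E &
     forall w, normc (Z w) ^+ k <= g w]) -> fm Z.
Proof.
move=> mr mi H; split=> // k; have [g [mg gf Hg]] := H k.
apply: le_lt_trans gf; rewrite !expectation.unlock; apply: ge0_le_integral => //.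
- by move=> w _; rewrite lee_fin exprn_ge0 ?normc_ge0.
- by apply/measurable_EFinP; apply: measurable_funX; exact: normc_meas.
- exact/measurable_EFinP.
- by move=> w _; rewrite lee_fin.
Qed.

Lemma fm_cst (c : R[i]) : fm (fun=> c).
Proof.
split; [exact: measurable_cst|exact: measurable_cst|move=> k].
by rewrite (@expectation_cst _ _ _ P (normc c ^+ k)) ltry.
Qed.

Lemma fm_powmeas (Z : T -> R[i]) k : fm Z -> measurable_fun setT (fun w => normc (Z w) ^+ k).
Proof. by case=> *; apply: measurable_funX; exact: normc_meas. Qed.

Lemma E_sum_lt (f g : T -> R) : measurable_fun setT f -> measurable_fun setT g ->
  (forall w, 0 <= f w) -> (forall w, 0 <= g w) ->
  ('E_P[f] < +oo -> 'E_P[g] < +oo -> 'E_P[fun w => (f w + g w)%R] < +oo)%E.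
Proof.
move=> mf mg f0 g0; rewrite !expectation.unlock => hf hg.
rewrite (eq_integral (fun w => (f w)%:E + (g w)%:E)%E); last by move=> w _; rewrite EFinD.
rewrite ge0_integralD//; first [exact/measurable_EFinP | exact: lte_add_pinfty
  | by move=> w _; rewrite lee_fin].
Qed.

Lemma fmD (X Y : T -> R[i]) : fm X -> fm Y -> fm (fun w => X w + Y w).
Proof.
move=> hX hY; have [mXr mXi fX] := hX; have [mYr mYi fY] := hY.
apply: fm_bound.
- rewrite (_ : (fun _ => _) = (fun w => complex.Re (X w) + complex.Re (Y w))); last first.
    by apply/funext => w; rewrite raddfD.
  exact: measurable_funD.
- rewrite (_ : (fun _ => _) = (fun w => complex.Im (X w) + complex.Im (Y w))); last first.
    by apply/funext => w; rewrite raddfD.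
  exact: measurable_funD.
move=> k; exists (fun w => 2 ^+ k * (normc (X w) ^+ k + normc (Y w) ^+ k)).
have ms := measurable_funD (fm_powmeas k hX) (fm_powmeas k hY).
split.
- by apply: measurable_funM => //; exact: measurable_cst.
- have := E_sum_lt (fm_powmeas k hX) (fm_powmeas k hY).
  move=> /(_ (fun w => exprn_ge0 _ (normc_ge0 _)) (fun w => exprn_ge0 _ (normc_ge0 _)) (fX k) (fY k)).
  rewrite !expectation.unlock => h.
  under eq_integral do rewrite EFinM.
  rewrite ge0_integralZl//; first
    [ exact/measurable_EFinP
    | by move=> w _; rewrite lee_fin addr_ge0 ?exprn_ge0 ?normc_ge0
    | by rewrite lee_fin exprn_ge0
    | by rewrite lte_mul_pinfty ?lee_fin ?exprn_ge0 ].
- move=> w; set x := normc (X w); set y := normc (Y w).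
  have x0 : 0 <= x by exact: normc_ge0.
  have y0 : 0 <= y by exact: normc_ge0.
  apply: (@le_trans _ _ ((2 * Num.max x y) ^+ k)).
    apply: lerXn2r; rewrite ?nnegrE ?normc_ge0 ?mulr_ge0 ?le_max ?x0//.
    apply: (le_trans (le_normcD _ _)); rewrite -/x -/y mulr_natl mulr2n.
    by apply: lerD; rewrite le_max lexx ?orbT.
  rewrite exprMn ler_wpM2l ?exprn_ge0//.
  by case: (leP x y) => _; rewrite ?lerDl ?lerDr exprn_ge0.
Qed.

Lemma fmM (X Y : T -> R[i]) : fm X -> fm Y -> fm (fun w => X w * Y w).
Proof.
move=> hX hY; have [mXr mXi fX] := hX; have [mYr mYi fY] := hY.
have ReM (a b : R[i]) : complex.Re (a * b) = complex.Re a * complex.Re b - complex.Im a * complex.Im b.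
  by case: a b => [? ?] [? ?].
have ImM (a b : R[i]) : complex.Im (a * b) = complex.Re a * complex.Im b + complex.Im a * complex.Re b.
  by case: a b => [? ?] [? ?].
apply: fm_bound.
- under eq_fun do rewrite ReM.
  by apply: measurable_funB; apply: measurable_funM.
- under eq_fun do rewrite ImM.
  by apply: measurable_funD; apply: measurable_funM.
move=> k; exists (fun w => normc (X w) ^+ (k + k) + normc (Y w) ^+ (k + k)).
split.
- by apply: measurable_funD; exact: fm_powmeas.
- apply: E_sum_lt => //; try exact: fm_powmeas.
  by move=> w; rewrite exprn_ge0 ?normc_ge0.
  by move=> w; rewrite exprn_ge0 ?normc_ge0.
- move=> w; rewrite normcM exprMn !exprD.
  set x := normc _ ^+ k; set y := normc _ ^+ k.
  have x0 : 0 <= x by rewrite exprn_ge0 ?normc_ge0.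
  have y0 : 0 <= y by rewrite exprn_ge0 ?normc_ge0.
  case: (leP x y) => xy.
    by apply: (@le_trans _ _ (y * y)); [rewrite ler_wpM2r|rewrite lerDr mulr_ge0].
  apply: (@le_trans _ _ (x * x)); last by rewrite lerDl mulr_ge0.
  by apply: ler_wpM2l => //; exact: ltW.
Qed.

Lemma fm_sum (I : Type) (r : seq I) (F : I -> T -> R[i]) :
  (forall i, fm (F i)) -> fm (fun w => \sum_(i <- r) F i w).
Proof.
move=> h; elim: r => [|i r IH].
  by under eq_fun do rewrite big_nil; exact: fm_cst.
by under eq_fun do rewrite big_cons; exact: fmD.
Qed.

Lemma fmJ (X : T -> R[i]) : fm X -> fm (fun w => (X w)^*).
Proof.
case=> mr mi f; split.
- by rewrite (_ : (fun _ => _) = (fun w => complex.Re (X w)))//; apply/funext => w; case: (X w).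
- rewrite (_ : (fun _ => _) = (fun w => - complex.Im (X w))); last first.
    by apply/funext => w; case: (X w).
  exact: (@measurableT_comp _ _ _ _ _ _ (@GRing.opp R)).
- move=> k; rewrite (_ : (fun _ => _) = (fun w => normc (X w) ^+ k)); first exact: f.
  by apply/funext => w; case: (X w) => a b /=; rewrite sqrrN.
Qed.

Lemma fm_int (X : T -> R[i]) : fm X ->
  P.-integrable setT (fun w => (complex.Re (X w))%:E) /\
  P.-integrable setT (fun w => (complex.Im (X w))%:E).
Proof.
move=> hX; have [mr mi /(_ 1)] := hX; rewrite expectation.unlock => f.
have int (g : T -> R) : measurable_fun setT g -> (forall w, `|g w| <= normc (X w)) -> P.-integrable setT (EFin \o g).
  move=> mg gn; apply/integrableP; split; first exact/measurable_EFinP.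
  apply: le_lt_trans f; apply: ge0_le_integral => //.
  - by apply: measurableT_comp => //; exact/measurable_EFinP.
  - by apply/measurable_EFinP; exact: fm_powmeas.
  - by move=> w _; rewrite expr1 /= lee_fin.
split; apply: int => // w; case: (X w) => a b /=.
  by rewrite -sqrtr_sqr ler_sqrt ?addr_ge0 ?sqr_ge0// lerDl sqr_ge0.
by rewrite -sqrtr_sqr ler_sqrt ?addr_ge0 ?sqr_ge0// lerDr sqr_ge0.
Qed.

(* Random matrices have size n.+1: for size 0 the state n^{-1} E Tr does not
   satisfy the unit condition. *)
Variable n : nat.
Local Notation M := 'M[R[i]]_n.+1.

Definition rmx_pred : {pred T -> M} :=
  mem [set A : T -> M | forall i j, finite_moments P (fun w => A w i j)].

Lemma rmx_subring : subring_closed rmx_pred.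
Proof.
split.
- rewrite inE => i j; rewrite /= (_ : (fun _ => _) = fun=> (1%:M : M) i j)//.
  exact: fm_cst.
- move=> A B; rewrite !inE => hA hB i j.
  rewrite (_ : (fun _ => _) = fun w => A w i j + (-1) * B w i j); last first.
    by apply/funext => w; rewrite !mxE mulN1r.
  by apply: fmD => //; apply: fmM => //; exact: fm_cst.
- move=> A B; rewrite !inE => hA hB i j.
  rewrite (_ : (fun _ => _) = fun w => \sum_k A w i k * B w k j); last first.
    by apply/funext => w; rewrite mxE.
  by apply: fm_sum => k; exact: fmM.
Qed.

HB.instance Definition _ := GRing.isSubringClosed.Build (T -> M) rmx_pred rmx_subring.

Record rmx := Rmx { rmx_fun :> T -> M; _ : rmx_fun \in rmx_pred }.
HB.instance Definition _ := [isSub of rmx for rmx_fun].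
HB.instance Definition _ := [Choice of rmx by <:].
HB.instance Definition _ := GRing.SubChoice_isSubPzRing.Build (T -> M) rmx_pred rmx rmx_subring.

Lemma rmx_funP (A B : rmx) : (forall w, A w = B w) -> A = B.
Proof. by move=> h; apply: val_inj; apply/funext. Qed.

Lemma rmx_oner_neq0 : (1 : rmx) != 0.
Proof.
have [t _] : [set: T] !=set0.
  apply/set0P/eqP => T0; have := probability_setT P.
  by rewrite T0 measure0 => /eqP; rewrite lt_eqF// lte01.
apply/eqP => /(congr1 (fun A : rmx => A t ord0 ord0)) /=.
rewrite [LHS](_ : _ = (1%:M : M) ord0 ord0)// [RHS](_ : _ = (0 : M) ord0 ord0)//.
by rewrite !mxE eqxx => /eqP; rewrite oner_eq0.
Qed.

HB.instance Definition _ := GRing.PzSemiRing_isNonZero.Build rmx rmx_oner_neq0.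

Lemma rmx_scale_subproof (c : R[i]) (A : rmx) : (fun w => c *: A w) \in rmx_pred.
Proof.
rewrite inE => i j; have := valP A; rewrite inE => /(_ i j) hA.
rewrite (_ : (fun _ => _) = fun w => c * A w i j); last first.
  by apply/funext => w; rewrite mxE.
by apply: fmM => //; exact: fm_cst.
Qed.

Definition rmx_scale (c : R[i]) (A : rmx) : rmx := Rmx (rmx_scale_subproof c A).

Lemma rmx_addE (A B : rmx) w : (A + B) w = A w + B w. Proof. by []. Qed.
Lemma rmx_mulE (A B : rmx) w : (A * B) w = A w *m B w. Proof. by []. Qed.
Lemma rmx_oneE w : (1 : rmx) w = 1%:M. Proof. by []. Qed.

Fact rmx_scaleA a b (A : rmx) : rmx_scale a (rmx_scale b A) = rmx_scale (a * b) A.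
Proof. by apply: rmx_funP => w /=; rewrite scalerA. Qed.
Fact rmx_scale1 : left_id 1 rmx_scale.
Proof. by move=> A; apply: rmx_funP => w /=; rewrite scale1r. Qed.
Fact rmx_scaleDr : right_distributive rmx_scale +%R.
Proof. by move=> c A B; apply: rmx_funP => w; exact: scalerDr. Qed.
Fact rmx_scaleDl A : {morph rmx_scale^~ A : a b / a + b}.
Proof. by move=> a b; apply: rmx_funP => w; exact: scalerDl. Qed.

HB.instance Definition _ := GRing.Zmodule_isLmodule.Build R[i] rmx
  rmx_scaleA rmx_scale1 rmx_scaleDr rmx_scaleDl.

Fact rmx_scaleAl (a : R[i]) (A B : rmx) : a *: (A * B) = (a *: A) * B.
Proof. by apply: rmx_funP => w; exact: scalemxAl. Qed.
HB.instance Definition _ := GRing.Lmodule_isLalgebra.Build R[i] rmx rmx_scaleAl.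
Fact rmx_scaleAr (a : R[i]) (A B : rmx) : a *: (A * B) = A * (a *: B).
Proof. by apply: rmx_funP => w; exact: scalemxAr. Qed.
HB.instance Definition _ := GRing.Lalgebra_isAlgebra.Build R[i] rmx rmx_scaleAr.

Lemma rmx_star_subproof (A : rmx) : (fun w => map_mx Num.conj (A w)^T) \in rmx_pred.
Proof.
rewrite inE => i j; have := valP A; rewrite inE => /(_ j i) hA.
rewrite (_ : (fun _ => _) = fun w => (A w j i)^*); last first.
  by apply/funext => w; rewrite !mxE.
exact: fmJ.
Qed.

Definition rmx_star (A : rmx) : rmx := Rmx (rmx_star_subproof A).

Lemma rmx_starE (A : rmx) w i j : rmx_star A w i j = Num.conj (A w j i).
Proof. by rewrite [LHS]mxE mxE. Qed.
Lemma rmx_scaleE c (A : rmx) w i j : (c *: A) w i j = c * A w i j.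
Proof. by rewrite [LHS]mxE. Qed.

Fact rmx_starK : involutive rmx_star.
Proof.
by move=> A; apply: rmx_funP => w; apply/matrixP => i j; rewrite !rmx_starE conjCK.
Qed.
Fact rmx_starD : {morph rmx_star : A B / A + B}.
Proof.
move=> A B; apply: rmx_funP => w; apply/matrixP => i j.
rewrite rmx_starE !rmx_addE [in LHS]mxE rmorphD.
by rewrite [in RHS]mxE !rmx_starE.
Qed.
Fact rmx_starZ (c : R[i]) A : rmx_star (c *: A) = Num.conj c *: rmx_star A.
Proof.
apply: rmx_funP => w; apply/matrixP => i j.
by rewrite rmx_scaleE !rmx_starE rmx_scaleE rmorphM.
Qed.
Fact rmx_starM A B : rmx_star (A * B) = rmx_star B * rmx_star A.
Proof.
apply: rmx_funP => w; apply/matrixP => i j.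
rewrite rmx_starE !rmx_mulE !mxE rmorph_sum; apply: eq_bigr => k _.
by rewrite rmorphM mulrC !rmx_starE.
Qed.

Definition rmx_state (A : rmx) : R[i] :=
  n.+1%:R^-1 * cexpectation P (fun w => \tr (A w)).

Lemma fm_tr (A : rmx) : fm (fun w => \tr (A w)).
Proof. by apply: fm_sum => i; have := valP A; rewrite inE; exact. Qed.

Lemma cexpectationD (X Y : T -> R[i]) : fm X -> fm Y ->
  cexpectation P (fun w => X w + Y w) = cexpectation P X + cexpectation P Y.
Proof.
move=> /fm_int[Xr Xi] /fm_int[Yr Yi]; rewrite /cexpectation.
rewrite [RHS]/GRing.add/=; congr (_ +i* _); rewrite -RintegralD//;
  by apply: eq_Rintegral => w _; rewrite raddfD.
Qed.

Lemma cexpectationZ (c : R[i]) (X : T -> R[i]) : fm X ->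
  cexpectation P (fun w => c * X w) = c * cexpectation P X.
Proof.
move=> /fm_int[Xr Xi]; rewrite /cexpectation; case: c => a b.
have iZ (k : R) (g : T -> R) : P.-integrable setT (EFin \o g) ->
    P.-integrable setT (EFin \o (fun w => k * g w)).
  by move=> h; rewrite (_ : _ \o _ = fun w => (k%:E * (g w)%:E)%E)//; exact: integrableZl.
rewrite [RHS]/GRing.mul/=; congr (_ +i* _).
  rewrite -!RintegralZl// -RintegralB//; [|exact: iZ|exact: iZ].
  by apply: eq_Rintegral => w _; case: (X w).
rewrite -!RintegralZl// -RintegralD//; [|exact: iZ|exact: iZ].
by apply: eq_Rintegral => w _; case: (X w).
Qed.

Lemma rmx_state_linear : scalar rmx_state.
Proof.
move=> c A B; rewrite /rmx_state.
rewrite (_ : (fun w => _) = fun w => c * \tr (A w) + \tr (B w)); last first.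
  by apply/funext => w; rewrite rmx_addE linearD /= linearZ.
have fA : fm (fun w => c * \tr (A w)).
  by apply: fmM; [exact: fm_cst|exact: fm_tr].
rewrite (cexpectationD fA (fm_tr B)) (cexpectationZ c (fm_tr A)) mulrDr.
by congr (_ + _); rewrite mulrCA.
Qed.

HB.instance Definition _ :=
  GRing.isLinear.Build R[i] rmx R[i] *%R rmx_state rmx_state_linear.

Lemma rmx_state1 : rmx_state 1 = 1.
Proof.
rewrite /rmx_state /cexpectation.
under eq_Rintegral do rewrite rmx_oneE mxtrace1.
under [X in _ +i* X]eq_Rintegral do rewrite rmx_oneE mxtrace1.
rewrite !Rintegral_cst//= probability_setT /= !mulr1.
by rewrite (_ : _ +i* _ = n.+1%:R) ?mulVf ?pnatr_eq0//; case: (n.+1%:R : R[i]).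
Qed.

Definition rmx_ncp : ncp R[i] :=
  Ncp rmx_starK rmx_starD rmx_starZ rmx_starM rmx_state1.

End RandomMatrices.

Section Esd.
Variables (R : realType) (n : nat).
Implicit Type A : 'M[R[i]]_n.+1.

(* The eigenvalues of A, listed with their algebraic multiplicities. *)
Definition eigenvalues A : seq R[i] :=
  sval (closed_field_poly_normal (char_poly A)).

Lemma char_poly_eigenvalues A :
  char_poly A = \prod_(z <- eigenvalues A) ('X - z%:P).
Proof.
rewrite /eigenvalues; case: closed_field_poly_normal => r /= {1}->.
by rewrite (monicP (char_poly_monic A)) scale1r.
Qed.

Lemma size_eigenvalues A : size (eigenvalues A) = n.+1.
Proof.
have := size_char_poly A; rewrite char_poly_eigenvalues size_prod_XsubC.
by case.
Qed.

Definition esd_point (z : R[i]) : plane R := (complex.Re z, complex.Im z).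

Definition esd A : set (plane R) -> \bar R :=
  mscale (n.+1%:R^-1)%:nng
    (msum (fun j => \d_(esd_point (eigenvalues A)`_j)) n.+1).

HB.instance Definition _ A := Measure.on (esd A).

Lemma esd_setT A : esd A setT = 1%E.
Proof.
rewrite /esd /mscale /= /msum.
rewrite (eq_bigr (fun=> 1%:E)); last by move=> i _; exact: diracT.
rewrite sumEFin sumr_const card_ord -EFinM mulVf ?pnatr_eq0//.
Qed.

HB.instance Definition _ A :=
  Measure_isProbability.Build _ _ _ (esd A) (esd_setT A).

End Esd.

Section BivariateNormal.
Variables (R : realType) (m : 'rV[R]_2) (Sigma : 'M[R]_2).

Definition row_of_plane (z : plane R) : 'rV[R]_2 :=
  \row_(i < 2) if i == ord0 then z.1 else z.2.

(* The density with mean m and covariance matrix Sigma; it is only meaningful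
   when Sigma is positive definite. *)
Definition bivariate_normal_pdf (z : plane R) : R :=
  let v := row_of_plane z - m in
  (Num.sqrt ((2 * pi) ^+ 2 * \det Sigma))^-1 *
  expR (- (v *m invmx Sigma *m v^T) ord0 ord0 / 2).

Definition bivariate_normal : set (plane R) -> \bar R :=
  fun V => (\int[@lebesgue_measure R \x @lebesgue_measure R]_(z in V)
              (bivariate_normal_pdf z)%:E)%E.

Lemma bivariate_normal_pdf_ge0 z : 0 <= bivariate_normal_pdf z.
Proof. by rewrite mulr_ge0 ?expR_ge0// invr_ge0 sqrtr_ge0. Qed.

Lemma measurable_bivariate_normal_pdf :
  measurable_fun setT (bivariate_normal_pdf : plane R -> measurableTypeR R).
Proof.
have mv j : measurable_fun setT (fun z : plane R => (row_of_plane z - m) ord0 j : R).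
  under eq_fun do rewrite !mxE.
  apply: measurable_funB; last exact: measurable_cst.
  by case: (j == ord0); [exact: measurable_fst|exact: measurable_snd].
apply: measurable_funM; first exact: measurable_cst.
apply: measurableT_comp; first exact: measurable_expR.
apply: measurable_funM; last exact: measurable_cst.
apply: (@measurableT_comp _ _ _ _ _ _ (@GRing.opp R)) => //.
under eq_fun do rewrite mxE.
apply: measurable_sum => j; apply: measurable_funM; last first.
  by under eq_fun do rewrite mxE; exact: mv.
under eq_fun do rewrite mxE.
by apply: measurable_sum => k; apply: measurable_funM => //; exact: measurable_cst.
Qed.

Let bivariate_normal0 : bivariate_normal set0 = 0%E.
Proof. exact: integral_set0. Qed.

Let bivariate_normal_ge0 V : (0 <= bivariate_normal V)%E.
Proof.
by apply: integral_ge0 => z _; rewrite lee_fin bivariate_normal_pdf_ge0.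
Qed.

Let bivariate_normal_sigma_additive : semi_sigma_additive bivariate_normal.
Proof.
move=> /= F mF tF mUF; rewrite /bivariate_normal ge0_integral_bigcup//=.
- apply: is_cvg_ereal_nneg_natsum_cond => k _ _; exact: bivariate_normal_ge0.
- apply/measurable_EFinP; apply: measurable_funTS.
  exact: measurable_bivariate_normal_pdf.
- by move=> z _; rewrite lee_fin bivariate_normal_pdf_ge0.
Qed.

HB.instance Definition _ := isMeasure.Build _ _ _ bivariate_normal
  bivariate_normal0 bivariate_normal_ge0 bivariate_normal_sigma_additive.

End BivariateNormal.

Section Probability.
Context d (T : measurableType d) (R : realType) (P : probability T R).

Definition independent_RVs (s : nat -> {RV P >-> R}) : Prop :=
  forall (J : seq nat) (B : nat -> set R), uniq J ->
    (forall j, measurable (B j)) ->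
    P (\bigcap_(j in [set` J]) (s j @^-1` B j)) =
    (\prod_(j <- J) P (s j @^-1` B j))%E.

Definition cvg_in_probability (X_ : nat -> T -> R) (c : R) : Prop :=
  forall eps : R, 0 < eps ->
    P [set w | eps <= `|X_ n w - c|] @[n --> \oo] --> 0%E.

Definition weak_cvg_in_probability
    (mu_ : nat -> T -> probability (plane R) R)
    (mu : {measure set (plane R) -> \bar R}) : Prop :=
  forall f : R * R -> R, continuous f ->
    (exists K : R, forall z, `|f z| <= K) ->
    cvg_in_probability (fun n w => \int[mu_ n w]_z f z) (\int[mu]_z f z).

End Probability.

Section SkewCirculant.
Variable R : realType.

Definition Scirc (n : nat) (s : nat -> R) : 'M[R]_n :=
  \matrix_(i < n, j < n)
    if (i <= j)%N then s (j - i)%N else - s (n + j - i)%N.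

(* n^{-1/2} Scirc(s_0, ..., s_{n-1}), as a complex matrix. *)
Definition scaled_Scirc (n : nat) (s : nat -> R) : 'M[R[i]]_n :=
  map_mx (real_complex R) ((Num.sqrt n%:R)^-1 *: Scirc n s).

End SkewCirculant.

(* Main.v *)
Require Import Defs.
From mathcomp Require Import all_boot all_order all_algebra.
From mathcomp Require Import all_classical all_reals all_analysis.
From mathcomp Require Import measurable_realfun complex ring lra zify.

Set Implicit Arguments.
Unset Strict Implicit.
Unset Printing Implicit Defensive.

Import Order.TTheory GRing.Theory Num.Theory.
Import numFieldNormedType.Exports.
Import Normc.

Local Open Scope classical_set_scope.
Local Open Scope ring_scope.
Local Open Scope complex_scope.

(** Let e_k, for k < n, be the n-th roots of -1. The sequences (e_k^m)_m turn the
    sign change of a skew-circulant matrix into a shift, so they diagonalise all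
    of them simultaneously: the eigenvalues of the normalised matrix are
    z_k = n^(-1/2) sum_m s_m e_k^m, the matrix is normal, and both parts of the
    theorem concern the means (1/n) sum_k f (z_k), for f a monomial in z and its
    conjugate in part (i), and f bounded and continuous in part (ii)
    ([trace_word], [esd_scirc]).

    The basic case is f (z) = cos (t . z + c). Then t . z_k is a linear form in
    the independent s_m with coefficients O(n^(-1/2)). The cosine and sine
    transforms of s_m at x equal exp (- x^2 / 2) and 0 up to o(x^2), uniformly in
    m, thanks to the moments of order 2 + delta ([cf_expansion]), and replacing
    the summands one by one gives the mean of cos (sum_m x_m s_m + c), which is
    exp (- sum x_m^2 / 2) cos c up to o(1) sum x_m^2 ([cos_lin_comb]). By
    orthogonality of the e_k the coefficients of Re z_k and Im z_k are orthogonal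
    of squared length 1/2, unless e_k is real, and those of different z_j, z_k
    are orthogonal unless e_j and e_k are conjugate ([wave_orthogonal]). So, for
    all but O(n) pairs, the mean of cos (t . z_j + c) cos (t . z_k + c) tends to
    the square of exp (- |t|^2 / 4) cos c, and (1/n) sum_k cos (t . z_k + c)
    converges to that number in mean square ([cos_L2]). The number is the integral
    of the cosine under the complex Gaussian law, by a differential equation in t
    ([gauss_cos], [gauss_XY_cos]).

    Linear combinations of these cosines form an algebra. Bernstein polynomials
    in (1 + sin (x / L)) / 2 lie in it and approximate a bounded continuous f
    uniformly on a large box, while respecting its bound on the whole plane
    ([trig_approx]); outside the box the mean of |z_k|^2, equal to 1 by Parseval,
    is used. Hence (1/n) sum_k f (z_k) converges to the Gaussian integral of f in
    mean ([bounded_cvg_mean]), which implies part (ii) by Markov's inequality.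

    For part (i), the even moments of the linear forms are bounded uniformly
    ([moment_bound]), so the convergence of the expectations extends by truncation
    to functions of polynomial growth ([growth_cvg_mean]), in particular to
    monomials. The limit variable is the random matrix of size one whose entry
    is the complex Gaussian variable on the plane ([gauss_rmx]). *)

(** * Random variables with moments of all orders *)

Section Moments.
Context d (T : measurableType d) (R : realType) (P : probability T R).

(** The real case is stated as an instance of the complex one, so that closure
    under sums and products is inherited. *)
Definition Mom (X : T -> R) := finite_moments P (fun w => (X w)%:C).

Lemma normc_real (x : R) : normc x%:C = `|x|.
Proof. by rewrite /normc /= expr0n /= addr0 sqrtr_sqr. Qed.

Lemma MomP (X : T -> R) : Mom X <->
  measurable_fun setT X /\
  forall k : nat, ('E_P[fun w => (`|X w| ^+ k)%R] < +oo)%E.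
Proof.
have H k : (fun w => normc (X w)%:C ^+ k) = (fun w => `|X w| ^+ k).
  by apply/funext => w; rewrite normc_real.
split=> [[mr mi f]|[m f]].
  by split => // k; rewrite -H; exact: f.
split; [exact: m|exact: measurable_cst|by move=> k; rewrite H; exact: f].
Qed.

Lemma Mom_meas X : Mom X -> measurable_fun setT X.
Proof. by move=> /MomP[]. Qed.

Lemma Mom_int X : Mom X -> P.-integrable setT (EFin \o X).
Proof. by move=> /fm_int[]. Qed.

Lemma Mom_cst (c : R) : Mom (fun=> c).
Proof. exact: fm_cst. Qed.

Lemma MomD X Y : Mom X -> Mom Y -> Mom (fun w => X w + Y w).
Proof.
move=> hX hY; have := fmD hX hY; rewrite /Mom.
by rewrite (_ : (fun _ => _) = fun w => (X w + Y w)%:C) //; apply/funext => w; rewrite rmorphD.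
Qed.

Lemma MomM X Y : Mom X -> Mom Y -> Mom (fun w => X w * Y w).
Proof.
move=> hX hY; have := fmM hX hY; rewrite /Mom.
by rewrite (_ : (fun _ => _) = fun w => (X w * Y w)%:C) //; apply/funext => w; rewrite rmorphM.
Qed.

Lemma MomZ c X : Mom X -> Mom (fun w => c * X w).
Proof. by move=> h; apply: MomM => //; exact: Mom_cst. Qed.

Lemma MomB X Y : Mom X -> Mom Y -> Mom (fun w => X w - Y w).
Proof.
move=> hX hY; have := MomD hX (MomZ (-1) hY).
by under eq_fun do rewrite mulN1r.
Qed.

Lemma MomX X k : Mom X -> Mom (fun w => X w ^+ k).
Proof.
move=> h; elim: k => [|k IH]; first exact: Mom_cst.
by under eq_fun do rewrite exprS; exact: MomM.
Qed.

Lemma Mom_sum (I : Type) (r : seq I) (F : I -> T -> R) :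
  (forall i, Mom (F i)) -> Mom (fun w => \sum_(i <- r) F i w).
Proof.
move=> h; elim: r => [|i r IH].
  by under eq_fun do rewrite big_nil; exact: Mom_cst.
by under eq_fun do rewrite big_cons; exact: MomD.
Qed.

Lemma Mom_bounded (X : T -> R) (c : R) : measurable_fun setT X -> (forall w, `|X w| <= c) ->
  Mom X.
Proof.
move=> mX Xc; apply/MomP; split => // k.
apply: (@le_lt_trans _ _ 'E_P[fun=> (c ^+ k)%R]%E); last first.
  by rewrite (@expectation_cst _ _ _ P (c ^+ k)) ltry.
rewrite !expectation.unlock; apply: ge0_le_integral => //.
- by apply/measurable_EFinP; apply: measurable_funX; exact: measurableT_comp.
- by move=> w _; rewrite lee_fin lerXn2r ?nnegrE// (le_trans _ (Xc w)).
Qed.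

Lemma Mom_dom (X Y : T -> R) : measurable_fun setT X -> Mom Y -> (forall w, `|X w| <= `|Y w|) ->
  Mom X.
Proof.
move=> mX /MomP[mY fY] XY; apply/MomP; split => // k.
apply: le_lt_trans (fY k).
rewrite !expectation.unlock; apply: ge0_le_integral => //.
- by apply/measurable_EFinP; apply: measurable_funX; exact: measurableT_comp.
- by apply/measurable_EFinP; apply: measurable_funX; exact: measurableT_comp.
- by move=> w _; rewrite lee_fin lerXn2r ?nnegrE.
Qed.

End Moments.

Section RealIntegral.
Context d (T : measurableType d) (R : realType) (mu : {measure set T -> \bar R}).

Lemma Rdominated_cvg (f_ : nat -> T -> R) (f g : T -> R) :
  (forall n, measurable_fun setT (f_ n)) ->
  (forall x, f_ ^~ x @ \oo --> f x) ->
  mu.-integrable setT (EFin \o g) ->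
  (forall n x, `|f_ n x| <= g x) ->
  mu.-integrable setT (EFin \o f) /\
  (\int[mu]_x f_ n x @[n --> \oo] --> \int[mu]_x f x).
Proof.
move=> mf cf ig fg.
have mf' n : measurable_fun setT (EFin \o f_ n) by exact/measurable_EFinP.
have mlim : measurable_fun setT f by apply: (measurable_fun_cvg mf) => x _; exact: cf.
have mfe : measurable_fun setT (EFin \o f) by exact/measurable_EFinP.
have cfe : {ae mu, forall x, setT x -> (EFin \o f_ n) x @[n --> \oo] --> (EFin \o f) x}.
  by apply: aeW => x _; apply: cvg_EFin; [exact: nearW|exact: cf].
have fge : {ae mu, forall x n, setT x -> (`|(EFin \o f_ n) x| <= (EFin \o g) x)%E}.
  by apply: aeW => x n _; rewrite lee_fin.
have [if_ _ h] := @dominated_convergence _ _ _ mu _ measurableT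
  (fun n => EFin \o f_ n) (EFin \o f) (EFin \o g) mf' mfe cfe ig fge.
split => //.
by apply: fine_cvg; rewrite fineK //; exact: integrable_fin_num.
Qed.

Lemma Rintegral_sum (I : Type) (r : seq I) (F : I -> T -> R) :
  (forall i, mu.-integrable setT (EFin \o F i)) ->
  \int[mu]_x (\sum_(i <- r) F i x) = \sum_(i <- r) \int[mu]_x F i x.
Proof.
move=> h; elim: r => [|i r IH].
  by under eq_Rintegral do rewrite big_nil; rewrite Rintegral_cst// mul0r big_nil.
under eq_Rintegral do rewrite big_cons.
rewrite RintegralD//; first by rewrite IH big_cons.
rewrite (_ : _ \o _ = fun x => (\sum_(i <- r) (F i x)%:E)%E).
  by apply: (@integrable_sum _ _ _ mu setT measurableT _ r xpredT (fun i => EFin \o F i)) => j _; exact: h.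
by apply/funext => x /=; rewrite sumEFin.
Qed.

Lemma integrable_mul_bounded (f g : T -> R) (c : R) :
  mu.-integrable setT (EFin \o f) -> measurable_fun setT g ->
  (forall x, `|g x| <= c) -> mu.-integrable setT (EFin \o (fun x => f x * g x)).
Proof.
move=> If mg gc.
have If2 : mu.-integrable setT (EFin \o (fun x => c * f x)).
  by rewrite (_ : _ \o _ = fun x => (c%:E * (f x)%:E)%E)//; exact: integrableZl.
apply: le_integrable If2 => //.
  apply/measurable_EFinP; apply: measurable_funM => //.
  by have /measurable_int/measurable_EFinP := If.
move=> x _; rewrite lee_fin !normrM mulrC ler_wpM2r//.
by rewrite (le_trans (gc x))// ler_norm.
Qed.

End RealIntegral.

(** * Independence of the past *)

Import HBNNSimple.

Section Orthogonality.
Context d d' (T : measurableType d) (T' : measurableType d') (R : realType).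
Variables (P : {measure set T -> \bar R}) (D : T -> R) (Y : T -> T').
Hypothesis mY : measurable_fun setT Y.
Hypothesis iD : P.-integrable setT (EFin \o D).
Hypothesis D0 : forall B, measurable B -> \int[P]_w (D w * \1_B (Y w)) = 0.

Let mD : measurable_fun setT D.
Proof. by have /measurable_int/measurable_EFinP := iD. Qed.

Let orth_ge0 (g : T' -> R) : measurable_fun setT g -> (forall y, 0 <= g y) ->
  P.-integrable setT (EFin \o (fun w => D w * g (Y w))) ->
  \int[P]_w (D w * g (Y w)) = 0.
Proof.
move=> mg g0 ig.
have mge : measurable_fun setT (EFin \o g) by exact/measurable_EFinP.
pose h := nnsfun_approx measurableT mge.
have hg n y : 0 <= h n y <= g y.
  apply/andP; split; first by [].
  by rewrite -lee_fin /h nnsfun_approxE; apply: le_approx => // ? _; rewrite lee_fin.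
have h0 n : \int[P]_w (D w * h n (Y w)) = 0.
  under eq_Rintegral do rewrite fimfunE fsbig_finite//= mulr_sumr.
  rewrite Rintegral_sum.
    rewrite big1_seq// => r _.
    under eq_Rintegral do rewrite mulrCA.
    have mB : measurable (h n @^-1` [set r]) by exact: measurable_sfunP.
    rewrite RintegralZl//; first by rewrite D0 ?mulr0.
    apply: (@integrable_mul_bounded _ _ _ _ _ _ 1) => //.
      by apply: measurableT_comp => //; exact: measurable_indic.
    by move=> x; rewrite indicE; case: (_ \in _); rewrite /= ?normr1 ?normr0.
  move=> r; have mB : measurable (h n @^-1` [set r]) by exact: measurable_sfunP.
  apply: (@integrable_mul_bounded _ _ _ _ _ _ `|r|) => //.
    apply: measurable_funM; first exact: measurable_cst.
    by apply: (@measurableT_comp _ _ _ _ _ _ (\1_(h n @^-1` [set r]) : T' -> R)) => //; exact: measurable_indic.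
  move=> x; rewrite normrM indicE.
  by case: (_ \in _); rewrite /= ?normr1 ?normr0 ?mulr1// mulr0.
have mh n : measurable_fun setT (fun w => D w * h n (Y w)).
  apply: measurable_funM => //; apply: (measurableT_comp (f := h n)) => //.
have ch w : D w * h n (Y w) @[n --> \oo] --> D w * g (Y w).
  apply: cvgM; first exact: cvg_cst.
  have := @cvg_nnsfun_approx _ _ _ _ measurableT _ mge (fun y _ => g0 y) (Y w) I.
  by move=> /fine_cvg.
have [|_ hc] := Rdominated_cvg mh ch (integrable_norm ig).
  move=> n w /=; rewrite !normrM ler_wpM2l//.
  by have /andP[h1 h2] := hg n (Y w); rewrite !ger0_norm// (le_trans h1).
move/cvg_lim : hc => <-//.
by under eq_fun do rewrite h0; rewrite lim_cst.
Qed.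

(** A function orthogonal to all indicators of events generated by [Y] is
    orthogonal to every function of [Y]: the identity passes to simple
    functions, and from them by dominated convergence. *)
Lemma orthogonal_comp (g : T' -> R) : measurable_fun setT g ->
  P.-integrable setT (EFin \o (fun w => D w * g (Y w))) ->
  \int[P]_w (D w * g (Y w)) = 0.
Proof.
move=> mg ig.
have mDg : measurable_fun setT (fun w => D w * g (Y w)).
  by apply: measurable_funM => //; exact: measurableT_comp.
pose gp y := Num.max (g y) 0; pose gn y := Num.max (- g y) 0.
have mgp : measurable_fun setT gp by apply: measurable_maxr => //; exact: measurable_cst.
have mgn : measurable_fun setT gn.
  by apply: measurable_maxr => //; apply: measurableT_comp.
have igp : P.-integrable setT (EFin \o (fun w => D w * gp (Y w))).
  apply: le_integrable ig => //.
    by apply/measurable_EFinP; apply: measurable_funM => //; exact: measurableT_comp.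
  move=> w _; rewrite lee_fin !normrM ler_wpM2l// /gp.
  by case: (leP (g (Y w)) 0) => h; rewrite ?normr0.
have ign : P.-integrable setT (EFin \o (fun w => D w * gn (Y w))).
  apply: le_integrable ig => //.
    by apply/measurable_EFinP; apply: measurable_funM => //; exact: measurableT_comp.
  move=> w _; rewrite lee_fin !normrM ler_wpM2l// /gn.
  by case: (leP (- g (Y w)) 0) => h; rewrite ?normr0// normrN.
rewrite -[RHS](subr0 0) -[X in X - _](orth_ge0 mgp _ igp); last first.
  by move=> y; rewrite le_max lexx orbT.
rewrite -[X in _ - X](orth_ge0 mgn _ ign); last first.
  by move=> y; rewrite le_max lexx orbT.
rewrite -RintegralB//; apply: eq_Rintegral => w _.
rewrite -mulrBr; congr (_ * _); rewrite /gp /gn.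
by case: (ltgtP (g (Y w)) 0) => h; case: (ltgtP (- g (Y w)) 0) => h'; lra.
Qed.

End Orthogonality.

Section Past.
Context d (T : measurableType d) (R : realType) (P : probability T R).
Variable s : nat -> {RV P >-> R}.

Definition future_indic (J : seq nat) (B : nat -> set R) (w : T) : R :=
  \prod_(j <- J) \1_(B j) (s j w).

(** [F] is uncorrelated with every event that depends on finitely many of the
    s_j, j >= n. Being linear in [F], this weak form of independence is closed
    under sums, and it is all that is needed to integrate the summands of a
    linear form out one at a time. *)
Definition Past n (F : T -> R) := Mom P F /\
  forall J B, uniq J -> all (leq n) J -> (forall j, measurable (B j)) ->
  \int[P]_w (F w * future_indic J B w) =
  \int[P]_w F w * \prod_(j <- J) fine (P (s j @^-1` B j)).

Lemma Past_Mom n F : Past n F -> Mom P F. Proof. by case. Qed.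

Lemma future_indicE J B w :
  future_indic J B w = \1_(\bigcap_(j in [set` J]) (s j @^-1` B j)) w.
Proof.
rewrite /future_indic indicE; case: (boolP (w \in _)) => /=.
  rewrite inE => h; rewrite big1_seq// => j /andP[_ jJ].
  by rewrite indicE mem_set//; exact: h.
rewrite notin_setE => h.
have [j [jJ nj]] : exists j, j \in J /\ ~ B j (s j w).
  apply: contrapT => h2; apply: h => j /= jJ; apply: contrapT => h3.
  by apply: h2; exists j.
rewrite (big_rem j)//= indicE memNset// ?mul0r//.
Qed.

Lemma measurable_future_indic J B : (forall j, measurable (B j)) ->
  measurable_fun setT (future_indic J B).
Proof.
move=> mB; apply: measurable_prod => j _.
by apply: (@measurableT_comp _ _ _ _ _ _ (\1_(B j) : R -> R)).
Qed.

Lemma future_indic_Mom J B : (forall j, measurable (B j)) ->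
  Mom P (future_indic J B).
Proof.
move=> mB; apply: (@Mom_bounded _ _ _ _ _ 1).
  exact: measurable_future_indic.
move=> w; rewrite future_indicE indicE.
by case: (_ \in _); rewrite /= ?normr1 ?normr0.
Qed.

Lemma Past0 c : independent_RVs s -> Past 0 (fun=> c).
Proof.
move=> ind; split; first exact: Mom_cst.
move=> J B uJ _ mB.
rewrite RintegralZl//; last exact: Mom_int (future_indic_Mom _ mB).
rewrite Rintegral_cst// (_ : fine _ = 1) ?mulr1; last first.
  by rewrite -[1]/(fine 1%E); congr fine; exact: probability_setT.
congr (_ * _).
under eq_Rintegral do rewrite future_indicE.
rewrite /Rintegral integral_indic//; last first.
  apply: fin_bigcap_measurable => // j _.
  by rewrite -[X in measurable X]setTI; exact: measurable_funP.
rewrite setIT; transitivity (fine (\prod_(j <- J) P (s j @^-1` B j))%E).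
  by congr fine; exact: ind.
elim: J {uJ} => [|j J IH]; first by rewrite !big_nil.
have fP i : P (s i @^-1` B i) \is a fin_num.
  by apply: fin_num_measure; rewrite -[X in measurable X]setTI; exact: measurable_funP.
rewrite !big_cons fineM ?IH//.
by apply: prode_fin_num => i _; exact: fP.
Qed.

Lemma PastS n F : Past n F -> Past n.+1 F.
Proof.
move=> [mF h]; split => // J B uJ aJ; apply: h => //.
by apply: sub_all aJ => j; exact: ltnW.
Qed.

Lemma PastD n F G : Past n F -> Past n G -> Past n (fun w => F w + G w).
Proof.
move=> [mF hF] [mG hG]; split; first exact: MomD.
move=> J B uJ aJ mB.
under eq_Rintegral do rewrite mulrDl.
have mi := future_indic_Mom J mB.
rewrite !RintegralD//; try exact: Mom_int mF; try exact: Mom_int mG.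
- by rewrite hF// hG// mulrDl.
- exact: Mom_int (MomM mF mi).
- exact: Mom_int (MomM mG mi).
Qed.

Lemma PastZ n F c : Past n F -> Past n (fun w => c * F w).
Proof.
move=> [mF hF]; split; first exact: MomZ.
move=> J B uJ aJ mB.
under eq_Rintegral do rewrite -mulrA.
have mi := future_indic_Mom J mB.
rewrite !RintegralZl//; [|exact: Mom_int|].
- by rewrite hF// mulrA.
- exact: Mom_int (MomM mF mi).
Qed.

Lemma Past_sum (I : Type) (r : seq I) n (F : I -> T -> R) : Past n (fun=> 0) ->
  (forall i, Past n (F i)) -> Past n (fun w => \sum_(i <- r) F i w).
Proof.
move=> h0 h; elim: r => [|i r IH].
  by under eq_fun do rewrite big_nil.
by under eq_fun do rewrite big_cons; exact: PastD.
Qed.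

(** For an indicator g this is the definition of [Past], with n added to the
    index set. In general, the difference between F times the future indicators
    and its mean is orthogonal to the indicators of s_n, hence to g (s_n). *)
Lemma Past_factor n F (g : R -> R) J B : Past n F -> measurable_fun setT g ->
  Mom P (fun w => g (s n w)) ->
  uniq J -> all (leq n.+1) J -> (forall j, measurable (B j)) ->
  \int[P]_w (F w * g (s n w) * future_indic J B w) =
  \int[P]_w F w * \int[P]_w g (s n w) * \prod_(j <- J) fine (P (s j @^-1` B j)).
Proof.
move=> [mF hF] mg Mg uJ aJ mB.
set k := \int[P]_w F w * \prod_(j <- J) fine (P (s j @^-1` B j)).
have mi := future_indic_Mom J mB.
have mD : Mom P (fun w => F w * future_indic J B w - k).
  by apply: MomB; [exact: MomM|exact: Mom_cst].
have := @orthogonal_comp _ _ _ _ _ P _ _ (measurable_funP (s n)) (Mom_int mD) _ g mg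
   (Mom_int (MomM mD Mg)).
have aJn : all (leq n) J by apply: sub_all aJ => j; exact: ltnW.
have H : forall B0 : set R, measurable B0 ->
    \int[P]_w ((F w * future_indic J B w - k) * \1_B0 (s n w)) = 0.
  move=> B0 mB0.
  have M1 : Mom P (fun w => \1_B0 (s n w) : R).
    apply: (@Mom_bounded _ _ _ _ _ 1).
      by apply: (@measurableT_comp _ _ _ _ _ _ (\1_B0 : R -> R)).
    by move=> w; rewrite indicE; case: (_ \in _); rewrite /= ?normr1 ?normr0.
  under eq_Rintegral do rewrite mulrBl -mulrA.
  rewrite RintegralB//; [|exact: Mom_int (MomM mF (MomM mi M1))|exact: Mom_int (MomZ _ M1)].
  pose B' j := if j == n then B0 else B j.
  have B'n : B' n = B0 by rewrite /B' eqxx.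
  have mB' j : measurable (B' j) by rewrite /B'; case: ifP.
  have nJ : n \notin J by apply/negP => /(allP aJ); rewrite ltnn.
  have eJ : {in J, forall j, B' j = B j}.
    by move=> j jJ; rewrite /B'; case: eqP => // jn; rewrite -jn jJ in nJ.
  have e1 w : F w * (future_indic J B w * \1_B0 (s n w)) =
      F w * future_indic (n :: J) B' w.
    rewrite /future_indic big_cons B'n.
    rewrite (eq_big_seq (fun j => \1_(B' j) (s j w))); first by ring.
    by move=> j /eJ ->.
  under eq_Rintegral do rewrite e1.
  rewrite (hF (n :: J) B')//=; [|by rewrite nJ uJ|by rewrite leqnn aJn].
  rewrite RintegralZl//; last exact: Mom_int.
  rewrite big_cons B'n (eq_big_seq (fun j => fine (P (s j @^-1` B j)))); last first.
    by move=> j /eJ ->.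
  rewrite (_ : \int[P]_w \1_B0 (s n w) = fine (P (s n @^-1` B0))); first by rewrite /k; ring.
  rewrite /Rintegral (eq_integral (EFin \o \1_(s n @^-1` B0))); last first.
    by move=> w _ /=; rewrite !indicE.
  rewrite integral_indic ?setIT//.
  by rewrite -[X in measurable X]setTI; exact: measurable_funP.
move=> /(_ H).
under eq_Rintegral do rewrite mulrBl mulrAC.
rewrite RintegralB//; [|exact: Mom_int (MomM (MomM mF Mg) mi)|exact: Mom_int (MomZ _ Mg)].
rewrite RintegralZl//; last exact: Mom_int.
by move/eqP; rewrite subr_eq0 => /eqP ->; rewrite /k; ring.
Qed.

Lemma Past_E n F (g : R -> R) : Past n F -> measurable_fun setT g ->
  Mom P (fun w => g (s n w)) ->
  \int[P]_w (F w * g (s n w)) = \int[P]_w F w * \int[P]_w g (s n w).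
Proof.
move=> pF mg Mg.
have := @Past_factor n F g [::] (fun=> set0) pF mg Mg isT isT (fun=> measurable0).
rewrite big_nil mulr1 => <-; apply: eq_Rintegral => w _.
by rewrite /future_indic big_nil mulr1.
Qed.

Lemma Past_mul n F (g : R -> R) : Past n F -> measurable_fun setT g ->
  Mom P (fun w => g (s n w)) -> Past n.+1 (fun w => F w * g (s n w)).
Proof.
move=> pF mg Mg; split; first by apply: MomM => //; exact: Past_Mom pF.
by move=> J B uJ aJ mB; rewrite (Past_factor pF)// (Past_E pF).
Qed.

End Past.

(** * Second order Taylor bounds *)

Section TrigBounds.
Variable R : realType.
Implicit Types x y u : R.

Lemma cos_half x : 1 - cos x = 2 * sin (x / 2) ^+ 2.
Proof.
have -> : cos x = cos ((x / 2) *+ 2) by congr cos; rewrite mulr2n; lra.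
by rewrite cos_mulr2n cos2sin2; ring.
Qed.

(** The mean value theorem, in the form used for Taylor bounds. *)
Lemma MVT_bound (f df : R -> R) x (c : R) : 0 <= x ->
  (forall y, is_derive y 1 f (df y)) -> f 0 = 0 ->
  (forall y, 0 <= y <= x -> `|df y| <= c) -> `|f x| <= c * x.
Proof.
rewrite le_eqVlt => /predU1P[<- _ f0 _|x0 dff f0 dfc].
  by rewrite f0 normr0 mulr0.
have [|y yx] := @MVT R f df 0 x x0 (fun y _ => dff y).
  by apply: derivable_within_continuous => y _; have [] := dff y.
rewrite f0 !subr0 => ->; rewrite normrM (gtr0_norm x0) ler_wpM2r ?(ltW x0)//.
by apply: dfc; move: yx; rewrite in_itv /= => /andP[/ltW -> /ltW ->].
Qed.

Lemma abs_sin_le x : `|sin x| <= `|x|.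
Proof.
wlog x0 : x / 0 <= x => [h|].
  have [/h//|/ltW x0] := leP 0 x.
  by rewrite -(normrN x) -(normrN (sin x)) -sinN h// oppr_ge0.
rewrite (ger0_norm x0) -[leRHS]mul1r.
apply: (@MVT_bound _ cos) => //; first exact: sin0.
by move=> y _; exact: cos_max.
Qed.

Lemma one_sub_cos_ge0 x : 0 <= 1 - cos x.
Proof. by rewrite subr_ge0 cos_le1. Qed.

Lemma one_sub_cos_le x : 1 - cos x <= x ^+ 2 / 2.
Proof.
rewrite cos_half.
have : sin (x / 2) ^+ 2 <= (x / 2) ^+ 2.
  rewrite -[leLHS]real_normK ?num_real// -[leRHS]real_normK ?num_real//.
  by rewrite lerXn2r ?nnegrE// abs_sin_le.
lra.
Qed.

Lemma abs_sin_sub_le x : `|sin x - x| <= `|x| ^+ 3.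
Proof.
wlog x0 : x / 0 <= x => [h|].
  have [/h//|/ltW x0] := leP 0 x.
  rewrite -(normrN x) -(normrN (sin x - x)).
  have -> : - (sin x - x) = sin (- x) - (- x) by rewrite sinN; ring.
  by rewrite h// oppr_ge0.
rewrite (ger0_norm x0) exprSr.
apply: (@MVT_bound (fun y => sin y - y) (fun y => cos y - 1)) => //.
  by rewrite sin0 subr0.
move=> y /andP[y0 yx].
rewrite distrC (ger0_norm (one_sub_cos_ge0 y)) (le_trans (one_sub_cos_le y))//.
have : y ^+ 2 <= x ^+ 2 by rewrite lerXn2r ?nnegrE.
have : 0 <= y ^+ 2 by exact: sqr_ge0.
lra.
Qed.

(** [taylor_rem y], the minimum of y^2 and |y|^3, is the size of the remainder
    of the second order expansions of cosine and sine; integrated, it needs only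
    slightly more than a second moment to be small. *)
Definition taylor_rem y := Num.min (y ^+ 2) (`|y| ^+ 3).

Lemma cos_taylor y : `|cos y - 1 + y ^+ 2 / 2| <= taylor_rem y.
Proof.
have h1 := one_sub_cos_le y; have h2 := one_sub_cos_ge0 y.
have y2 := sqr_ge0 y.
have -> : cos y - 1 + y ^+ 2 / 2 = y ^+ 2 / 2 - (1 - cos y) by ring.
rewrite ger0_norm; last by rewrite subr_ge0.
rewrite /taylor_rem le_min; apply/andP; split; first by lra.
have [u yE] : exists u, u = y / 2 by eexists.
rewrite cos_half -yE; have -> : y = 2 * u by lra.
have a1 := abs_sin_le u; have a2 := abs_sin_sub_le u.
have -> : `|2 * u| ^+ 3 = 8 * `|u| ^+ 3.
  by rewrite normrM exprMn (ger0_norm (ler0n _ 2)) -natrX.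
have [u1|/ltW u1] := leP `|u| 1.
  have -> : (2 * u) ^+ 2 / 2 - 2 * sin u ^+ 2 = 2 * ((u - sin u) * (u + sin u)) by field.
  apply: (le_trans (ler_norm _)); rewrite !normrM (ger0_norm (ler0n _ 2)) [`|u - _|]distrC.
  have : `|sin u - u| * `|u + sin u| <= `|u| ^+ 3 * 2.
    apply: ler_pM => //; apply: (le_trans (ler_normD _ _)).
    by apply: le_trans (_ : `|u| + `|u| <= _); [exact: lerD|lra].
  have : 0 <= `|u| ^+ 3 by rewrite exprn_ge0.
  lra.
have : 0 <= sin u ^+ 2 by exact: sqr_ge0.
have : `|u| ^+ 2 <= `|u| ^+ 3 by apply: ler_weXn2l.
have e2 : (2 * u) ^+ 2 = 4 * `|u| ^+ 2 by rewrite real_normK ?num_real//; ring.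
have := exprn_ge0 2 (normr_ge0 u).
rewrite e2; lra.
Qed.

Lemma sin_taylor y : `|sin y - y| <= 2 * taylor_rem y.
Proof.
have a1 := abs_sin_le y; have a2 := abs_sin_sub_le y.
rewrite /taylor_rem; have y3 := exprn_ge0 3 (normr_ge0 y).
rewrite -[y ^+ 2]real_normK ?num_real//.
have [y1|/ltW y1] := leP `|y| 1.
  have : `|y| ^+ 3 <= `|y| ^+ 2 by apply: ler_wiXn2l.
  move=> h; rewrite (min_idPr h); lra.
have : `|y| ^+ 2 <= `|y| ^+ 3 by apply: ler_weXn2l.
move=> h; rewrite (min_idPl h).
have : `|y| <= `|y| ^+ 2 by rewrite -[leLHS]expr1; apply: ler_weXn2l.
have := ler_normB (sin y) y; lra.
Qed.

Lemma expR_taylor u : 0 <= u -> `|expR (- u) - 1 + u| <= u ^+ 2.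
Proof.
move=> u0; have := expR_ge1Dx (- u) => h1.
rewrite ger0_norm; last by lra.
have h2 := expR_ge1Dx u.
have e0 := expR_gt0 (- u).
have : expR (- u) * (1 + u) <= 1.
  by rewrite -[leRHS](expRxMexpNx_1 u) mulrC ler_wpM2r ?(ltW e0)//.
have up : 0 < 1 + u by lra.
have u3 : 0 <= u ^+ 3 by rewrite exprn_ge0.
move=> h; rewrite -(ler_pM2r up).
have -> : u ^+ 2 * (1 + u) = u ^+ 2 + u ^+ 3 by ring.
nra.
Qed.

End TrigBounds.

(** * The spectrum of a skew-circulant matrix *)

Section Expi.
Variable R : realType.

Definition expi (t : R) : R[i] := cos t +i* sin t.

Lemma expiD (a b : R) : expi (a + b) = expi a * expi b.
Proof.
rewrite /expi cosD sinD; simpc; apply/eqP; rewrite eq_complex /=.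
by apply/andP; split; apply/eqP; ring.
Qed.

Lemma expi0 : expi 0 = 1.
Proof. by rewrite /expi cos0 sin0. Qed.

Lemma expi_nat (a : R) n : expi (a * n%:R) = expi a ^+ n.
Proof.
elim: n => [|n IH]; first by rewrite mulr0 expi0 expr0.
by rewrite -natr1 mulrDr mulr1 expiD IH exprSr.
Qed.

Lemma conj_expi (t : R) : Num.conj (expi t) = expi (- t).
Proof. by rewrite /expi cosN sinN. Qed.

Lemma expi_pi : expi pi = -1.
Proof. by rewrite /expi cospi sinpi; apply/eqP; rewrite eq_complex /= oppr0 !eqxx. Qed.

Lemma expi_2pi_nat k : expi (2 * pi * k%:R) = 1.
Proof.
rewrite expi_nat mulr_natl mulr2n expiD expi_pi mulrNN mulr1 expr1n//.
Qed.

Lemma expi_neq1 (l n : nat) : (0 < l < n)%N -> expi (2 * pi * l%:R / n%:R) != 1.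
Proof.
move=> /andP[l0 ln]; apply/eqP => h.
have n0 : 0 < n%:R :> R by rewrite ltr0n (leq_trans _ ln).
pose a : R := pi * l%:R / n%:R.
have e : 2 * pi * l%:R / n%:R = a *+ 2 by rewrite /a mulr2n; ring.
move: h; rewrite e => /(congr1 (@complex.Re R)) /=.
rewrite cos_mulr2n cos2sin2 => h.
have /eqP : sin a ^+ 2 = 0 by lra.
rewrite expf_eq0 /= => /eqP sa.
have : 0 < sin a.
  apply: sin_gt0_pi; apply/andP; split.
    by rewrite divr_gt0// mulr_gt0 ?pi_gt0// ltr0n.
  by rewrite ltr_pdivrMr// ltr_pM2l ?pi_gt0// ltr_nat.
by rewrite sa ltxx.
Qed.

Lemma geom_sum0 (n : nat) (x : R[i]) : x != 1 -> x ^+ n = 1 -> \sum_(m < n) x ^+ m = 0.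
Proof.
move=> x1 xn; have := subrX1 x n; rewrite xn subrr => /esym/eqP.
by rewrite mulf_eq0 subr_eq0 (negbTE x1) => /eqP.
Qed.

(** A geometric series in a root of unity; the range 0 < l < 2n covers
    both the sums and, after adding n, the differences of two indices below n. *)
Lemma expi_sum0 (l n : nat) : (0 < l < n.*2)%N -> l != n ->
  \sum_(m < n) expi (2 * pi * l%:R / n%:R * m%:R) = 0.
Proof.
move=> /andP[l0 l2] ln.
have n0 : n%:R != 0 :> R by rewrite pnatr_eq0; lia.
under eq_bigr do rewrite expi_nat.
apply: geom_sum0.
  have [lln|nll|/eqP] := ltngtP l n; last by rewrite (negbTE ln).
    by apply: expi_neq1; rewrite l0.
  have -> : 2 * pi * l%:R / n%:R = 2 * pi * (l - n)%:R / n%:R + 2 * pi * 1%:R :> R.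
    by rewrite natrB ?(ltnW nll)//; field.
  rewrite expiD expi_2pi_nat mulr1; apply: expi_neq1; lia.
by rewrite -expi_nat divfK// expi_2pi_nat.
Qed.

(** The arguments of the n-th roots of -1. *)
Definition theta (n j : nat) : R := pi * j.*2.+1%:R / n%:R.

Lemma expi_theta_n n j : (0 < n)%N -> expi (theta n j * n%:R) = -1.
Proof.
move=> n0; rewrite /theta divfK ?pnatr_eq0 -?lt0n//.
by rewrite -natr1 mulrDr mulr1 expiD expi_pi -mul2n natrM mulrA [pi * 2]mulrC expi_2pi_nat mul1r.
Qed.

Lemma theta_sum0 n j k : (j < n)%N -> (k < n)%N -> (j + k).+1 != n ->
  \sum_(m < n) expi ((theta n j + theta n k) * m%:R) = 0.
Proof.
move=> jn kn jk.
rewrite -[RHS](@expi_sum0 (j + k).+1 n)//; last by apply/andP; split; lia.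
apply: eq_bigr => m _; congr (expi (_ * _)).
have n0 : n%:R != 0 :> R by rewrite pnatr_eq0; lia.
by rewrite /theta -!mul2n -!natr1 !natrM !natrD; field.
Qed.

Lemma theta_diff_sum0 n j k : (j < n)%N -> (k < n)%N -> j != k ->
  \sum_(m < n) expi ((theta n j - theta n k) * m%:R) = 0.
Proof.
move=> jn kn jk.
rewrite -[RHS](@expi_sum0 (j + n - k) n)//; [|by apply/andP; split; lia|lia].
apply: eq_bigr => m _.
have n0 : n%:R != 0 :> R by rewrite pnatr_eq0; lia.
have -> : 2 * pi * (j + n - k)%:R / n%:R * m%:R =
    (theta n j - theta n k) * m%:R + 2 * pi * m%:R :> R.
  rewrite natrB; last lia.
  by rewrite /theta -!mul2n -!natr1 !natrM !natrD; field.
by rewrite expiD expi_2pi_nat mulr1.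
Qed.

Definition wave (t1 t2 : R) (n j m : nat) : R :=
  t1 * cos (theta n j * m%:R) + t2 * sin (theta n j * m%:R).

Let Re_sum (I : Type) (r : seq I) (F : I -> R[i]) :
  complex.Re (\sum_(i <- r) F i) = \sum_(i <- r) complex.Re (F i).
Proof. by rewrite raddf_sum. Qed.

Let Im_sum (I : Type) (r : seq I) (F : I -> R[i]) :
  complex.Im (\sum_(i <- r) F i) = \sum_(i <- r) complex.Im (F i).
Proof. by rewrite raddf_sum. Qed.

(** Orthogonality of the waves: away from the antidiagonal j + k + 1 = n, the
    coefficient vectors of the real and imaginary parts of the eigenvalues are
    orthogonal and of the same length. *)
Lemma wave_orthogonal t1 t2 n j k : (j < n)%N -> (k < n)%N -> (j + k).+1 != n ->
  \sum_(m < n) wave t1 t2 n j m * wave t1 t2 n k m =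
  if j == k then n%:R * (t1 ^+ 2 + t2 ^+ 2) / 2 else 0.
Proof.
move=> jn kn jk.
have s1 := theta_sum0 jn kn jk.
have c1 : \sum_(m < n) cos ((theta n j + theta n k) * m%:R) = 0.
  by have := congr1 (@complex.Re R) s1; rewrite Re_sum.
have c2 : \sum_(m < n) sin ((theta n j + theta n k) * m%:R) = 0.
  by have := congr1 (@complex.Im R) s1; rewrite Im_sum.
rewrite (eq_bigr (fun m : 'I_n =>
   (t1 ^+ 2 + t2 ^+ 2) / 2 * cos ((theta n j - theta n k) * m%:R) +
   ((t1 ^+ 2 - t2 ^+ 2) / 2 * cos ((theta n j + theta n k) * m%:R) +
    t1 * t2 * sin ((theta n j + theta n k) * m%:R)))); last first.
  move=> m _; rewrite /wave.
  have -> : (theta n j - theta n k) * m%:R = theta n j * m%:R - theta n k * m%:R by ring.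
  have -> : (theta n j + theta n k) * m%:R = theta n j * m%:R + theta n k * m%:R by ring.
  by rewrite cosB cosD sinD; field.
rewrite !big_split /= -!mulr_sumr c1 c2 !mulr0 !addr0.
case: eqP => [->|/eqP njk].
  under eq_bigr do rewrite subrr mul0r cos0.
  by rewrite sumr_const card_ord -mulr_natl; ring.
have s2 := theta_diff_sum0 jn kn njk.
have -> : \sum_(m < n) cos ((theta n j - theta n k) * m%:R) = 0.
  by have := congr1 (@complex.Re R) s2; rewrite Re_sum.
by rewrite mulr0.
Qed.

End Expi.

Section Spectrum.
Variables (R : realType) (n : nat).
Local Notation N := n.+1.
Variable u : nat -> R.
Local Notation C := R[i].

Definition scirc_ev (j : nat) : C :=
  \sum_(m < N) (u m)%:C * expi (theta R N j * m%:R).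

Definition fourier_mx : 'M[C]_N := \matrix_(i, j) expi (theta R N j * i%:R).
Local Notation F := fourier_mx.
Local Notation S := (map_mx (real_complex R) (Scirc N u)).

Lemma fourier_star_mul : map_mx Num.conj F^T *m F = N%:R%:M.
Proof.
apply/matrixP => j k; rewrite !mxE.
rewrite (eq_bigr (fun i : 'I_N => expi ((theta R N k - theta R N j) * i%:R))); last first.
  by move=> i _; rewrite !mxE conj_expi -expiD; congr expi; ring.
have [->|jk] := eqVneq j k.
  under eq_bigr do rewrite subrr mul0r expi0.
  by rewrite sumr_const card_ord mulr1n.
by rewrite theta_diff_sum0 ?mulr0n// eq_sym.
Qed.

Lemma fourier_unit : F \in unitmx.
Proof.
suff /mulmx1_unit[_] : (N%:R^-1 *: map_mx Num.conj F^T) *m F = 1%:M by [].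
by rewrite -scalemxAl fourier_star_mul scale_scalar_mx mulVf// pnatr_eq0.
Qed.

Lemma invmx_fourier : invmx F = N%:R^-1 *: map_mx Num.conj F^T.
Proof.
have h : (N%:R^-1 *: map_mx Num.conj F^T) *m F = 1%:M.
  by rewrite -scalemxAl fourier_star_mul scale_scalar_mx mulVf// pnatr_eq0.
by rewrite -[RHS]mulmx1 -(mulmxV fourier_unit) mulmxA h mul1mx.
Qed.

(** Along a column of the Fourier matrix at the roots of -1, entries extend to a
    sequence e with e (N + m) = - e m. The sign of the wrapped entries of the
    skew-circulant matrix is thus absorbed, and each row acts as a translate of
    the first one. *)
Lemma mul_scirc_fourier : S *m F = F *m diag_mx (\row_j scirc_ev j).
Proof.
apply/matrixP => i k; rewrite mul_mx_diag !mxE /scirc_ev.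
pose e (m : nat) : C := expi (theta R N k * m%:R).
have eN m : e (N + m)%N = - e m.
  by rewrite /e natrD mulrDr expiD expi_theta_n// mulN1r.
have iN := ltn_ord i.
rewrite mulr_sumr.
rewrite [RHS](eq_bigr (fun m : 'I_N => (u m)%:C * e (m + i)%N)); last first.
  by move=> m _; rewrite mulrCA -expiD; congr (_ * expi _); rewrite natrD; ring.
rewrite [LHS](eq_bigr (fun j : 'I_N =>
   (if (i <= j)%N then u (j - i)%N else - u (N + j - i)%N)%:C * e j)); last first.
  by move=> j _; rewrite !mxE.
rewrite -(big_mkord xpredT (fun j => (if (i <= j)%N then u (j - i)%N else - u (N + j - i)%N)%:C * e j)).
rewrite -(big_mkord xpredT (fun m => (u m)%:C * e (m + i)%N)).
rewrite (@big_cat_nat _ _ _ i)//=; last exact: ltnW.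
rewrite [RHS](@big_cat_nat _ _ _ (N - i))//=; last by rewrite leq_subr.
rewrite addrC; congr (_ + _).
  rewrite -{1}[nat_of_ord i]add0n big_addn; apply: eq_big_nat => m _.
  by rewrite leq_addl addnK.
rewrite -{1}[(N - i)%N]add0n big_addn subKn; last exact: ltnW.
apply: eq_big_nat => m /andP[_ mi].
have -> : (i <= m)%N = false by rewrite leqNgt mi.
have -> : (m + (N - i) + i)%N = (N + m)%N by lia.
rewrite eN; have -> : (N + m - i)%N = (m + (N - i))%N by lia.
by rewrite rmorphN mulNr mulrN.
Qed.

Lemma scirc_similar : S = F *m diag_mx (\row_j scirc_ev j) *m invmx F.
Proof. by rewrite -mul_scirc_fourier mulmxK// fourier_unit. Qed.

Lemma scirc_char_poly : char_poly S = \prod_(j < N) ('X - (scirc_ev j)%:P).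
Proof.
pose D : 'M[C]_N := diag_mx (\row_j scirc_ev j).
have -> : \prod_(j < N) ('X - (scirc_ev j)%:P) = char_poly D.
  rewrite char_poly_trig; last exact: diag_mx_is_trig.
  by apply: eq_bigr => j _; rewrite !mxE eqxx mulr1n.
pose F' := map_mx (polyC : C -> {poly C}) F.
have detF : \det F' != 0.
  rewrite det_map_mx polyC_eq0; have := fourier_unit.
  by rewrite unitmxE unitfE.
apply: (mulIf detF); rewrite /char_poly -[LHS]det_mulmx.
rewrite [RHS]mulrC -[RHS]det_mulmx; congr (\det _).
rewrite /char_poly_mx mulmxBl mulmxBr -!map_mxM mul_scirc_fourier.
by rewrite scalar_mxC.
Qed.

(** The list of eigenvalues is defined by a choice of roots of the characteristic
    polynomial, hence known up to order only, which is enough for symmetric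
    functions. *)
Lemma eigenvalues_scirc : perm_eq (eigenvalues S) [seq scirc_ev j | j <- iota 0 N].
Proof.
apply: prod_XsubC_eq; rewrite -char_poly_eigenvalues scirc_char_poly big_map.
by rewrite -(big_mkord xpredT (fun j => 'X - (scirc_ev j)%:P)) /index_iota subn0.
Qed.

Lemma scirc_star_fourier :
  map_mx Num.conj S^T *m F = F *m diag_mx (\row_j Num.conj (scirc_ev j)).
Proof.
have e : map_mx Num.conj (invmx F)^T = N%:R^-1 *: F.
  apply/matrixP => i j; rewrite invmx_fourier !mxE rmorphM fmorphV rmorph_nat /=.
  by rewrite conjCK.
rewrite {1}scirc_similar !trmx_mul tr_diag_mx !map_mxM map_diag_mx e.
rewrite -!mulmxA fourier_star_mul.
rewrite mul_mx_scalar -scalemxAr -scalemxAl scalerA mulfV ?pnatr_eq0// scale1r.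
by congr (_ *m diag_mx _); apply/rowP => j; rewrite !mxE.
Qed.

(** The matrix and its adjoint are diagonal in the same basis, so only the numbers
    of letters of each kind matter. *)
Lemma trace_word (Q : seq bool) :
  \tr (\big[mulmx/1%:M]_(b <- Q) (if b then map_mx Num.conj S^T else S)) =
  \sum_(j < N) scirc_ev j ^+ count negb Q * Num.conj (scirc_ev j) ^+ count id Q.
Proof.
have H : (\big[mulmx/1%:M]_(b <- Q) (if b then map_mx Num.conj S^T else S)) *m F =
    F *m diag_mx (\row_j (scirc_ev j ^+ count negb Q * Num.conj (scirc_ev j) ^+ count id Q)).
  elim: Q => [|b Q IH].
    rewrite big_nil mul1mx (_ : \row_j _ = const_mx 1) ?diag_const_mx ?mulmx1//.
    by apply/rowP => j; rewrite !mxE mulr1.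
  rewrite big_cons -mulmxA IH; case: b.
    rewrite mulmxA scirc_star_fourier -mulmxA mulmx_diag; congr (_ *m diag_mx _).
    by apply/rowP => j; rewrite !mxE /= exprS mulrCA.
  rewrite mulmxA mul_scirc_fourier -mulmxA mulmx_diag; congr (_ *m diag_mx _).
  by apply/rowP => j; rewrite !mxE /= exprS mulrA.
set W := \big[_/_]_(b <- Q) _ in H *.
have -> : W = F *m diag_mx (\row_j (scirc_ev j ^+ count negb Q *
   Num.conj (scirc_ev j) ^+ count id Q)) *m invmx F by rewrite -H mulmxK// fourier_unit.
rewrite mxtrace_mulC mulmxA mulVmx ?fourier_unit// mul1mx mxtrace_diag.
by apply: eq_bigr => j _; rewrite mxE.
Qed.

Lemma esd_point_scirc j : esd_point (scirc_ev j) =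
  (\sum_(m < N) u m * cos (theta R N j * m%:R), \sum_(m < N) u m * sin (theta R N j * m%:R)).
Proof.
rewrite /esd_point /scirc_ev !raddf_sum; congr (_, _); apply: eq_bigr => m _;
  by rewrite /expi /=; simpc.
Qed.

End Spectrum.

(** * Cosine transforms of linear forms *)

Section RIntegrable.
Context d (T : measurableType d) (R : realType) (mu : {measure set T -> \bar R}).

Lemma RintegrableZ (k : R) (g : T -> R) : mu.-integrable setT (EFin \o g) ->
  mu.-integrable setT (EFin \o (fun w => k * g w)).
Proof.
by move=> h; rewrite (_ : _ \o _ = fun w => (k%:E * (g w)%:E)%E)//; exact: integrableZl.
Qed.

Lemma RintegrableD (f g : T -> R) : mu.-integrable setT (EFin \o f) ->
  mu.-integrable setT (EFin \o g) ->
  mu.-integrable setT (EFin \o (fun w => f w + g w)).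
Proof.
move=> hf hg; rewrite (_ : _ \o _ = (EFin \o f) \+ (EFin \o g))%E//.
exact: integrableD.
Qed.

End RIntegrable.

Section MomentConversion.
Context d (T : measurableType d) (R : realType) (P : probability T R).

Lemma ge0_int_fin (X : T -> R) : measurable_fun setT X -> (forall w, 0 <= X w) ->
  ('E_P[X] < +oo)%E -> P.-integrable setT (EFin \o X).
Proof.
move=> mX X0; rewrite expectation.unlock => h; apply/integrableP; split.
  exact/measurable_EFinP.
under eq_integral do rewrite /= ger0_norm//.
exact: h.
Qed.

Lemma standard_moments (X : T -> R) : measurable_fun setT X ->
  ('E_P[X] = 0)%E -> ('E_P[fun w => (X w ^+ 2)%R] = 1)%E ->
  [/\ P.-integrable setT (EFin \o X), P.-integrable setT (EFin \o (fun w => X w ^+ 2)),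
      \int[P]_w X w = 0 & \int[P]_w (X w ^+ 2) = 1].
Proof.
move=> mX e1 e2.
have i2 : P.-integrable setT (EFin \o (fun w => X w ^+ 2)).
  apply: ge0_int_fin; [exact: measurable_funX|by move=> w; exact: sqr_ge0|].
  by rewrite e2 ltry.
have i1 : P.-integrable setT (EFin \o X).
  have i3 : P.-integrable setT (EFin \o (fun w => 1 + X w ^+ 2)).
    rewrite (_ : _ \o _ = fun w => ((EFin \o cst 1%R) w + (EFin \o (fun w => (X w ^+ 2)%R)) w)%E)//.
    by apply: integrableD => //; exact: finite_measure_integrable_cst.
  apply: le_integrable i3 => //; first exact/measurable_EFinP.
  move=> w _; rewrite lee_fin [leRHS]ger0_norm; last by rewrite addr_ge0 ?sqr_ge0.
  rewrite -[X w ^+ 2]real_normK ?num_real//.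
  have := sqr_ge0 (`|X w| - 1); have := normr_ge0 (X w); nra.
split => //.
- by move: e1; rewrite expectation.unlock /Rintegral => ->.
- by move: e2; rewrite expectation.unlock /Rintegral => ->.
Qed.

Lemma sup_bound (f : nat -> \bar R) : (forall j, 0 <= f j)%E ->
  (ereal_sup (range f) < +oo)%E ->
  exists2 M : R, 0 <= M & forall j, (f j <= M%:E)%E.
Proof.
move=> f0 h.
have sf j : (f j <= ereal_sup (range f))%E by apply: ereal_sup_ubound; exists j.
have s0 : (0 <= ereal_sup (range f))%E by exact: le_trans (f0 0%N) (sf 0%N).
exists (fine (ereal_sup (range f))); first exact: fine_ge0.
by move=> j; rewrite fineK// ge0_fin_numE.
Qed.

End MomentConversion.

Section CosineTransform.
Context d (T : measurableType d) (R : realType) (P : probability T R).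

(** Truncation at level K: below K the cubic bound is used, above K the quadratic
    one, paid for by the moment of order 2 + delta. *)
Lemma taylor_rem_split (K delta x y : R) : 0 < K -> 0 < delta ->
  taylor_rem (x * y) <=
  x ^+ 2 * (K * `|x| * y ^+ 2 + K `^ (- delta) * `|y| `^ (2 + delta)).
Proof.
move=> K0 d0; have Kd : 0 <= K `^ (- delta) * `|y| `^ (2 + delta).
  by rewrite mulr_ge0 ?powR_ge0.
have [yK|Ky] := leP `|y| K.
  apply: (@le_trans _ _ (`|x * y| ^+ 3)); first by rewrite /taylor_rem ge_min lexx orbT.
  rewrite -[x ^+ 2]real_normK ?num_real// -[y ^+ 2]real_normK ?num_real//.
  rewrite normrM exprMn.
  have -> : `|x| ^+ 3 * `|y| ^+ 3 = `|x| ^+ 2 * (`|y| * `|x| * `|y| ^+ 2) by ring.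
  rewrite ler_wpM2l ?sqr_ge0// -[leLHS]addr0 lerD// ler_wpM2r ?sqr_ge0//.
  by rewrite ler_wpM2r.
apply: (@le_trans _ _ ((x * y) ^+ 2)); first by rewrite /taylor_rem ge_min lexx.
rewrite exprMn ler_wpM2l ?sqr_ge0//.
apply: (@le_trans _ _ (K `^ (- delta) * `|y| `^ (2 + delta))); last first.
  by rewrite lerDr mulr_ge0 ?sqr_ge0// mulr_ge0// ltW.
rewrite powRD; last by apply/implyP => _; rewrite gt_eqF// (lt_trans K0).
rewrite -[y ^+ 2]real_normK ?num_real// powR_mulrn//.
rewrite mulrCA ler_peMr ?sqr_ge0// powRN mulrC ler_pdivlMr ?powR_gt0// mul1r.
by apply: ge0_ler_powR; [exact: ltW|rewrite nnegrE ltW|rewrite nnegrE|exact: ltW].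
Qed.

Lemma measurable_cos_lin (x c : R) : measurable_fun setT (fun y : R => cos (x * y + c)).
Proof.
apply: continuous_measurable_fun => y.
apply: (@continuous_comp _ _ _ (fun y => x * y + c) cos); last exact: continuous_cos.
by apply: cvgD; [apply: cvgM; [exact: cvg_cst|exact: cvg_id]|exact: cvg_cst].
Qed.

Lemma measurable_cos_mul (x : R) : measurable_fun setT (fun y : R => cos (x * y)).
Proof. by have := measurable_cos_lin x 0; under eq_fun do rewrite addr0. Qed.

Lemma measurable_sin_lin (x : R) : measurable_fun setT (fun y : R => sin (x * y)).
Proof.
apply: continuous_measurable_fun => y.
apply: (@continuous_comp _ _ _ (fun y => x * y) sin); last exact: continuous_sin.
by apply: cvgM; [exact: cvg_cst|exact: cvg_id].
Qed.

Variable (s : nat -> {RV P >-> R}).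

(** The first two terms of the expansion of the characteristic functions at 0,
    uniformly in j. The comparison is with exp (- x^2 / 2) rather than with
    1 - x^2 / 2, so that products over the summands multiply exactly. *)
Definition small_cf (eps eta : R) := forall j x, `|x| <= eta ->
  `|\int[P]_w cos (x * s j w) - expR (- (x ^+ 2 / 2))| <= eps * x ^+ 2 /\
  `|\int[P]_w sin (x * s j w)| <= eps * x ^+ 2.

Lemma cos_Mom j x : Mom P (fun w => cos (x * s j w)).
Proof.
apply: (@Mom_bounded _ _ _ _ _ 1); last by move=> w; exact: cos_max.
by apply: (measurableT_comp (measurable_cos_mul x)); exact: measurable_funP.
Qed.

Lemma sin_Mom j x : Mom P (fun w => sin (x * s j w)).
Proof.
apply: (@Mom_bounded _ _ _ _ _ 1); last by move=> w; exact: sin_max.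
by apply: (measurableT_comp (measurable_sin_lin x)); exact: measurable_funP.
Qed.

Lemma cf_expansion (delta M eps : R) : 0 < delta -> 0 < eps ->
  (forall j, 'E_P[s j] = 0)%E ->
  (forall j, 'E_P[fun w => (s j w ^+ 2)%R] = 1)%E ->
  (forall j, 'E_P[fun w => (`|s j w| `^ (2 + delta))%R] <= M%:E)%E -> 0 <= M ->
  exists2 eta, 0 < eta & small_cf eps eta.
Proof.
move=> d0 e0 s1 s2 sM M0.
(* The level K makes the tail term K^-delta M at most eps / 8; eta is then small
   enough for the term K |x| below the level and for the x^4 in exp. *)
pose K := (8 * (M + 1) / eps) `^ (delta^-1).
have A0 : 0 < 8 * (M + 1) / eps by rewrite divr_gt0// mulr_gt0// ltr_wpDl.
have K0 : 0 < K by rewrite powR_gt0.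
have Kd : K `^ (- delta) * M <= eps / 8.
  rewrite powRN /K -powRrM mulVf ?gt_eqF// powRr1 ?(ltW A0)// invf_div.
  rewrite mulrAC ler_pdivrMr; last by rewrite mulr_gt0// ltr_wpDl.
  have -> : eps / 8 * (8 * (M + 1)) = eps * (M + 1) by field.
  by rewrite ler_wpM2l ?(ltW e0)// lerDl.
pose eta := Num.min 1 (Num.min eps (eps / (8 * K))).
have eta0 : 0 < eta by rewrite !lt_min ltr01 e0 divr_gt0// mulr_gt0.
exists eta => // j x xeta.
have [x1 [xe xK]] : `|x| <= 1 /\ `|x| <= eps /\ `|x| <= eps / (8 * K).
  by move: xeta; rewrite !le_min => /and3P[].
have xK' : K * `|x| <= eps / 8.
  move: xK; rewrite invfM mulrA ler_pdivlMr//; lra.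
have [i1 i2 E1 E2] := standard_moments (measurable_funP (s j)) (s1 j) (s2 j).
have mp : measurable_fun setT (fun w => `|s j w| `^ (2 + delta)).
  apply: (@measurableT_comp _ _ _ _ _ _ (fun y : R => y `^ (2 + delta))).
    exact: measurable_powR.
  exact: measurableT_comp.
have ip : P.-integrable setT (EFin \o (fun w => `|s j w| `^ (2 + delta))).
  apply: ge0_int_fin => //.
  by apply: le_lt_trans (sM j) _; exact: ltry.
have Ep : \int[P]_w (`|s j w| `^ (2 + delta)) <= M.
  rewrite -lee_fin /Rintegral fineK; last exact: integrable_fin_num.
  by have := sM j; rewrite expectation.unlock.
pose dom w := x ^+ 2 * (K * `|x| * s j w ^+ 2 + K `^ (- delta) * `|s j w| `^ (2 + delta)).
have idom : P.-integrable setT (EFin \o dom) by apply: RintegrableZ; apply: RintegrableD; exact: RintegrableZ.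
have Edom : \int[P]_w dom w <= eps / 4 * x ^+ 2.
  rewrite RintegralZl//; last by apply: RintegrableD; exact: RintegrableZ.
  rewrite RintegralD//; [|exact: RintegrableZ|exact: RintegrableZ].
  rewrite !RintegralZl// E2 mulr1 mulrC ler_wpM2r ?sqr_ge0//.
  have : K `^ (- delta) * \int[P]_w (`|s j w| `^ (2 + delta)) <= K `^ (- delta) * M.
    by rewrite ler_wpM2l ?powR_ge0.
  lra.
have bound (f : T -> R) (k : R) : 0 <= k -> P.-integrable setT (EFin \o f) ->
    (forall w, `|f w| <= k * taylor_rem (x * s j w)) ->
    `|\int[P]_w f w| <= k * (eps / 4 * x ^+ 2).
  move=> k0 If h; apply: (le_trans (le_normr_Rintegral _ If)) => //.
  apply: (@le_trans _ _ (\int[P]_w (k * dom w))).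
    apply: le_Rintegral => //; [exact: integrable_norm|exact: RintegrableZ|].
    move=> w _; apply: (le_trans (h w)); rewrite ler_wpM2l//.
    exact: taylor_rem_split.
  by rewrite RintegralZl// ler_wpM2l.
have icos := Mom_int (cos_Mom j x); have isin := Mom_int (sin_Mom j x).
have ic1 : P.-integrable setT (EFin \o (fun w => cos (x * s j w) - 1)).
  by apply: RintegrableD => //; exact: finite_measure_integrable_cst.
have iq : P.-integrable setT (EFin \o (fun w => x ^+ 2 / 2 * s j w ^+ 2)) by exact: RintegrableZ.
have il : P.-integrable setT (EFin \o (fun w => - x * s j w)) by exact: RintegrableZ.
split; last first.
  have := @bound (fun w => sin (x * s j w) + (- x) * s j w) 2 _ (RintegrableD isin il) _.
  rewrite RintegralD// RintegralZl// E1 mulr0 addr0 => h.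
  apply: (le_trans (h _ _)) => //.
    by move=> w; rewrite mulNr; exact: sin_taylor.
  have := mulr_ge0 (ltW e0) (sqr_ge0 x); lra.
have h1 : `|\int[P]_w cos (x * s j w) - 1 + x ^+ 2 / 2| <= eps / 4 * x ^+ 2.
  have := @bound (fun w => cos (x * s j w) - 1 + x ^+ 2 / 2 * s j w ^+ 2) 1 _ (RintegrableD ic1 iq) _.
  rewrite RintegralD// RintegralZl// E2 mulr1 RintegralB//; last first.
    exact: finite_measure_integrable_cst.
  rewrite Rintegral_cst// (_ : fine _ = 1); last first.
    by rewrite -[1]/(fine 1%E); congr fine; exact: probability_setT.
  rewrite !mul1r => h; apply: h => // w.
  have := cos_taylor (x * s j w); rewrite exprMn mul1r.
  by rewrite (_ : x ^+ 2 * s j w ^+ 2 / 2 = x ^+ 2 / 2 * s j w ^+ 2)//; ring.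
have h2 : `|expR (- (x ^+ 2 / 2)) - 1 + x ^+ 2 / 2| <= eps / 4 * x ^+ 2.
  have x20 : 0 <= x ^+ 2 / 2 by rewrite divr_ge0 ?sqr_ge0.
  apply: (le_trans (expR_taylor x20)).
  have -> : (x ^+ 2 / 2) ^+ 2 = x ^+ 2 / 4 * x ^+ 2 by field.
  rewrite ler_wpM2r ?sqr_ge0//.
  rewrite -[x ^+ 2]real_normK ?num_real//.
  have : `|x| ^+ 2 <= `|x| * eps by rewrite expr2 ler_wpM2l.
  have : `|x| * eps <= eps by rewrite ler_piMl ?(ltW e0).
  lra.
set a := \int[P]_w _ in h1 *; set b := expR _ in h2 *.
have -> : a - b = (a - 1 + x ^+ 2 / 2) - (b - 1 + x ^+ 2 / 2) by ring.
apply: (le_trans (ler_normB _ _)).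
have := mulr_ge0 (ltW e0) (sqr_ge0 x); lra.
Qed.

Hypothesis ind : independent_RVs s.

Definition lin_comb (x : nat -> R) (n : nat) (w : T) := \sum_(m < n) x m * s m w.

Lemma lin_combS x n w : lin_comb x n.+1 w = lin_comb x n w + x n * s n w.
Proof. by rewrite /lin_comb big_ord_recr. Qed.

Lemma Past_cos x n c : Past s n (fun w => cos (lin_comb x n w + c)).
Proof.
elim: n c => [|n IH] c.
  rewrite (_ : (fun w => _) = fun=> cos (0 + c)); first exact: Past0.
  by apply/funext => w; rewrite /lin_comb big_ord0.
rewrite (_ : (fun w => _) = fun w =>
    cos (lin_comb x n w + c) * cos (x n * s n w) +
    cos (lin_comb x n w + (c + pi / 2)) * sin (x n * s n w)); last first.
  apply/funext => w; rewrite lin_combS addrAC cosD addrA cosDpihalf; ring.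
have m1 := measurable_cos_mul (x n).
apply: PastD.
  by apply: (@Past_mul _ _ _ _ _ _ _ (fun y => cos (x n * y))) => //; exact: cos_Mom.
apply: (@Past_mul _ _ _ _ _ _ _ (fun y => sin (x n * y))) => //.
  exact: measurable_sin_lin.
exact: sin_Mom.
Qed.

Lemma abs_Rintegral_le1 (f : T -> R) : Mom P f -> (forall w, `|f w| <= 1) ->
  `|\int[P]_w f w| <= 1.
Proof.
move=> mf f1; apply: (le_trans (le_normr_Rintegral _ (Mom_int mf))) => //.
apply: (@le_trans _ _ (\int[P]_w 1)).
  apply: le_Rintegral => //; first exact: integrable_norm (Mom_int mf).
  exact: finite_measure_integrable_cst.
rewrite Rintegral_cst// (_ : fine _ = 1) ?mul1r//.
by rewrite -[1]/(fine 1%E); congr fine; exact: probability_setT.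
Qed.

(** Lindeberg's exchange of one summand at a time: conditioning on the past, a
    factor cos (x_n s_n) may be replaced by exp (- x_n^2 / 2) at cost eps x_n^2, and
    the term with sin (x_n s_n) dropped at the same cost. *)
Lemma cos_lin_comb eps eta x n c : 0 <= eps -> small_cf eps eta ->
  (forall m, (m < n)%N -> `|x m| <= eta) ->
  `|\int[P]_w cos (lin_comb x n w + c)
    - expR (- ((\sum_(m < n) x m ^+ 2) / 2)) * cos c| <= 2 * eps * \sum_(m < n) x m ^+ 2.
Proof.
move=> e0 cf; elim: n c => [|n IH] c xn.
  rewrite !big_ord0 mul0r oppr0 expR0 mul1r mulr0.
  under eq_Rintegral do rewrite /lin_comb big_ord0 add0r.
  rewrite Rintegral_cst// (_ : fine _ = 1) ?mulr1 ?subrr ?normr0//.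
  by rewrite -[1]/(fine 1%E); congr fine; exact: probability_setT.
have IHc := IH c (fun m mn => xn m (ltnW mn)).
have [c1 c2] := cf n (x n) (xn n (ltnSn n)).
pose S := lin_comb x n.
have m1 := measurable_cos_mul (x n).
have E : \int[P]_w cos (lin_comb x n.+1 w + c) =
    \int[P]_w cos (S w + c) * \int[P]_w cos (x n * s n w) +
    \int[P]_w cos (S w + (c + pi / 2)) * \int[P]_w sin (x n * s n w).
  rewrite -(@Past_E _ _ _ _ _ _ _ (fun y => cos (x n * y)) (Past_cos x n c) m1 (cos_Mom _ _)).
  rewrite -(@Past_E _ _ _ _ _ _ _ (fun y => sin (x n * y)) (Past_cos x n (c + pi / 2))
    (measurable_sin_lin _) (sin_Mom _ _)).
  rewrite -RintegralD//.
  - by apply: eq_Rintegral => w _; rewrite lin_combS addrAC cosD addrA cosDpihalf; ring.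
  - by apply: Mom_int; apply: MomM; [exact: Past_Mom (Past_cos x n c)|exact: cos_Mom].
  - by apply: Mom_int; apply: MomM; [exact: Past_Mom (Past_cos x n _)|exact: sin_Mom].
rewrite E big_ord_recr /=.
rewrite (_ : expR _ = expR (- ((\sum_(m < n) x m ^+ 2) / 2)) * expR (- (x n ^+ 2 / 2))); last first.
  by rewrite -expRD; congr expR; ring.
have a1 : `|\int[P]_w cos (S w + c)| <= 1.
  by apply: abs_Rintegral_le1; [exact: Past_Mom (Past_cos x n c)|move=> w; exact: cos_max].
have a2 : `|\int[P]_w cos (S w + (c + pi / 2))| <= 1.
  by apply: abs_Rintegral_le1; [exact: Past_Mom (Past_cos x n _)|move=> w; exact: cos_max].
rewrite -/S in IHc.
set A := \int[P]_w cos (S w + c) in IHc a1 *.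
set B := \int[P]_w cos (S w + (c + pi / 2)) in a2 *.
set C := \int[P]_w cos (x n * s n w) in c1 *.
set D := \int[P]_w sin (x n * s n w) in c2 *.
set F := expR (- (_ / 2)) in IHc *; set G := expR (- (x n ^+ 2 / 2)) in c1 *.
set X := \sum_(m < n) _ in IHc *.
have -> : A * C + B * D - F * G * cos c = A * (C - G) + B * D + G * (A - F * cos c) by ring.
have G1 : `|G| <= 1.
  by rewrite ger0_norm ?expR_ge0// /G expR_le1 oppr_le0 divr_ge0 ?sqr_ge0.
rewrite (mulrDr (2 * eps)).
apply: (le_trans (ler_normD _ _)); rewrite addrC; apply: lerD.
  by rewrite normrM; apply: le_trans IHc; rewrite ler_piMl.
apply: (le_trans (ler_normD _ _)); rewrite !normrM.
have : `|A| * `|C - G| <= `|C - G| by rewrite ler_piMl.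
have : `|B| * `|D| <= `|D| by rewrite ler_piMl.
lra.
Qed.

End CosineTransform.

(** * Even moments of linear forms *)

Section PowerBounds.
Variable R : realType.
Implicit Types S y : R.

Lemma normr_even S p : `|S| ^+ p.*2 = S ^+ p.*2.
Proof. by rewrite -mul2n !exprM real_normK ?num_real. Qed.

Lemma pow_le_1D S k p : (k <= p.*2)%N -> `|S ^+ k| <= 1 + S ^+ p.*2.
Proof.
move=> kp; rewrite normrX -normr_even.
have h : 0 <= `|S| ^+ p.*2 by rewrite exprn_ge0.
have [S1|/ltW S1] := leP `|S| 1.
  by apply: (@le_trans _ _ 1); [exact: exprn_ile1|rewrite lerDl].
by apply: (@le_trans _ _ (`|S| ^+ p.*2)); [exact: ler_weXn2l|rewrite lerDr].
Qed.

Lemma pow_le_sqrD y k p : (2 <= k <= p.*2)%N -> `|y ^+ k| <= y ^+ 2 + y ^+ p.*2.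
Proof.
move=> /andP[k2 kp]; rewrite normrX -normr_even -[y ^+ 2]real_normK ?num_real//.
have h : 0 <= `|y| ^+ p.*2 by rewrite exprn_ge0.
have [S1|/ltW S1] := leP `|y| 1.
  by apply: (@le_trans _ _ (`|y| ^+ 2)); [exact: ler_wiXn2l|rewrite lerDl].
by apply: (@le_trans _ _ (`|y| ^+ p.*2)); [exact: ler_weXn2l|rewrite lerDr sqr_ge0].
Qed.

(** The expansion to first order of the power of a sum, with a remainder in which
    S and y are separated, ready for independence. The remainder has S to the
    lower even power 2p and y to powers at least 2. *)
Lemma pow_add_le p : exists2 c : R, 0 <= c & forall S y,
  (S + y) ^+ p.+1.*2 <= S ^+ p.+1.*2 + p.+1.*2%:R * (S ^+ p.*2.+1 * y) +
    c * ((1 + S ^+ p.*2) * (y ^+ 2 + y ^+ p.+1.*2)).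
Proof.
exists (\sum_(i < p.*2.+1) 'C(p.+1.*2, bump 0 (bump 0 i))%:R).
  by apply: sumr_ge0.
move=> S y; rewrite exprDn big_ord_recl big_ord_recl /= subn0 bin0 expr0 mulr1 mulr1n.
rewrite -addrA lerD2l; apply: lerD.
  by rewrite /bump /= addn0 bin1 expr1 -mulr_natl doubleS subSS subn0.
rewrite mulr_suml; apply: ler_sum => i _.
rewrite -mulr_natl ler_wpM2l//.
apply: (le_trans (ler_norm _)); rewrite normrM.
apply: ler_pM => //.
  by apply: pow_le_1D; rewrite /bump !leq0n !add1n doubleS !subSS leq_subr.
by apply: pow_le_sqrD; have := ltn_ord i; rewrite /bump !leq0n !add1n doubleS !ltnS.
Qed.

End PowerBounds.

Section MomentBound.
Context d (T : measurableType d) (R : realType) (P : probability T R).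
Variable (s : nat -> {RV P >-> R}).
Hypothesis ind : independent_RVs s.
Hypothesis smom : forall j, Mom P (s j).

Lemma lin_comb_Mom x n : Mom P (lin_comb s x n).
Proof.
by apply: Mom_sum => m; apply: MomZ; exact: smom.
Qed.

Lemma Past_lin_combX x n k : Past s n (fun w => lin_comb s x n w ^+ k).
Proof.
elim: n k => [|n IH] k.
  rewrite (_ : (fun w => _) = fun=> 0 ^+ k); first exact: Past0.
  by apply/funext => w; rewrite /lin_comb big_ord0.
rewrite (_ : (fun w => _) = fun w => \sum_(i < k.+1)
   ('C(k, i)%:R * (lin_comb s x n w ^+ (k - i) * (x n * s n w) ^+ i))); last first.
  apply/funext => w; rewrite lin_combS exprDn; apply: eq_bigr => i _.
  by rewrite mulr_natl.
have mg i : measurable_fun setT (fun y : R => (x n * y) ^+ i).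
  by apply: measurable_funX; apply: measurable_funM => //; exact: measurable_cst.
have P0 : Past s n.+1 (fun=> 0).
  by elim: (n.+1) => [|m]; [exact: Past0|exact: PastS].
apply: Past_sum => // i; apply: PastZ.
apply: (@Past_mul _ _ _ _ _ _ _ (fun y => (x n * y) ^+ i)) => //.
by apply: MomX; apply: MomZ; exact: smom.
Qed.

Hypothesis s1 : forall j, \int[P]_w s j w = 0.
Hypothesis s2 : forall j, \int[P]_w (s j w ^+ 2) = 1.
Hypothesis sk : forall k, exists2 M : R, 0 <= M & forall j, \int[P]_w (s j w ^+ k.*2) <= M.

Lemma Rintegral_prob_cst (c : R) : \int[P]_w c = c.
Proof.
rewrite Rintegral_cst// (_ : fine _ = 1) ?mulr1//.
by rewrite -[1]/(fine 1%E); congr fine; exact: probability_setT.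
Qed.

(** The even moments of a normalised linear form are bounded uniformly in the
    coefficients: expanding one summand at a time, the term of first order
    vanishes since the summand is centred and independent of the past, and the
    others are of order x_n^2 with moments of lower order in front. *)
Lemma moment_bound p : exists2 C : R, 0 <= C & forall (x : nat -> R) n,
  (forall m, `|x m| <= 1) -> \sum_(m < n) x m ^+ 2 <= 1 ->
  \int[P]_w (lin_comb s x n w ^+ p.*2) <= C.
Proof.
elim: p => [|p [C C0 IH]].
  by exists 1 => // x n _ _; under eq_Rintegral do rewrite expr0; rewrite Rintegral_prob_cst.
have [M M0 HM] := sk p.+1.
have [c c0 Hc] := pow_add_le R p.
pose D := c * ((1 + C) * (1 + M)).
have D0 : 0 <= D by rewrite mulr_ge0// mulr_ge0// addr_ge0.
exists D => // x n x1.
suff H : \sum_(m < n) x m ^+ 2 <= 1 ->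
    \int[P]_w (lin_comb s x n w ^+ p.+1.*2) <= D * \sum_(m < n) x m ^+ 2.
  by move=> h; apply: (le_trans (H h)); rewrite ler_piMr.
elim: n => [_|n IHn].
  under eq_Rintegral do rewrite /lin_comb big_ord0 expr0n /=.
  by rewrite Rintegral_prob_cst big_ord0 mulr0.
rewrite big_ord_recr /= => hn.
have hn' : \sum_(m < n) x m ^+ 2 <= 1.
  by apply: le_trans hn; rewrite lerDl sqr_ge0.
have {}IHn := IHn hn'; have IHp := IH x n x1 hn'.
set S := lin_comb s x n.
have mS : Mom P S by exact: lin_comb_Mom.
pose X1 w := S w ^+ p.+1.*2.
pose X2 w := S w ^+ p.*2.+1 * s n w.
pose X3 w := (1 + S w ^+ p.*2) * (s n w ^+ 2 + s n w ^+ p.+1.*2).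
have M1 : Mom P X1 by exact: MomX.
have M2 : Mom P X2 by apply: MomM => //; exact: MomX.
have Mg : Mom P (fun w => s n w ^+ 2 + s n w ^+ p.+1.*2) by apply: MomD; apply: MomX.
have MS2 : Mom P (fun w => 1 + S w ^+ p.*2).
  by apply: MomD; [exact: Mom_cst|exact: MomX].
have M3 : Mom P X3 by apply: MomM.
have E2 : \int[P]_w X2 w = 0.
  by rewrite (@Past_E _ _ _ _ _ _ _ id (Past_lin_combX x n _))// ?s1 ?mulr0//; exact: smom.
have E3 : \int[P]_w X3 w <= (1 + C) * (1 + M).
  have PS : Past s n (fun w => 1 + S w ^+ p.*2).
    apply: PastD; last exact: Past_lin_combX.
    by elim: (n) => [|m]; [exact: Past0|exact: PastS].
  rewrite (@Past_E _ _ _ _ _ _ _ (fun y => y ^+ 2 + y ^+ p.+1.*2) PS)//; last first.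
    by apply: measurable_funD; exact: measurable_funX.
  rewrite RintegralD//; [|exact: Mom_int (Mom_cst _ _)|exact: Mom_int (MomX _ mS)].
  rewrite RintegralD//; [|exact: Mom_int (MomX _ (smom n))..].
  rewrite Rintegral_prob_cst s2.
  have e1 : 0 <= \int[P]_w (S w ^+ p.*2).
    by apply: Rintegral_ge0 => w _; rewrite -normr_even exprn_ge0.
  have e2 : 0 <= \int[P]_w (s n w ^+ p.+1.*2).
    by apply: Rintegral_ge0 => w _; rewrite -normr_even exprn_ge0.
  by apply: ler_pM; rewrite ?addr_ge0// lerD2l.
have pw w : lin_comb s x n.+1 w ^+ p.+1.*2 <=
    X1 w + p.+1.*2%:R * x n * X2 w + c * x n ^+ 2 * X3 w.
  rewrite lin_combS; apply: (le_trans (Hc _ _)); apply: lerD.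
    by rewrite /X1 /X2 le_eqVlt; apply/orP; left; apply/eqP; rewrite /S; ring.
  have -> : c * x n ^+ 2 * X3 w = c * ((1 + S w ^+ p.*2) *
     (x n ^+ 2 * (s n w ^+ 2 + s n w ^+ p.+1.*2))) by rewrite /X3; ring.
  rewrite ler_wpM2l// ler_wpM2l//.
    by rewrite addr_ge0// -normr_even exprn_ge0.
  rewrite !exprMn mulrDr lerD2l ler_wpM2r//.
    by rewrite -normr_even exprn_ge0.
  rewrite -normr_even -[x n ^+ 2]real_normK ?num_real//.
  by apply: ler_wiXn2l => //; lia.
have i1 := Mom_int M1; have i2 := Mom_int (MomZ (p.+1.*2%:R * x n) M2).
have i3 := Mom_int (MomZ (c * x n ^+ 2) M3).
apply: (@le_trans _ _ (\int[P]_w (X1 w + p.+1.*2%:R * x n * X2 w + c * x n ^+ 2 * X3 w))).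
  apply: le_Rintegral => //; first exact: Mom_int (MomX _ (lin_comb_Mom x n.+1)).
  by apply: RintegrableD => //; apply: RintegrableD.
rewrite RintegralD//; last exact: RintegrableD.
rewrite RintegralD// !RintegralZl//; [|exact: Mom_int..].
rewrite E2 mulr0 addr0 mulrDr; apply: lerD => //.
have -> : D * x n ^+ 2 = c * x n ^+ 2 * ((1 + C) * (1 + M)) by rewrite /D; ring.
by rewrite ler_wpM2l// mulr_ge0// sqr_ge0.
Qed.

End MomentBound.

(** * The Gaussian integral of a cosine *)

Section DensityIntegral.
Context d (T : measurableType d) (R : realType).
Variables (mu nu : {measure set T -> \bar R}) (p : T -> R).
Hypothesis mp : measurable_fun setT p.
Hypothesis p0 : forall x, 0 <= p x.
Hypothesis nuE : forall A, measurable A -> nu A = (\int[mu]_(x in A) (p x)%:E)%E.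

Let density_indic (A : set T) : measurable A ->
  (\int[nu]_x (\1_A x)%:E = \int[mu]_x ((\1_A x)%:E * (p x)%:E))%E.
Proof.
move=> mA; rewrite integral_indic// setIT nuE// integral_mkcond.
apply: eq_integral => x _; rewrite patchE indicE.
by case: (x \in A); rewrite ?mul1e ?mul0e.
Qed.

Let density_nnsfun (h : {nnsfun T >-> R}) :
  (\int[nu]_x (h x)%:E = \int[mu]_x ((h x)%:E * (p x)%:E))%E.
Proof.
under [LHS]eq_integral do rewrite fimfunE -fsumEFin//.
rewrite [LHS]ge0_integral_fsum//; last 2 first.
  - by move=> r; exact/measurable_EFinP/measurableT_comp.
  - by move=> n x _; rewrite EFinM nnfun_muleindic_ge0.
under [RHS]eq_integral.
  move=> x xD; rewrite fimfunE -fsumEFin// ge0_mule_fsuml; last first.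
    by move=> r; rewrite EFinM nnfun_muleindic_ge0.
  over.
rewrite [RHS]ge0_integral_fsum//; last 2 first.
  - move=> r; apply: emeasurable_funM; last exact/measurable_EFinP.
    by apply/measurable_EFinP; apply/measurableT_comp.
  - move=> n x _; rewrite EFinM mule_ge0//; last by rewrite lee_fin.
    by rewrite nnfun_muleindic_ge0.
apply: eq_fsbigr => r _.
rewrite integralZl_indic_nnsfun//= density_indic//.
case: (ltP r 0) => r0.
  rewrite (_ : h @^-1` [set r] = set0); last first.
    apply/seteqP; split => x //= hx; have : 0 <= h x by [].
    by rewrite hx leNgt r0.
  rewrite !integral0_eq ?mule0// => x _; rewrite indic0 /= ?mulr0 ?mule0 ?mul0e//.
rewrite -ge0_integralZl//.
- by apply: eq_integral => x _; rewrite EFinM muleA.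
- apply: emeasurable_funM; last exact/measurable_EFinP.
  exact/measurable_EFinP.
- by move=> x _; rewrite mule_ge0 ?lee_fin.
Qed.

(** Obtained for indicators by definition, for simple functions by linearity, and
    for limits by monotone convergence. *)
Lemma density_integral (f : T -> \bar R) : measurable_fun setT f ->
  (forall x, 0 <= f x)%E ->
  (\int[nu]_x f x = \int[mu]_x (f x * (p x)%:E))%E.
Proof.
move=> mf f0; pose f_ := nnsfun_approx measurableT mf.
have h1 : (\int[nu]_x (f_ n x)%:E)%E @[n --> \oo] --> (\int[nu]_x f x)%E.
  rewrite (eq_integral (fun x => lim ((f_ n x)%:E @[n --> \oo]))); last first.
    by move=> x _; apply/esym/cvg_lim => //; exact: cvg_nnsfun_approx.
  apply: cvg_monotone_convergence => //.
  - by move=> n; exact/measurable_EFinP.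
  - by move=> n x _; rewrite lee_fin.
  - by move=> x _ m n mn; rewrite lee_fin; exact/lefP/nd_nnsfun_approx.
have h2 : (\int[mu]_x ((f_ n x)%:E * (p x)%:E))%E @[n --> \oo] -->
   (\int[mu]_x (f x * (p x)%:E))%E.
  rewrite (eq_integral (fun x => lim (((f_ n x)%:E * (p x)%:E)%E @[n --> \oo]))); last first.
    move=> x _; apply/esym/cvg_lim => //; apply: cvgeZr => //.
    exact: cvg_nnsfun_approx.
  apply: cvg_monotone_convergence => //.
  - by move=> n; apply: emeasurable_funM; exact/measurable_EFinP.
  - by move=> n x _; rewrite mule_ge0 ?lee_fin.
  - move=> x _ m n mn; rewrite lee_wpmul2r ?lee_fin//; exact/lefP/nd_nnsfun_approx.
have e : (fun n => \int[nu]_x (f_ n x)%:E)%E =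
    (fun n => \int[mu]_x ((f_ n x)%:E * (p x)%:E))%E.
  by apply/funext => n; exact: density_nnsfun.
rewrite e in h1; apply: cvg_unique h1 h2; exact: ereal_hausdorff.
Qed.

End DensityIntegral.

Section GaussCosine.
Variable R : realType.
Local Notation mu := (@lebesgue_measure R).
Local Notation gs := (@gauss_fun R).

Lemma gauss_sqrt_int : mu.-integrable setT (EFin \o (fun x : R => expR (- (x ^+ 2 / 2)))).
Proof.
have := @integrable_normal_pdf R 0 1.
rewrite (_ : (fun x => _) = EFin \o normal_pdf 0 1)// => /(RintegrableZ (normal_peak 1)^-1).
congr (_.-integrable _ (EFin \o _)); apply/funext => x.
rewrite normal_pdfE ?oner_neq0// mulrA mulVf ?mul1r; last first.
  by rewrite gt_eqF// normal_peak_gt0// oner_neq0.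
by rewrite /normal_fun subr0 expr1n mulNr.
Qed.

Lemma expR_ge_id (x : R) : x <= expR x.
Proof. by apply: le_trans (expR_ge1Dx x); rewrite lerDr. Qed.

Lemma gauss_moment_int k : mu.-integrable setT (EFin \o (fun x : R => x ^+ k * gs x)).
Proof.
pose m := k.+1; have m0 : 0 < m%:R :> R by rewrite ltr0n.
pose C : R := 1 + (2 * m%:R) ^+ m.
have := RintegrableZ C gauss_sqrt_int; apply: le_integrable => //.
  apply/measurable_EFinP; apply: measurable_funM; last exact: measurable_gauss_fun.
  exact: measurable_funX.
move=> x _; rewrite lee_fin normrM [leRHS]ger0_norm; last first.
  by rewrite mulr_ge0 ?expR_ge0// addr_ge0// exprn_ge0// mulr_ge0// ltW.
rewrite (ger0_norm (gauss_fun_ge0 x)).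
have -> : gs x = expR (- (x ^+ 2 / 2)) * expR (- (x ^+ 2 / 2)).
  by rewrite -expRD /gauss_fun; congr expR; lra.
rewrite mulrA ler_wpM2r ?expR_ge0//.
have e1 : expR (- (x ^+ 2 / 2)) <= 1.
  by rewrite expR_le1 oppr_le0 divr_ge0 ?sqr_ge0.
have h1 : `|x ^+ k| <= 1 + x ^+ m.*2 by apply: pow_le_1D; rewrite /m; lia.
have h2 : x ^+ m.*2 <= (2 * m%:R) ^+ m * expR (x ^+ 2 / 2).
  have -> : x ^+ m.*2 = ((2 * m%:R) * (x ^+ 2 / (2 * m%:R))) ^+ m.
    rewrite -mul2n exprM; congr (_ ^+ _); field; lra.
  rewrite [leLHS]exprMn; apply: ler_wpM2l.
    by apply: exprn_ge0; apply: mulr_ge0 => //; exact: ltW.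
  have -> : expR (x ^+ 2 / 2) = expR (x ^+ 2 / (2 * m%:R)) ^+ m.
    rewrite -expRM_natl; congr expR; rewrite -mulr_natl; field; lra.
  have q0 : 0 <= x ^+ 2 / (2 * m%:R) by rewrite divr_ge0 ?sqr_ge0 ?mulr_ge0 ?ltW.
  by rewrite lerXn2r ?nnegrE ?expR_ge0// expR_ge_id.
have e0 := expR_ge0 (- (x ^+ 2 / 2)).
apply: (@le_trans _ _ ((1 + x ^+ m.*2) * expR (- (x ^+ 2 / 2)))); first by rewrite ler_wpM2r.
rewrite mulrDl mul1r /C; apply: lerD => //.
apply: (@le_trans _ _ ((2 * m%:R) ^+ m * expR (x ^+ 2 / 2) * expR (- (x ^+ 2 / 2)))).
  by rewrite ler_wpM2r.
by rewrite -mulrA expRxMexpNx_1 mulr1.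
Qed.

Lemma gauss_int_bounded (f : R -> R) k (c : R) : measurable_fun setT f ->
  (forall x, `|f x| <= c) ->
  mu.-integrable setT (EFin \o (fun x : R => x ^+ k * gs x * f x)).
Proof.
by move=> mf fc; apply: (integrable_mul_bounded (gauss_moment_int k) mf fc).
Qed.

Lemma is_derive_affine (a c t : R) : is_derive t 1 (fun t => t * a + c) a.
Proof.
have H := is_deriveD (is_deriveM (is_derive_id t 1) (is_derive_cst a t 1))
  (is_derive_cst c t 1).
apply: (is_derive_eq H).
by rewrite scaler0 add0r addr0 /GRing.scale /= mulr1.
Qed.

Lemma is_derive_cos_affine (a c t : R) :
  is_derive t 1 (fun t => cos (t * a + c)) (- sin (t * a + c) * a).
Proof.
have H := @is_derive1_comp _ cos (fun t => t * a + c) t _ _ (is_derive_cos _) (is_derive_affine a c t).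
exact: (is_derive_eq H).
Qed.

Lemma is_derive_sin_affine (a c t : R) :
  is_derive t 1 (fun t => sin (t * a + c)) (cos (t * a + c) * a).
Proof.
have H := @is_derive1_comp _ sin (fun t => t * a + c) t _ _ (is_derive_sin _) (is_derive_affine a c t).
exact: (is_derive_eq H).
Qed.

Lemma is_derive_gauss (x : R) : is_derive x 1 gs (- (2 * x * gs x)).
Proof.
have H := is_deriveN (is_deriveX 2 (is_derive_id x 1)).
have K := @is_derive1_comp _ expR (- id ^+ 2) x _ _ (is_derive_expR _) H.
apply: (is_derive_eq K); rewrite /gauss_fun /GRing.scale /= mulr1 expr1 mulr_natl; ring.
Qed.

Let S (t c x : R) := sin (x * t + c) * gs x.
Let K (t c x : R) := t * (x ^+ 0 * gs x * cos (x * t + c)) -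
                     2 * (x ^+ 1 * gs x * sin (x * t + c)).

Lemma is_derive_S (t c x : R) : is_derive x 1 (S t c) (K t c x).
Proof.
have H := is_deriveM (is_derive_sin_affine t c x) (is_derive_gauss x).
apply: (is_derive_eq H); rewrite /K /GRing.scale /=; ring.
Qed.

Let mcos (t c : R) : measurable_fun setT (fun x : R => cos (x * t + c)).
Proof. by have := measurable_cos_lin t c; under eq_fun do rewrite mulrC. Qed.

Let msin (t c : R) : measurable_fun setT (fun x : R => sin (x * t + c)).
Proof.
have := mcos t (c - pi / 2); congr measurable_fun; apply/funext => x.
by rewrite addrA cosBpihalf.
Qed.

Let i0 t c := gauss_int_bounded 0 (mcos t c) (fun x => cos_max (x * t + c)).
Let i1 t c := gauss_int_bounded 1 (msin t c) (fun x => sin_max (x * t + c)).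

Let iK t c : mu.-integrable setT (EFin \o K t c).
Proof.
have := RintegrableD (RintegrableZ t (i0 t c)) (RintegrableZ (-2) (i1 t c)).
by congr (_.-integrable _ (EFin \o _)); apply/funext => x; rewrite /K; ring.
Qed.

Let cK t c : continuous (K t c).
Proof.
have cc (u : R -> R) (du : R -> R) : (forall x : R, is_derive x 1 u (du x)) -> continuous u.
  move=> h x; apply: differentiable_continuous; apply/derivable1_diffP.
  by have [] := h x.
have cg : continuous gs := @continuous_gauss_fun R.
have c1 := cc _ _ (is_derive_cos_affine t c).
have c2 := cc _ _ (is_derive_sin_affine t c).
move=> x; apply: cvgB; (apply: cvgM; first exact: cvg_cst);
  (apply: cvgM; last by [exact: c1|exact: c2]); (apply: cvgM; last exact: cg).
  exact: cvg_cst.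
exact: cvg_id.
Qed.

(** [K t c] is the derivative of [S t c], which vanishes at infinity. *)
Lemma gauss_by_parts (t c : R) : \int[mu]_x K t c x = 0.
Proof.
pose D n : set R := `[- n.+1%:R, n.+1%:R]%classic.
have h1 : \int[mu]_x (K t c \_ (D n)) x @[n --> \oo] --> \int[mu]_x K t c x.
  have mr n : measurable_fun setT (K t c \_ (D n)).
    apply/(measurable_restrictT _ _).1; first exact: measurable_itv.
    by apply: measurable_funTS; have /measurable_int/measurable_EFinP := iK t c.
  have cr x : (K t c \_ (D n)) x @[n --> \oo] --> K t c x.
    apply: cvg_near_cst; near=> n.
    rewrite patchE ifT// inE /D /= in_itv /= -ler_norml.
    apply: (@le_trans _ _ n%:R); last by rewrite ler_nat.
    by near: n; exact: nbhs_infty_ger.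
  have br n x : `|(K t c \_ (D n)) x| <= `|K t c x|.
    by rewrite patchE; case: ifP => // _; rewrite normr0.
  by have [] := @Rdominated_cvg _ (measurableTypeR R) R mu _ _ _ mr cr (integrable_norm (iK t c)) br.
have FTC n : \int[mu]_x (K t c \_ (D n)) x = S t c n.+1%:R - S t c (- n.+1%:R).
  rewrite -Rintegral_mkcond /Rintegral.
  have nn : - n.+1%:R < n.+1%:R :> R by apply: (@lt_trans _ _ 0); rewrite ?oppr_lt0 ltr0n.
  rewrite (@continuous_FTC2 R (K t c) (S t c) (- n.+1%:R) n.+1%:R nn)//.
  - by apply: continuous_subspaceT; exact: cK.
  - have cS : continuous (S t c).
      move=> x; apply: differentiable_continuous; apply/derivable1_diffP.
      by have [] := is_derive_S t c x.
    split.
    + by move=> x _; have [] := is_derive_S t c x.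
    + by apply: cvg_at_right_filter; exact: cS.
    + by apply: cvg_at_left_filter; exact: cS.
  - by move=> x _; rewrite derive1E; have [_ ->] := is_derive_S t c x.
have Sb x : `|S t c x| <= gs x.
  by rewrite /S normrM (ger0_norm (gauss_fun_ge0 x)) ler_piMl ?gauss_fun_ge0 ?sin_max.
have gb n : gs n.+1%:R <= n.+1%:R^-1.
  rewrite /gauss_fun expRN lef_pV2 ?posrE ?expR_gt0 ?ltr0n//.
  apply: le_trans (expR_ge_id _); rewrite -natrX ler_nat; lia.
have h2 : (S t c n.+1%:R - S t c (- n.+1%:R)) @[n --> \oo] --> (0 : R).
  have hh : (2 * n.+1%:R^-1 : R) @[n --> \oo] --> (0 : R).
    rewrite -[X in _ --> X](mulr0 2); apply: cvgM; first exact: cvg_cst.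
    exact: cvg_harmonic.
  apply/norm_cvg0P; apply: squeeze_cvgr hh; last exact: (cvg_cst (0 : R)).
  near=> n; rewrite normr_ge0 /=; apply: (le_trans (ler_normB _ _)).
  rewrite mulr_natl mulr2n; apply: lerD; apply: (le_trans (Sb _)) => //.
  by have -> : gs (- n.+1%:R) = gs n.+1%:R by rewrite /gauss_fun sqrrN.
have h3 : \int[mu]_x (K t c \_ (D n)) x @[n --> \oo] --> (0 : R).
  by under eq_fun do rewrite FTC.
by apply: cvg_unique h1 h3; exact: norm_hausdorff.
Unshelve. all: by end_near. Qed.

Let H c t := \int[mu]_x (cos (t * x + c) * gs x).

(** Differentiation under the integral sign produces - x sin (t x + c), and
    integration by parts turns the factor x back into t / 2. *)
Lemma is_derive_H (c t : R) : is_derive t 1 (H c) (- (t / 2) * H c t).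
Proof.
pose f (t x : R) := cos (t * x + c) * gs x.
have df (u x : R) : is_derive u 1 (f ^~ x) (- (x ^+ 1 * gs x * sin (x * u + c))).
  have Hd := is_deriveM (is_derive_cos_affine x c u) (is_derive_cst (gs x) u 1).
  apply: (is_derive_eq Hd).
  rewrite /GRing.scale /= [x * u]mulrC; ring.
have p1 (u x : R) : partial1of2 f u x = - (x ^+ 1 * gs x * sin (x * u + c)).
  by rewrite partial1of2E; have [_ ->] := df u x.
have tI : `]t - 1, t + 1[%classic t by rewrite /= in_itv /=; apply/andP; split; lra.
have intf x : `]t - 1, t + 1[%classic x -> mu.-integrable setT (EFin \o f x).
  move=> _; have := i0 x c; congr (_.-integrable _ (EFin \o _)); apply/funext => y.
  by rewrite /f [x * y]mulrC; ring.
have derf x y : `]t - 1, t + 1[%classic x -> [set: R] y -> derivable (f ^~ y) x 1.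
  by move=> _ _; have [] := df x y.
have G0 (y : R) : 0 <= `|y ^+ 1 * gs y| by [].
have Gub x y : `]t - 1, t + 1[%classic x -> [set: R] y -> `|partial1of2 f x y| <= `|y ^+ 1 * gs y|.
  by move=> _ _; rewrite p1 normrN normrM ler_piMr// sin_max.
have iG := integrable_norm (gauss_moment_int 1).
have d1 := @derivable_under_integral _ _ _ mu f setT measurableT t _ _ tI intf derf _ G0 iG Gub.
have d2 := @differentiation_under_integral _ _ _ mu f setT measurableT t _ _ tI intf derf _ G0 iG Gub.
split => //.
rewrite -derive1E [LHS]d2.
have := gauss_by_parts t c; rewrite /K RintegralB//; [|exact: RintegrableZ (i0 t c)|exact: RintegrableZ (i1 t c)].
rewrite (RintegralZl t measurableT (i0 t c)) (RintegralZl 2 measurableT (i1 t c)).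
set I0 := \int[mu]_x (x ^+ 0 * gs x * cos (x * t + c)).
set I1 := \int[mu]_x (x ^+ 1 * gs x * sin (x * t + c)) => e.
have -> : H c t = I0 by apply: eq_Rintegral => x _; rewrite /= [t * x]mulrC; ring.
transitivity (- I1); last by lra.
rewrite -mulN1r -(RintegralZl (-1) measurableT (i1 t c)).
by apply: eq_Rintegral => x _; rewrite p1 mulN1r.
Qed.

(** The linear differential equation of [is_derive_H], integrated from 0, where the
    value is given by the Gauss integral. *)
Lemma gauss_cos (t c : R) : \int[mu]_x (cos (t * x + c) * gs x) =
  Num.sqrt pi * expR (- (t ^+ 2 / 4)) * cos c.
Proof.
pose g (u : R) := H c u * expR (u ^+ 2 / 4).
have dg (u : R) : is_derive u 1 g 0.
  have d1 : is_derive u 1 (fun u : R => u ^+ 2 / 4) (u / 2).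
    have Hd := is_deriveM (is_deriveX 2 (is_derive_id u 1)) (is_derive_cst (4^-1 : R) u 1).
    apply: (is_derive_eq Hd).
    by rewrite /GRing.scale /= mulr0 add0r mulr1 expr1; field.
  have d2 := @is_derive1_comp _ expR (fun u : R => u ^+ 2 / 4) u _ _ (is_derive_expR _) d1.
  have d3 := is_deriveM (is_derive_H c u) d2.
  by apply: (is_derive_eq d3); rewrite /GRing.scale /=; field.
have := is_derive_0_is_cst t 0 dg.
rewrite /g expr0n /= mul0r expR0 mulr1.
have -> : H c 0 = Num.sqrt pi * cos c.
  rewrite /H; under eq_Rintegral do rewrite mul0r add0r.
  rewrite RintegralZl//; last exact: integrableT_gauss.
  by rewrite /Rintegral integralT_gauss /= mulrC.
move=> e.
have E : expR (t ^+ 2 / 4) * expR (- (t ^+ 2 / 4)) = 1 :> R by rewrite expRxMexpNx_1.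
have -> : \int[mu]_x (cos (t * x + c) * gs x) =
    H c t * expR (t ^+ 2 / 4) * expR (- (t ^+ 2 / 4)) by rewrite -mulrA E mulr1.
by rewrite e; ring.
Qed.

End GaussCosine.

(** * The limit law *)

Section ProbabilityIntegral.
Context d (T : measurableType d) (R : realType) (P : probability T R).

Lemma bounded_integrable (f : T -> R) (c : R) :
  measurable_fun setT f -> (forall x, `|f x| <= c) -> P.-integrable setT (EFin \o f).
Proof. by move=> mf fc; exact: Mom_int (Mom_bounded P mf fc). Qed.

Lemma integral_prob_cst (c : R) : (\int[P]_x c%:E = c%:E)%E.
Proof. by have := @expectation_cst _ _ _ P c; rewrite expectation.unlock. Qed.

End ProbabilityIntegral.

Section NormalLaw.
Variable R : realType.
Local Notation mu := (@lebesgue_measure R).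
Local Notation gs := (@gauss_fun R).
Local Notation sigma := (Num.sqrt (2^-1 : R)).
Local Notation N := (normal_prob 0 sigma).

Let sigma_neq0 : sigma != 0.
Proof. by rewrite gt_eqF// sqrtr_gt0 invr_gt0. Qed.

Let sigma2 : sigma ^+ 2 = 2^-1.
Proof. by rewrite sqr_sqrtr// invr_ge0. Qed.

Lemma normal_pdf_half (x : R) : normal_pdf 0 sigma x = (Num.sqrt pi)^-1 * gs x.
Proof.
rewrite normal_pdfE// /normal_peak /normal_fun subr0 sigma2 /gauss_fun.
congr (_^-1 * expR _); last by rewrite -mulr_natr mulVf// divr1.
by congr (Num.sqrt _); rewrite -mulr_natr mulrAC mulVf ?mul1r.
Qed.

Lemma normal_density (f : R -> \bar R) : measurable_fun setT f ->
  (forall x, 0 <= f x)%E ->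
  (\int[N]_x f x = \int[mu]_x (f x * ((Num.sqrt pi)^-1 * gs x)%:E))%E.
Proof.
move=> mf f0.
rewrite (@density_integral _ (measurableTypeR R) R mu N (normal_pdf 0 sigma))//.
- by apply: eq_integral => x _; rewrite normal_pdf_half.
- exact: measurable_normal_pdf.
- exact: normal_pdf_ge0.
Qed.

Lemma normal_moment k : (\int[N]_x (`|x| ^+ k)%:E < +oo)%E.
Proof.
rewrite normal_density//; last first.
  by apply/measurable_EFinP; apply: measurable_funX; exact: normr_measurable.
have /integrable_norm := RintegrableZ (Num.sqrt pi)^-1 (gauss_moment_int R k).
move=> /integrableP[_]; apply: le_lt_trans.
rewrite le_eqVlt; apply/orP; left; apply/eqP; apply: eq_integral => x _.
rewrite /= -EFinM normr_id; congr (_%:E).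
rewrite !normrM normrX (ger0_norm (gauss_fun_ge0 x)) ger0_norm; last first.
  by rewrite invr_ge0 sqrtr_ge0.
ring.
Qed.

Lemma normal_cos (t c : R) :
  (\int[N]_x (cos (t * x + c))%:E)%E = (expR (- (t ^+ 2 / 4)) * cos c)%:E.
Proof.
have mc := measurable_cos_lin t c.
have ic : N.-integrable setT (EFin \o (fun x : R => cos (t * x + c))).
  by apply: (@bounded_integrable _ _ _ N _ 1) => // x; exact: cos_max.
have pi0 : 0 < Num.sqrt pi :> R by rewrite sqrtr_gt0 pi_gt0.
have ig : mu.-integrable setT (EFin \o (fun x : R => cos (t * x + c) * gs x)).
  have := gauss_int_bounded 0 mc (fun x => cos_max (t * x + c)).
  by congr (_.-integrable _ (EFin \o _)); apply/funext => x; rewrite expr0 mul1r mulrC.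
have i1 : N.-integrable setT (EFin \o (fun=> 1 : R)) by exact: finite_measure_integrable_cst.
have E : (\int[N]_x (1 + cos (t * x + c))%:E)%E =
    (1 + expR (- (t ^+ 2 / 4)) * cos c)%:E.
  rewrite normal_density; last 2 first.
  - by apply/measurable_EFinP; apply: measurable_funD => //; exact: measurable_cst.
  - by move=> x; rewrite lee_fin; have := cos_geN1 (t * x + c); lra.
  transitivity (\int[mu]_x ((Num.sqrt pi)^-1 * (gs x + cos (t * x + c) * gs x))%:E)%E.
    by apply: eq_integral => x _; rewrite -EFinM; congr (_%:E); ring.
  rewrite -[LHS]fineK; last first.
    apply: integrable_fin_num => //.
    by apply: RintegrableZ; apply: RintegrableD => //; exact: integrableT_gauss.
  rewrite -/(Rintegral _ _ _) RintegralZl//; last first.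
    by apply: RintegrableD => //; exact: integrableT_gauss.
  rewrite RintegralD//; last exact: integrableT_gauss.
  rewrite gauss_cos {1}/Rintegral integralT_gauss /=; congr (_%:E).
  by field; rewrite gt_eqF.
have E2 : (\int[N]_x (1 + cos (t * x + c))%:E)%E =
    (1 + \int[N]_x (cos (t * x + c))%:E)%E.
  under eq_integral do rewrite EFinD.
  rewrite integralD//; congr (_ + _)%E.
  exact: (@integral_prob_cst _ _ _ N).
have fc : (\int[N]_x (cos (t * x + c))%:E)%E \is a fin_num.
  exact: integrable_fin_num.
move: E; rewrite E2 -(fineK fc) -EFinD => -[] /addrI ->.
by [].
Qed.

Local Notation G := (gauss_XY R).

Lemma plane_measurable_affine (t1 t2 c : R) :
  measurable_fun setT (fun z : plane R => t1 * z.1 + t2 * z.2 + c : R).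
Proof.
apply: measurable_funD; last exact: measurable_cst.
apply: measurable_funD; apply: measurable_funM; first exact: measurable_cst.
- exact: measurable_fst.
- exact: measurable_cst.
- exact: measurable_snd.
Qed.

Lemma plane_measurable_cos (t1 t2 c : R) :
  measurable_fun setT (fun z : plane R => cos (t1 * z.1 + t2 * z.2 + c) : R).
Proof.
apply: (@measurableT_comp _ _ _ _ _ _ (@cos R)).
  by apply: continuous_measurable_fun; exact: continuous_cos.
exact: plane_measurable_affine.
Qed.

Lemma gauss_XY_cos (t1 t2 c : R) :
  \int[G]_z cos (t1 * z.1 + t2 * z.2 + c) = expR (- ((t1 ^+ 2 + t2 ^+ 2) / 4)) * cos c.
Proof.
have ig : (N \x N)%E.-integrable setT
    (EFin \o (fun z : plane R => cos (t1 * z.1 + t2 * z.2 + c))).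
  apply: (@bounded_integrable _ _ _ G _ 1); first exact: plane_measurable_cos.
  by move=> z; exact: cos_max.
rewrite /Rintegral -(integral12_prod_meas1 ig).
rewrite (eq_integral (fun x : measurableTypeR R =>
    ((expR (- (t2 ^+ 2 / 4)))%:E * (cos (t1 * x + c))%:E)%E)); last first.
  move=> x _; rewrite /fubini_F /=.
  under eq_integral do rewrite addrAC addrC.
  by rewrite normal_cos EFinM.
rewrite integralZl//; last first.
  apply: (@bounded_integrable _ _ _ N _ 1); first exact: measurable_cos_lin.
  by move=> z; exact: cos_max.
rewrite normal_cos /= mulrA -expRD; congr (expR _ * _).
by rewrite mulrDl; ring.
Qed.

Lemma gauss_XY_moment1 k : ('E_G[fun z : plane R => (`|z.1| ^+ k)%R] < +oo)%E.
Proof.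
rewrite expectation.unlock fubini_tonelli1//=.
- rewrite /fubini_F /=.
  rewrite (eq_integral (fun x : measurableTypeR R => (`|x| ^+ k)%:E)); first exact: normal_moment.
  by move=> x _; exact: (@integral_prob_cst _ _ _ N).
- apply/measurable_EFinP; apply: measurable_funX; apply: measurableT_comp => //.
Qed.

Lemma gauss_XY_moment2 k : ('E_G[fun z : plane R => (`|z.2| ^+ k)%R] < +oo)%E.
Proof.
rewrite expectation.unlock fubini_tonelli2//=.
- rewrite /fubini_G /=.
  rewrite (eq_integral (fun x : measurableTypeR R => (`|x| ^+ k)%:E)); first exact: normal_moment.
  by move=> x _; exact: (@integral_prob_cst _ _ _ N).
- apply/measurable_EFinP; apply: measurable_funX; apply: measurableT_comp => //.
Qed.

Lemma gauss_XY_Mom1 : Mom G (fun z : plane R => z.1).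
Proof. by apply/MomP; split; [exact: measurable_fst|exact: gauss_XY_moment1]. Qed.

Lemma gauss_XY_Mom2 : Mom G (fun z : plane R => z.2).
Proof. by apply/MomP; split; [exact: measurable_snd|exact: gauss_XY_moment2]. Qed.

Lemma gauss_G_finite_moments : finite_moments G (@gauss_G R).
Proof.
rewrite (_ : @gauss_G R = fun z : plane R => (z.1)%:C + 'i * (z.2)%:C).
  apply: fmD; first exact: gauss_XY_Mom1.
  by apply: fmM; [exact: fm_cst|exact: gauss_XY_Mom2].
apply/funext => z; rewrite /gauss_G; simpc.
by [].
Qed.

Lemma bivariate_normal_pdf_half (z : plane R) :
  bivariate_normal_pdf 0 (2^-1)%:M z =
  ((Num.sqrt pi)^-1 * gs z.1) * ((Num.sqrt pi)^-1 * gs z.2).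
Proof.
rewrite /bivariate_normal_pdf det_scalar.
have pi0 : 0 <= pi :> R := pi_ge0 R.
have -> : Num.sqrt ((2 * pi) ^+ 2 * (2^-1) ^+ 2) = Num.sqrt pi * Num.sqrt pi :> R.
  rewrite -exprMn mulrAC divff// mul1r sqrtr_sqr ger0_norm//.
  by rewrite -expr2 sqr_sqrtr.
rewrite invfM mulrACA; congr (_ * _).
rewrite /gauss_fun -expRD; congr expR.
rewrite invmx_scalar invrK subr0 mul_mx_scalar -scalemxAl mxE mxE big_ord_recl big_ord1.
by rewrite !mxE /=; field.
Qed.

(** The two descriptions of the limit law: product of two centred normal laws of
    variance 1/2, and density with respect to planar Lebesgue measure. *)
Lemma bivariate_normal_gauss_XY (A : set (plane R)) : measurable A ->
  bivariate_normal 0 (2^-1)%:M A = G A.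
Proof.
move=> mA; apply/esym; apply: product_measure_unique => //= A1 A2 mA1 mA2.
rewrite /bivariate_normal integral_mkcond.
pose g1 := (EFin \o normal_pdf 0 sigma) \_ A1.
pose g2 := (EFin \o normal_pdf 0 sigma) \_ A2.
have m1 : measurable_fun setT g1.
  apply/(measurable_restrictT _ _).1 => //; apply: measurable_funTS.
  by apply/measurable_EFinP; exact: measurable_normal_pdf.
have m2 : measurable_fun setT g2.
  apply/(measurable_restrictT _ _).1 => //; apply: measurable_funTS.
  by apply/measurable_EFinP; exact: measurable_normal_pdf.
have g10 x : (0 <= g1 x)%E.
  by rewrite /g1 patchE; case: ifP => // _; rewrite lee_fin normal_pdf_ge0.
have g20 x : (0 <= g2 x)%E.
  by rewrite /g2 patchE; case: ifP => // _; rewrite lee_fin normal_pdf_ge0.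
rewrite (eq_integral (fun z : plane R => g1 z.1 * g2 z.2)%E); last first.
  move=> z _; rewrite patchE /g1 /g2 !patchE bivariate_normal_pdf_half.
  rewrite -!normal_pdf_half.
  have -> : (z \in A1 `*` A2) = (z.1 \in A1) && (z.2 \in A2).
    by apply/idP/andP; rewrite !inE.
  by case: (z.1 \in A1); case: (z.2 \in A2); rewrite ?mule0 ?mul0e.
rewrite fubini_tonelli1//=; last 2 first.
- apply: emeasurable_funM.
    by apply: measurableT_comp => //; exact: measurable_fst.
  by apply: measurableT_comp => //; exact: measurable_snd.
- by move=> z; rewrite mule_ge0.
rewrite /fubini_F /=.
under eq_integral do rewrite ge0_integralZl//.
rewrite ge0_integralZr//; last by apply: integral_ge0.
rewrite /normal_prob.
by congr (_ * _)%E; rewrite [RHS]integral_mkcond.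
Qed.

End NormalLaw.

(** * Trigonometric approximation of continuous functions *)

Section TrigPoly.
Variable R : realType.

(** The span of the functions z |-> cos (t . z + c), an algebra containing the
    constants. *)
Inductive trigpoly : (R * R -> R) -> Prop :=
| trigpoly_cos t1 t2 c : trigpoly (fun z => cos (t1 * z.1 + t2 * z.2 + c))
| trigpolyD f g : trigpoly f -> trigpoly g -> trigpoly (fun z => f z + g z)
| trigpolyZ k f : trigpoly f -> trigpoly (fun z => k * f z).

Lemma trigpoly_cst k : trigpoly (fun=> k).
Proof.
have := trigpolyZ k (trigpoly_cos 0 0 0).
rewrite (_ : (fun z => _) = fun=> k)//; apply/funext => z /=.
by rewrite !mul0r !addr0 cos0 mulr1.
Qed.

Lemma trigpolyM f g : trigpoly f -> trigpoly g -> trigpoly (fun z => f z * g z).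
Proof.
move=> tf tg; elim: tf => [t1 t2 c|f1 f2 _ h1 _ h2|k f1 _ h1].
- elim: tg => [r1 r2 e|f1 f2 _ h1 _ h2|k f1 _ h1].
  + have := trigpolyD (trigpolyZ (2^-1) (trigpoly_cos (t1 + r1) (t2 + r2) (c + e)))
                      (trigpolyZ (2^-1) (trigpoly_cos (t1 - r1) (t2 - r2) (c - e))).
    congr trigpoly; apply/funext => z.
    have -> : (t1 + r1) * z.1 + (t2 + r2) * z.2 + (c + e) =
      (t1 * z.1 + t2 * z.2 + c) + (r1 * z.1 + r2 * z.2 + e) by ring.
    have -> : (t1 - r1) * z.1 + (t2 - r2) * z.2 + (c - e) =
      (t1 * z.1 + t2 * z.2 + c) - (r1 * z.1 + r2 * z.2 + e) by ring.
    by rewrite cosD cosB; field.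
  + by have := trigpolyD h1 h2; congr trigpoly; apply/funext => z; ring.
  + by have := trigpolyZ k h1; congr trigpoly; apply/funext => z; ring.
- by have := trigpolyD h1 h2; congr trigpoly; apply/funext => z; ring.
- by have := trigpolyZ k h1; congr trigpoly; apply/funext => z; ring.
Qed.

(** [bern u N phi] is the mean of [phi] under the binomial law of parameters [N]
    and [u], i.e. the Bernstein polynomial of [phi] at [u], computed by
    conditioning on the first trial. *)
Fixpoint bern (u : R) (N : nat) (phi : nat -> R) : R :=
  if N is N'.+1 then u * bern u N' (phi \o S) + (1 - u) * bern u N' phi else phi 0%N.

Lemma bernD u N phi psi : bern u N (fun k => phi k + psi k) = bern u N phi + bern u N psi.
Proof.
elim: N phi psi => [//|N IH] phi psi /=.
rewrite (IH (phi \o S) (psi \o S)) (IH phi psi); ring.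
Qed.

Lemma bernZ u N a phi : bern u N (fun k => a * phi k) = a * bern u N phi.
Proof.
elim: N phi => [//|N IH] phi /=.
rewrite (IH (phi \o S)) (IH phi); ring.
Qed.

Lemma bern_cst u N c : bern u N (fun=> c) = c.
Proof.
elim: N => [//|N IH] /=; rewrite (_ : _ \o S = fun=> c)// IH; ring.
Qed.

(** The mean square distance to a of a binomial variable: bias plus variance. *)
Lemma bern_sqr u N a :
  bern u N (fun k => (k%:R - a) ^+ 2) = (N%:R * u - a) ^+ 2 + N%:R * u * (1 - u).
Proof.
elim: N a => [|N IH] a /=; first by rewrite !mul0r addr0.
rewrite (_ : _ \o S = fun k => (k%:R - (a - 1)) ^+ 2); last first.
  by apply/funext => k /=; rewrite -natr1; congr (_ ^+ 2); ring.
by rewrite !IH -natr1; ring.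
Qed.

Lemma bern_le u N phi psi : 0 <= u <= 1 -> (forall k, (k <= N)%N -> phi k <= psi k) ->
  bern u N phi <= bern u N psi.
Proof.
move=> /andP[u0 u1]; elim: N phi psi => [|N IH] phi psi h /=; first exact: h.
apply: lerD; apply: ler_wpM2l; rewrite ?subr_ge0//; apply: IH => k kN.
  exact: h.
by apply: h; rewrite (leq_trans kN).
Qed.

Lemma bern_norm u N phi c : 0 <= u <= 1 -> (forall k, (k <= N)%N -> `|phi k| <= c) ->
  `|bern u N phi| <= c.
Proof.
move=> u01 h; rewrite ler_norml; apply/andP; split.
  rewrite -(bern_cst u N (- c)); apply: bern_le => // k /h.
  by rewrite ler_norml => /andP[].
rewrite -(bern_cst u N c); apply: bern_le => // k /h.
by rewrite ler_norml => /andP[].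
Qed.

Lemma trigpoly_bern (u : R * R -> R) N (phi : nat -> R * R -> R) : trigpoly u ->
  (forall k, trigpoly (phi k)) -> trigpoly (fun z => bern (u z) N (phi ^~ z)).
Proof.
move=> tu; elim: N phi => [|N IH] phi tphi /=; first exact: tphi.
apply: trigpolyD; apply: trigpolyM => //.
- by apply: (IH (phi \o S)) => k; exact: tphi.
- apply: trigpolyD; first exact: trigpoly_cst.
  by have := trigpolyZ (-1) tu; congr trigpoly; apply/funext => z; ring.
- exact: IH.
Qed.

(** The derivative of sine is at least cos 1 on [-1, 1]. *)
Lemma sin_expanding (a b : R) : `|a| <= 1 -> `|b| <= 1 ->
  cos 1 * `|a - b| <= `|sin a - sin b|.
Proof.
wlog ba : a b / b < a => [h|].
  case: (ltgtP b a) => [/h|ab|->].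
  - by apply.
  - by move=> a1 b1; rewrite distrC [leRHS]distrC; apply: h.
  - by rewrite !subrr normr0 mulr0.
move=> a1 b1.
have cs : {within `[b, a], continuous sin}.
  by apply: derivable_within_continuous => y _; exact: derivable_sin.
have [x xab ->] := @MVT R sin cos b a ba (fun y _ => is_derive_sin y) cs.
rewrite normrM ler_wpM2r//; apply: le_trans (ler_norm _).
have x1 : `|x| <= 1.
  move: xab a1 b1; rewrite in_itv /= !ler_norml => /andP[bx xa] /andP[_ a1] /andP[b1 _].
  by apply/andP; split; lra.
have p1 : 1 <= pi :> R by rewrite (le_trans _ (pi_ge2 R))// ler1n.
have xp : `|x| <= pi by exact: le_trans p1.
by rewrite -(cos_norm x) leNgt ltr_cos ?in_itv /= ?normr_ge0 ?ler01 ?p1 ?xp// -leNgt.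
Qed.

(** The abscissa whose sine is closest to [v], within [-1, 1]. *)
Definition arc (v : R) : R := asin (Num.max (- sin 1) (Num.min (sin 1) v)).

Lemma sin1_itv : 0 < sin (1 : R) <= 1.
Proof.
apply/andP; split; last exact: sin_le1.
by apply: sin2_gt0; rewrite ltr01 ltr1n.
Qed.

Lemma arc_facts v : `|arc v| <= 1 /\ sin (arc v) = Num.max (- sin 1) (Num.min (sin 1) v).
Proof.
have /andP[s0 s1] := sin1_itv.
set w := Num.max _ _.
have w1 : - sin 1 <= w <= sin 1.
  by rewrite /w le_max lexx /= ge_max ge_min lexx; apply/andP; split => //; lra.
have ww : -1 <= w <= 1 by move: w1 => /andP[? ?]; apply/andP; split; lra.
have e : sin (arc v) = w by rewrite /arc asinK.
split=> //.
have p1 : 1 <= pi / 2 :> R := pihalf_ge1 R.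
have m1 := asin_geNpi2 ww; have m2 := asin_lepi2 ww.
have hpi : `[(- (pi / 2)), pi / 2] =i [pred x : R | -(pi / 2) <= x <= pi / 2].
  by move=> x; rewrite in_itv.
rewrite ler_norml; apply/andP; split; rewrite leNgt; apply/negP.
  rewrite -ltr_sin ?hpi ?inE ?m1//=; last by apply/andP; split; lra.
  rewrite e sinN => h; move: w1 => /andP[? ?]; lra.
rewrite -ltr_sin ?hpi ?inE ?m1//=; last by apply/andP; split; lra.
rewrite e => h; move: w1 => /andP[? ?]; lra.
Qed.

(** Projection to the interval [- sin 1, sin 1], which contains sin a, can only
    bring v closer to sin a. *)
Lemma arc_dist (a v : R) : `|a| <= 1 -> cos 1 * `|arc v - a| <= `|v - sin a|.
Proof.
move=> a1; have [b1 e] := arc_facts v.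
apply: (le_trans (sin_expanding b1 a1)); rewrite e.
have /andP[s0 s1] := sin1_itv.
have [sa1 sa2] : - sin 1 <= sin a /\ sin a <= sin 1.
  have p1 : 1 <= pi / 2 :> R := pihalf_ge1 R.
  move: a1; rewrite ler_norml => /andP[h1 h2].
  have hpi : `[(- (pi / 2)), pi / 2] =i [pred x : R | -(pi / 2) <= x <= pi / 2].
    by move=> x; rewrite in_itv.
  split; rewrite -?sinN leNgt; apply/negP; rewrite ltr_sin ?hpi ?inE/=;
    by [lra | apply/andP; split; lra].
have := ler_norm (v - sin a); have := ler_norm (- (v - sin a)); rewrite normrN => n1 n2.
case: (leP (sin 1) v) => h; case: (leP (- sin 1) _) => h2;
  by rewrite ler_norml; apply/andP; split; lra.
Qed.

End TrigPoly.

Section UniformContinuity.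
Variable R : realType.

Lemma box_unif_continuous (f : R * R -> R) (L eps : R) : continuous f -> 0 < eps ->
  exists2 delta, 0 < delta & forall z z' : R * R, `|z.1| <= L -> `|z.2| <= L ->
    `|z'.1 - z.1| < delta -> `|z'.2 - z.2| < delta -> `|f z' - f z| <= eps.
Proof.
move=> cf e0.
pose K : set (R * R) := `[-L, L]%classic `*` `[-L, L]%classic.
have cK : compact K by apply: compact_setX; exact: segment_compact.
move/compact_near_coveringP : cK => /(_ R (0^'+) 
  (fun delta z => forall z' : R * R, `|z'.1 - z.1| < delta -> `|z'.2 - z.2| < delta ->
     `|f z' - f z| <= eps)) [].
move=> z Kz.
have e20 : 0 < eps / 2 by rewrite divr_gt0.
have /cvgrPdist_lt/(_ _ e20) := cf z.
rewrite /= => /nbhs_ballP[r /= r0 hr].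
have r20 : 0 < r / 2 by rewrite divr_gt0.
exists (ball z (r / 2), [set d | 0 < d < r / 2]).
  split; first exact: nbhsx_ballx.
  exists (r / 2) => //= x; rewrite /= sub0r normrN => h x0; rewrite x0 /=.
  by rewrite (le_lt_trans (ler_norm _)).
move=> [z1 d] /= [[b1 b2] /andP[d0 dr]] z' h1 h2.
have f1 : `|f z - f z1| < eps / 2.
  apply: hr; apply: (@le_ball _ _ _ (r/2)); last by split.
  lra.
have f2 : `|f z - f z'| < eps / 2.
  move: b1 b2; rewrite /ball /= => b1 b2.
  apply: hr; split; rewrite /ball /=.
    have -> : z.1 - z'.1 = (z.1 - z1.1) - (z'.1 - z1.1) by ring.
    apply: (le_lt_trans (ler_normB _ _)); lra.
  have -> : z.2 - z'.2 = (z.2 - z1.2) - (z'.2 - z1.2) by ring.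
  apply: (le_lt_trans (ler_normB _ _)); lra.
have -> : f z' - f z1 = (f z - f z1) - (f z - f z') by ring.
apply: (le_trans (ler_normB _ _)); lra.
move=> d /= d0 hd.
exists (d / 2); first by rewrite divr_gt0.
move=> z z' z1 z2; apply: hd; rewrite /= ?sub0r ?normrN ?gtr0_norm ?divr_gt0//.
  by rewrite ltr_pdivrMr// mulr_natr mulr2n ltrDl.
by split; rewrite /= in_itv /= -ler_norml.
Qed.

End UniformContinuity.

Section TrigApproximation.
Variable R : realType.

(** A Bernstein polynomial of f in the variables u (z.1) and u (z.2), where u is
    (1 + sin (x / L)) / 2. Since u takes its values in [0, 1] everywhere, the
    approximation is bounded by M on the whole plane, although it is close to f
    only on the box, where the sine is increasing. As u is trigonometric, so are
    polynomials in it. *)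
Lemma trig_approx (f : R * R -> R) (M L eps : R) : continuous f ->
  (forall z, `|f z| <= M) -> 0 < L -> 0 < eps ->
  exists p, [/\ trigpoly p, forall z, `|p z| <= M &
    forall z, `|z.1| <= L -> `|z.2| <= L -> `|p z - f z| <= eps].
Proof.
move=> cf fM L0 e0.
have M0 : 0 <= M by exact: le_trans (fM (0, 0)).
have e20 : 0 < eps / 2 by rewrite divr_gt0.
have [delta d0 fd] := box_unif_continuous L cf e20.
(* Uniform continuity and boundedness in one quadratic inequality, the only one
   that can be averaged against the binomial weights. *)
pose C0 := 2 * M / delta ^+ 2.
have C00 : 0 <= C0 by rewrite /C0; apply: divr_ge0; [exact: mulr_ge0|exact: sqr_ge0].
have fC (z z' : R * R) : `|z.1| <= L -> `|z.2| <= L ->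
    `|f z' - f z| <= eps / 2 + C0 * ((z'.1 - z.1) ^+ 2 + (z'.2 - z.2) ^+ 2).
  move=> z1 z2.
  have far (h : R) : delta <= `|h| -> 2 * M <= C0 * h ^+ 2.
    move=> dh; rewrite /C0 mulrAC -mulrA ler_peMr ?mulr_ge0//.
    rewrite ler_pdivlMr ?exprn_gt0// mul1r -[leRHS]real_normK ?num_real//.
    by rewrite lerXn2r ?nnegrE// ltW.
  have f2M : `|f z' - f z| <= 2 * M.
    by apply: (le_trans (ler_normB _ _)); have := fM z; have := fM z'; lra.
  have q1 : 0 <= C0 * (z'.1 - z.1) ^+ 2 by rewrite mulr_ge0 ?sqr_ge0.
  have q2 : 0 <= C0 * (z'.2 - z.2) ^+ 2 by rewrite mulr_ge0 ?sqr_ge0.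
  rewrite mulrDr.
  have [/far h|h1] := leP delta `|z'.1 - z.1|; first lra.
  have [/far h|h2] := leP delta `|z'.2 - z.2|; first lra.
  have := fd z z' z1 z2 h1 h2; lra.
have c0 : 0 < cos 1 :> R := cos1_gt0 R.
pose C := C0 * (L / cos 1) ^+ 2.
have C_ge0 : 0 <= C by rewrite mulr_ge0// sqr_ge0.
have [N NC] : exists N, 4 * C / eps <= N.+1%:R.
  have h : 0 <= 4 * C / eps by apply: divr_ge0; [exact: mulr_ge0|exact: ltW].
  exists (Num.Def.archi_bound (4 * C / eps)).
  by apply: (le_trans (ltW (archi_boundP h))); rewrite ler_nat.
pose n := N.+1.
have n0 : 0 < n%:R :> R by rewrite ltr0n.
pose v (k : nat) : R := 2 * (k%:R / n%:R) - 1.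
pose u (x : R) : R := (1 + sin (x / L)) / 2.
have u01 x : 0 <= u x <= 1.
  have := sin_geN1 (x / L); have := sin_le1 (x / L) => ? ?.
  by apply/andP; split; rewrite /u; lra.
pose node k := L * arc (v k).
pose p (z : R * R) := bern (u z.1) n (fun k => bern (u z.2) n (fun l => f (node k, node l))).
exists p; split.
- have tu1 : trigpoly (fun z : R * R => u z.1).
    have := trigpolyD (trigpoly_cst (2^-1)) (trigpolyZ (2^-1) (trigpoly_cos (L^-1) 0 (- (pi / 2)))).
    congr trigpoly; apply/funext => z; rewrite cosBpihalf /u mul0r addr0 mulrC.
    by rewrite [L^-1 * _]mulrC mulrDl mul1r mulrC; congr (_ + _); rewrite mulrC.
  have tu2 : trigpoly (fun z : R * R => u z.2).
    have := trigpolyD (trigpoly_cst (2^-1)) (trigpolyZ (2^-1) (trigpoly_cos 0 (L^-1) (- (pi / 2)))).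
    congr trigpoly; apply/funext => z; rewrite cosBpihalf /u mul0r add0r.
    by have -> : L^-1 * z.2 = z.2 / L by [rewrite mulrC]; field.
  apply: (@trigpoly_bern _ (fun z => u z.1) n (fun k z => bern (u z.2) n _)) => // k.
  by apply: (@trigpoly_bern _ (fun z => u z.2) n (fun l z => _)) => // l; exact: trigpoly_cst.
- by move=> z; apply: bern_norm => // k _; apply: bern_norm.
move=> z z1 z2.
have nodeE x k : `|x| <= L -> (node k - x) ^+ 2 <=
    (L / cos 1) ^+ 2 * ((2 / n%:R) ^+ 2 * (k%:R - n%:R * u x) ^+ 2).
  move=> xL.
  have xL1 : `|x / L| <= 1.
    by rewrite normrM normfV (gtr0_norm L0) ler_pdivrMr// mul1r.
  have := arc_dist (v k) xL1.
  have -> : v k - sin (x / L) = 2 / n%:R * (k%:R - n%:R * u x).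
    rewrite /v /u; field; lra.
  move=> h.
  have -> : node k - x = L * (arc (v k) - x / L).
    by rewrite /node mulrBr; congr (_ - _); field; lra.
  rewrite -!exprMn -[leLHS]real_normK ?num_real// -[leRHS]real_normK ?num_real//.
  rewrite lerXn2r ?nnegrE// normrM [leRHS]normrM normrM normfV.
  rewrite (gtr0_norm L0) (gtr0_norm c0) -mulrA ler_wpM2l ?(ltW L0)//.
  by rewrite ler_pdivlMl.
pose a := C * (2 / n%:R) ^+ 2.
have nodeC x k : `|x| <= L -> C0 * (node k - x) ^+ 2 <= a * (k%:R - n%:R * u x) ^+ 2.
  move=> xL; rewrite /a /C -(mulrA C0) -(mulrA C0) -(mulrA ((L / cos 1) ^+ 2)).
  by apply: ler_wpM2l => //; exact: nodeE.
have pt k l : `|f (node k, node l) - f z| <=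
   eps / 2 + (a * (k%:R - n%:R * u z.1) ^+ 2 + a * (l%:R - n%:R * u z.2) ^+ 2).
  apply: (le_trans (fC z _ z1 z2)); rewrite lerD2l /= mulrDr.
  by apply: lerD; exact: nodeC.
have var x : a * (n%:R * u x * (1 - u x)) <= eps / 4.
  have -> : a * (n%:R * u x * (1 - u x)) = 4 * C / n%:R * (u x * (1 - u x)).
    by rewrite /a; field; lra.
  have uu : 0 <= u x * (1 - u x) <= 1 / 4.
    have /andP[u0 u1] := u01 x; apply/andP; split; first by rewrite mulr_ge0 ?subr_ge0.
    have := sqr_ge0 (u x - 1 / 2); nra.
  have Cn : 4 * C / n%:R <= eps.
    by rewrite ler_pdivrMr// [leRHS]mulrC -ler_pdivrMr.
  move: uu => /andP[u0 u1].
  apply: (@le_trans _ _ (eps * (u x * (1 - u x)))); first by rewrite ler_wpM2r.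
  by have := ler_wpM2l (ltW e0) u1; lra.
have H k : `|bern (u z.2) n (fun l => f (node k, node l)) - f z| <=
    eps / 2 + eps / 4 + a * (k%:R - n%:R * u z.1) ^+ 2.
  have -> : bern (u z.2) n (fun l => f (node k, node l)) - f z =
      bern (u z.2) n (fun l => f (node k, node l) + (- f z)) by rewrite bernD bern_cst.
  have hb : bern (u z.2) n (fun l => (eps / 2 + a * (k%:R - n%:R * u z.1) ^+ 2) +
     a * (l%:R - n%:R * u z.2) ^+ 2) <= eps / 2 + eps / 4 + a * (k%:R - n%:R * u z.1) ^+ 2.
    rewrite bernD bern_cst bernZ bern_sqr subrr expr0n add0r.
    have := var z.2; lra.
  rewrite ler_norml; apply/andP; split.
    apply: (@le_trans _ _ (- bern (u z.2) n (fun l => (eps / 2 + a * (k%:R - n%:R * u z.1) ^+ 2) +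
       a * (l%:R - n%:R * u z.2) ^+ 2))); first by rewrite lerN2.
    rewrite -mulN1r -bernZ; apply: bern_le => // l _.
    by have := pt k l; rewrite ler_norml => /andP[+ _]; rewrite mulN1r; lra.
  apply: le_trans hb; apply: bern_le => // l _.
  by have := pt k l; rewrite ler_norml => /andP[_]; lra.
have -> : p z - f z =
    bern (u z.1) n (fun k => bern (u z.2) n (fun l => f (node k, node l)) + (- f z)).
  by rewrite bernD bern_cst.
have hb : bern (u z.1) n (fun k => (eps / 2 + eps / 4) +
   a * (k%:R - n%:R * u z.1) ^+ 2) <= eps.
  rewrite bernD bern_cst bernZ bern_sqr subrr expr0n add0r.
  have := var z.1; lra.
rewrite ler_norml; apply/andP; split.
  apply: (@le_trans _ _ (- bern (u z.1) n (fun k => (eps / 2 + eps / 4) +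
     a * (k%:R - n%:R * u z.1) ^+ 2))); first by rewrite lerN2.
  rewrite -mulN1r -bernZ; apply: bern_le => // k _.
  by have := H k; rewrite ler_norml => /andP[+ _]; rewrite mulN1r; lra.
apply: le_trans hb; apply: bern_le => // k _.
by have := H k; rewrite ler_norml => /andP[_].
Qed.

End TrigApproximation.

(** * Empirical means of trigonometric functions *)

Section EmpiricalMean.
Context d (T : measurableType d) (R : realType) (P : probability T R).
Variable (s : nat -> {RV P >-> R}).

Definition scaled_entry (n : nat) (w : T) (m : nat) : R := (Num.sqrt n.+1%:R)^-1 * s m w.

Definition ev_point (n j : nat) (w : T) : R * R :=
  (\sum_(m < n.+1) scaled_entry n w m * cos (theta R n.+1 j * m%:R),
   \sum_(m < n.+1) scaled_entry n w m * sin (theta R n.+1 j * m%:R)).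

(** The integral of f against the empirical spectral distribution. *)
Definition emp (n : nat) (f : R * R -> R) (w : T) : R :=
  n.+1%:R^-1 * \sum_(j < n.+1) f (ev_point n j w).

Definition coeff (t1 t2 : R) (n j m : nat) : R :=
  (Num.sqrt n.+1%:R)^-1 * wave t1 t2 n.+1 j m.

Lemma ev_point_lin (t1 t2 : R) n j w :
  t1 * (ev_point n j w).1 + t2 * (ev_point n j w).2 = lin_comb s (coeff t1 t2 n j) n.+1 w.
Proof.
rewrite /ev_point /= !mulr_sumr -big_split; apply: eq_bigr => m _ /=.
rewrite /scaled_entry /coeff /wave; ring.
Qed.

Lemma measurable_ev_point n j : measurable_fun setT (ev_point n j : T -> plane R).
Proof.
apply: measurable_fun_pair; apply: measurable_sum => m;
  (apply: measurable_funM; last exact: measurable_cst);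
  (apply: measurable_funM; first exact: measurable_cst); exact: measurable_funP.
Qed.

Lemma measurable_emp n (f : R * R -> R) :
  measurable_fun setT (f : plane R -> R) -> measurable_fun setT (emp n f).
Proof.
move=> mf; apply: measurable_funM; first exact: measurable_cst.
apply: measurable_sum => j.
exact: (@measurableT_comp _ _ _ _ _ _ (f : plane R -> R) _ _ mf (measurable_ev_point n j)).
Qed.

Lemma emp_cst n (c : R) w : emp n (fun=> c) w = c.
Proof.
by rewrite /emp sumr_const card_ord -[c *+ _]mulr_natl mulrA mulVf ?mul1r// pnatr_eq0.
Qed.

Lemma empD n f g w : emp n (fun z => f z + g z) w = emp n f w + emp n g w.
Proof. by rewrite /emp big_split /= mulrDr. Qed.

Lemma empZ n c f w : emp n (fun z => c * f z) w = c * emp n f w.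
Proof. by rewrite /emp -mulr_sumr mulrCA. Qed.

Lemma emp_le n f g w : (forall z, f z <= g z) -> emp n f w <= emp n g w.
Proof.
by move=> fg; rewrite /emp ler_wpM2l ?invr_ge0//; apply: ler_sum => j _.
Qed.

Lemma emp_norm n f w : `|emp n f w| <= emp n (fun z => `|f z|) w.
Proof.
rewrite /emp normrM ger0_norm ?invr_ge0// ler_wpM2l ?invr_ge0//.
exact: ler_norm_sum.
Qed.

Lemma emp_bounded n f c w : (forall z, `|f z| <= c) -> `|emp n f w| <= c.
Proof.
move=> fc; apply: (le_trans (emp_norm _ _ _)).
by rewrite -[leRHS](emp_cst n c w); exact: emp_le.
Qed.

Lemma emp_Mom n f c : measurable_fun setT (f : plane R -> R) ->
  (forall z, `|f z| <= c) -> Mom P (emp n f).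
Proof.
move=> mf fc; apply: (@Mom_bounded _ _ _ _ _ c); first exact: measurable_emp.
by move=> w; exact: emp_bounded.
Qed.

Lemma coeff_bound t1 t2 n j m :
  `|coeff t1 t2 n j m| <= (Num.sqrt n.+1%:R)^-1 * (`|t1| + `|t2|).
Proof.
rewrite /coeff normrM ger0_norm ?invr_ge0 ?sqrtr_ge0// ler_wpM2l ?invr_ge0 ?sqrtr_ge0//.
apply: (le_trans (ler_normD _ _)); rewrite !normrM.
by apply: lerD; rewrite ler_piMr ?cos_max ?sin_max.
Qed.

Lemma coeff_orthogonal t1 t2 n j k : (j < n.+1)%N -> (k < n.+1)%N -> (j + k)%N != n ->
  \sum_(m < n.+1) coeff t1 t2 n j m * coeff t1 t2 n k m =
  if j == k then (t1 ^+ 2 + t2 ^+ 2) / 2 else 0.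
Proof.
move=> jn kn jk.
have sq : (Num.sqrt n.+1%:R)^-1 * (Num.sqrt n.+1%:R)^-1 = n.+1%:R^-1 :> R.
  by rewrite -invfM -expr2 sqr_sqrtr.
rewrite (eq_bigr (fun m : 'I_n.+1 => n.+1%:R^-1 *
   (wave t1 t2 n.+1 j m * wave t1 t2 n.+1 k m))); last first.
  by move=> m _; rewrite /coeff mulrACA sq.
rewrite -mulr_sumr wave_orthogonal//.
case: ifP => _; last by rewrite mulr0.
by field.
Qed.

Lemma lin_combD x y n w : lin_comb s (fun m => x m + y m) n w =
  lin_comb s x n w + lin_comb s y n w.
Proof. by rewrite /lin_comb -big_split; apply: eq_bigr => m _; rewrite mulrDl. Qed.

Lemma lin_combB x y n w : lin_comb s (fun m => x m - y m) n w =
  lin_comb s x n w - lin_comb s y n w.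
Proof.
rewrite /lin_comb -sumrN -big_split; apply: eq_bigr => m _; by rewrite mulrBl.
Qed.

Hypothesis ind : independent_RVs s.

Section Pairs.
Variables (eps eta : R).
Hypothesis e0 : 0 <= eps.
Hypothesis cf : small_cf s eps eta.
Variables (t1 t2 c : R) (n : nat).
Hypothesis small : 2 * ((Num.sqrt n.+1%:R)^-1 * (`|t1| + `|t2|)) <= eta.
Let tt := t1 ^+ 2 + t2 ^+ 2.
Let L := expR (- (tt / 4)) * cos c.
Let A j w := cos (t1 * (ev_point n j w).1 + t2 * (ev_point n j w).2 + c).

Let tt0 : 0 <= tt. Proof. by rewrite addr_ge0 ?sqr_ge0. Qed.

Let L1 : `|L| <= 1.
Proof.
rewrite /L normrM mulr_ile1 ?cos_max// ger0_norm ?expR_ge0//.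
by rewrite expR_le1 oppr_le0 divr_ge0.
Qed.

Let A_Mom j : Mom P (A j).
Proof.
apply: (@Mom_bounded _ _ _ _ _ 1); last by move=> w; exact: cos_max.
exact: (@measurableT_comp _ _ _ _ _ _ _ _ _ (plane_measurable_cos t1 t2 c)
  (measurable_ev_point n j)).
Qed.

Let mean_A j : (j < n.+1)%N -> (j + j)%N != n ->
  `|\int[P]_w A j w - L| <= eps * tt.
Proof.
move=> jn jj.
have := @cos_lin_comb _ _ _ _ s ind eps eta (coeff t1 t2 n j) n.+1 c e0 cf.
have -> : \sum_(m < n.+1) coeff t1 t2 n j m ^+ 2 = tt / 2.
  by have := coeff_orthogonal t1 t2 jn jn jj; rewrite eqxx.
have -> : tt / 2 / 2 = tt / 4 by field.
have -> : 2 * eps * (tt / 2) = eps * tt by field.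
move=> /(_ _); under eq_Rintegral do rewrite -ev_point_lin.
apply => m mn; apply: (le_trans (coeff_bound _ _ _ _ _)).
apply: le_trans small; have : 0 <= (Num.sqrt n.+1%:R)^-1 * (`|t1| + `|t2|).
  by rewrite mulr_ge0 ?addr_ge0// invr_ge0 sqrtr_ge0.
lra.
Qed.

(** For a pair of eigenvalues with orthogonal coefficient vectors, the sum and the
    difference of the two linear forms both have squared length t1^2 + t2^2; the
    product of cosines is half the sum of the cosines of both. *)
Let mean_AA j k : (j < n.+1)%N -> (k < n.+1)%N -> (j + k)%N != n -> j != k ->
  (j + j)%N != n -> (k + k)%N != n ->
  `|\int[P]_w (A j w * A k w) - L ^+ 2| <= 2 * eps * tt.
Proof.
move=> jn kn jk njk jj kk.
pose xj := coeff t1 t2 n j; pose xk := coeff t1 t2 n k.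
have Sjj : \sum_(m < n.+1) xj m * xj m = tt / 2.
  by rewrite coeff_orthogonal// eqxx.
have Skk : \sum_(m < n.+1) xk m * xk m = tt / 2.
  by rewrite coeff_orthogonal// eqxx.
have Sjk : \sum_(m < n.+1) xj m * xk m = 0.
  by rewrite coeff_orthogonal// (negbTE njk).
have Sp : \sum_(m < n.+1) (xj m + xk m) ^+ 2 = tt.
  rewrite (eq_bigr (fun m : 'I_n.+1 => xj m * xj m + (2 * (xj m * xk m) + xk m * xk m))).
    by rewrite !big_split /= -mulr_sumr Sjj Skk Sjk; field.
  by move=> m _; ring.
have Sm : \sum_(m < n.+1) (xj m - xk m) ^+ 2 = tt.
  rewrite (eq_bigr (fun m : 'I_n.+1 => xj m * xj m + (- 2 * (xj m * xk m) + xk m * xk m))).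
    by rewrite !big_split /= -mulr_sumr Sjj Skk Sjk; field.
  by move=> m _; ring.
have bj m : `|xj m| <= (Num.sqrt n.+1%:R)^-1 * (`|t1| + `|t2|) by exact: coeff_bound.
have bk m : `|xk m| <= (Num.sqrt n.+1%:R)^-1 * (`|t1| + `|t2|) by exact: coeff_bound.
have cp := @cos_lin_comb _ _ _ _ s ind eps eta (fun m => xj m + xk m) n.+1 (c + c) e0 cf.
have cm := @cos_lin_comb _ _ _ _ s ind eps eta (fun m => xj m - xk m) n.+1 0 e0 cf.
rewrite Sp in cp; rewrite Sm cos0 mulr1 in cm.
have {}cp := cp _; have {}cm := cm _.
have Mp : Mom P (fun w => cos (lin_comb s (fun m => xj m + xk m) n.+1 w + (c + c))).
  exact: Past_Mom (Past_cos ind _ _ _).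
have Mm : Mom P (fun w => cos (lin_comb s (fun m => xj m - xk m) n.+1 w + 0)).
  exact: Past_Mom (Past_cos ind _ _ _).
have E : \int[P]_w (A j w * A k w) =
   2^-1 * (\int[P]_w cos (lin_comb s (fun m => xj m + xk m) n.+1 w + (c + c)) +
           \int[P]_w cos (lin_comb s (fun m => xj m - xk m) n.+1 w + 0)).
  rewrite -RintegralD//; [|exact: Mom_int|exact: Mom_int].
  rewrite -RintegralZl//; last exact: Mom_int (MomD Mp Mm).
  apply: eq_Rintegral => w _; rewrite /A !ev_point_lin -/xj -/xk lin_combD lin_combB.
  set a := lin_comb _ _ _ _; set b := lin_comb _ _ _ _.
  have -> : a + b + (c + c) = (a + c) + (b + c) by ring.
  have -> : a - b + 0 = (a + c) - (b + c) by ring.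
  by rewrite (cosD (a + c)) (cosB (a + c)); field.
have L2 : L ^+ 2 = 2^-1 * (expR (- (tt / 2)) * cos (c + c) + expR (- (tt / 2))).
  have -> : expR (- (tt / 2)) = expR (- (tt / 4)) ^+ 2.
    by rewrite expr2 -expRD; congr expR; field.
  by rewrite -mulr2n cos_mulr2n /L; field.
rewrite E L2.
set a := \int[P]_w _ in cp *; set b := \int[P]_w _ in cm *.
have -> : 2^-1 * (a + b) - 2^-1 * (expR (- (tt / 2)) * cos (c + c) + expR (- (tt / 2))) =
  2^-1 * ((a - expR (- (tt / 2)) * cos (c + c)) + (b - expR (- (tt / 2)))) by ring.
rewrite normrM ger0_norm ?invr_ge0//.
have h1 : `|a - expR (- (tt / 2)) * cos (c + c)| <= 2 * eps * tt.
  apply: cp => m mn; apply: (le_trans (ler_normD _ _)); apply: le_trans small.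
  by have := bj m; have := bk m; lra.
have h2 : `|b - expR (- (tt / 2))| <= 2 * eps * tt.
  apply: cm => m mn; apply: (le_trans (ler_normB _ _)); apply: le_trans small.
  by have := bj m; have := bk m; lra.
have := ler_normD (a - expR (- (tt / 2)) * cos (c + c)) (b - expR (- (tt / 2))).
lra.
Qed.

(** The pairs attached to equal or complex conjugate roots of -1, and those that
    involve the real root -1, present in odd dimension: a proportion O(1/n) of
    all pairs. *)
Definition bad_pair (n j k : nat) : bool :=
  [|| j == k, (j + k)%N == n, (j + j)%N == n | (k + k)%N == n].

Let cov j k : (j < n.+1)%N -> (k < n.+1)%N ->
  \int[P]_w ((A j w - L) * (A k w - L)) <= 4 * eps * tt + 4 * (bad_pair n j k)%:R.
Proof.
move=> jn kn.
have MA i : Mom P (fun w => A i w - L) by apply: MomB; [exact: A_Mom|exact: Mom_cst].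
have [/=|/norP[njk /norP[jk /norP[jj kk]]]] := boolP (bad_pair n j k).
  move=> _; apply: (@le_trans _ _ (\int[P]_w (4 : R))); last first.
    by rewrite Rintegral_prob_cst mulr1 lerDr mulr_ge0 ?mulr_ge0.
  apply: le_Rintegral => //; [exact: Mom_int (MomM (MA j) (MA k))|exact: Mom_int (Mom_cst _ _)|].
  move=> w _; apply: (le_trans (ler_norm _)); rewrite normrM.
  have b2 i : `|A i w - L| <= 2.
    apply: (le_trans (ler_normB _ _)).
    by have : `|A i w| <= 1 by [exact: cos_max]; have := L1; lra.
  have -> : 4 = 2 * 2 :> R by ring.
  exact: ler_pM.
rewrite mulr0 addr0.
have -> : \int[P]_w ((A j w - L) * (A k w - L)) =
    (\int[P]_w (A j w * A k w) - L ^+ 2) - L * (\int[P]_w A j w - L) - L * (\int[P]_w A k w - L).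
  rewrite (@eq_Rintegral _ _ _ P setT (fun w => A j w * A k w + (- L * A j w + (- L * A k w + L ^+ 2)))); last first.
    by move=> w _; ring.
  have M1 := MomM (A_Mom j) (A_Mom k).
  have M2 := MomZ (- L) (A_Mom j); have M3 := MomZ (- L) (A_Mom k).
  have M4 := Mom_cst P (L ^+ 2).
  rewrite RintegralD//; [|exact: Mom_int|exact: Mom_int (MomD M2 (MomD M3 M4))].
  rewrite RintegralD//; [|exact: Mom_int|exact: Mom_int (MomD M3 M4)].
  rewrite RintegralD//; [|exact: Mom_int|exact: Mom_int].
  rewrite Rintegral_prob_cst !RintegralZl//; [|exact: Mom_int (A_Mom _)..].
  ring.
have h1 := mean_AA jn kn jk njk jj kk.
have hj := mean_A jn jj; have hk := mean_A kn kk.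
have lj : `|L * (\int[P]_w A j w - L)| <= eps * tt.
  by rewrite normrM; apply: le_trans hj; rewrite ler_piMl.
have lk : `|L * (\int[P]_w A k w - L)| <= eps * tt.
  by rewrite normrM; apply: le_trans hk; rewrite ler_piMl.
move: h1 lj lk; rewrite !ler_norml => /andP[_ ?] /andP[? _] /andP[? _].
lra.
Qed.

Lemma bad_pair_count : \sum_(j < n.+1) \sum_(k < n.+1) (bad_pair n j k)%:R <= 4 * n.+1%:R :> R.
Proof.
have one (f : 'I_n.+1 -> bool) : (forall i j, f i -> f j -> i = j) ->
    \sum_(k < n.+1) (f k)%:R <= 1 :> R.
  move=> inj; case: (pickP f) => [i fi|f0].
    rewrite (bigD1 i)//= fi big1 ?addr0// => k ki.
    by case: (boolP (f k)) => // fk; rewrite (inj k i fk fi) eqxx in ki.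
  by rewrite big1// => k _; rewrite f0.
pose g (j k : 'I_n.+1) : R := (j == k)%:R + (j + k == n)%N%:R + (j + j == n)%N%:R + (k + k == n)%N%:R.
apply: (@le_trans _ _ (\sum_(j < n.+1) \sum_(k < n.+1) g j k)).
  apply: ler_sum => j _; apply: ler_sum => k _; rewrite /g /bad_pair.
  rewrite -!natrD ler_nat -[(j == k)]/(nat_of_ord j == nat_of_ord k).
  by do 4 case: (_ == _).
rewrite (eq_bigr (fun j : 'I_n.+1 => \sum_(k < n.+1) (j == k)%:R + \sum_(k < n.+1) (j + k == n)%N%:R +
   n.+1%:R * (j + j == n)%N%:R + \sum_(k < n.+1) (k + k == n)%N%:R)); last first.
  move=> j _; rewrite /g !big_split /=; congr (_ + _ + _ + _).
  by rewrite sumr_const card_ord mulr_natl.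
rewrite !big_split /= -mulr_sumr sumr_const card_ord.
have q1 : \sum_(j < n.+1) \sum_(k < n.+1) (j == k)%:R <= n.+1%:R :> R.
  apply: (@le_trans _ _ (\sum_(j < n.+1) 1)); last by rewrite sumr_const card_ord.
  apply: ler_sum => j _; apply: one => i k /eqP <- /eqP <-//.
have q2 : \sum_(j < n.+1) \sum_(k < n.+1) (j + k == n)%N%:R <= n.+1%:R :> R.
  apply: (@le_trans _ _ (\sum_(j < n.+1) 1)); last by rewrite sumr_const card_ord.
  apply: ler_sum => j _; apply: one => i k /eqP e1 /eqP e2; apply: val_inj => /=; lia.
have q3 : \sum_(k < n.+1) (k + k == n)%N%:R <= 1 :> R.
  apply: one => i k /eqP e1 /eqP e2; apply: val_inj => /=; lia.
rewrite -[X in _ + X]mulr_natl.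
have := ler_wpM2l (ler0n R n.+1) q3; lra.
Qed.

(** Expanding the square into pairs, the good ones contribute O(eps) each and the
    bad ones at most 4. *)
Lemma variance_cos : \int[P]_w ((emp n (fun z => cos (t1 * z.1 + t2 * z.2 + c)) w - L) ^+ 2) <=
  4 * eps * tt + 16 * n.+1%:R^-1.
Proof.
have MA i : Mom P (fun w => A i w - L) by apply: MomB; [exact: A_Mom|exact: Mom_cst].
rewrite (@eq_Rintegral _ _ _ P setT (fun w => n.+1%:R^-1 ^+ 2 *
    \sum_(j < n.+1) \sum_(k < n.+1) (A j w - L) * (A k w - L))); last first.
  move=> w _; rewrite -[X in _ - X](emp_cst n L w) /emp -mulrBr exprMn; congr (_ * _).
  rewrite -sumrB expr2 mulr_suml; apply: eq_bigr => j _.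
  by rewrite mulr_sumr.
have MS j : Mom P (fun w => \sum_(k < n.+1) (A j w - L) * (A k w - L)).
  by apply: Mom_sum => k; apply: MomM.
rewrite RintegralZl//; last by apply: Mom_int; apply: Mom_sum.
rewrite Rintegral_sum; last by move=> j; exact: Mom_int.
have n0 : n.+1%:R != 0 :> R by rewrite pnatr_eq0.
have -> : 4 * eps * tt + 16 * n.+1%:R^-1 = n.+1%:R^-1 ^+ 2 *
   (n.+1%:R ^+ 2 * (4 * eps * tt) + 4 * (4 * n.+1%:R)) by field.
rewrite ler_wpM2l ?sqr_ge0//.
apply: (@le_trans _ _ (\sum_(j < n.+1) \sum_(k < n.+1) (4 * eps * tt + 4 * (bad_pair n j k)%:R))).
  apply: ler_sum => j _; rewrite Rintegral_sum; last by move=> k; exact: Mom_int (MomM (MA j) (MA k)).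
  by apply: ler_sum => k _; apply: cov.
rewrite (eq_bigr (fun j : 'I_n.+1 => n.+1%:R * (4 * eps * tt) +
    4 * \sum_(k < n.+1) (bad_pair n j k)%:R)); last first.
  by move=> j _; rewrite big_split /= sumr_const card_ord -mulr_sumr -[X in X + _]mulr_natl.
move: (4 * eps * tt) => q.
rewrite big_split /= -!mulr_sumr sumr_const card_ord.
rewrite -[q *+ _]mulr_natl (mulrA n.+1%:R) -expr2.
by rewrite lerD2l ler_wpM2l// bad_pair_count.
Qed.

End Pairs.

Lemma cos_L2 (t1 t2 c e : R) : (forall eps : R, 0 < eps -> exists2 eta, 0 < eta & small_cf s eps eta) ->
  0 < e -> \forall n \near \oo,
  \int[P]_w ((emp n (fun z => cos (t1 * z.1 + t2 * z.2 + c)) w -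
     expR (- ((t1 ^+ 2 + t2 ^+ 2) / 4)) * cos c) ^+ 2) <= e.
Proof.
move=> H e0; pose tt := t1 ^+ 2 + t2 ^+ 2.
have tt0 : 0 <= tt by rewrite addr_ge0 ?sqr_ge0.
pose eps := e / (8 * (tt + 1)).
have eps0 : 0 < eps by rewrite divr_gt0// mulr_gt0// ltr_wpDl.
have [eta eta0 cf] := H eps eps0.
pose a := 2 * (`|t1| + `|t2|) + 1.
have a0 : 0 < a by rewrite ltr_wpDl// mulr_ge0// addr_ge0.
have d0 : 0 < Num.min (e / 32) ((eta / a) ^+ 2).
  by rewrite lt_min divr_gt0//= exprn_gt0// divr_gt0.
near=> n.
have : n.+1%:R^-1 <= Num.min (e / 32) ((eta / a) ^+ 2).
  apply: ltW; near: n; exact: (near_infty_natSinv_lt (PosNum d0)).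
rewrite le_min => /andP[n1 n2].
have small : 2 * ((Num.sqrt n.+1%:R)^-1 * (`|t1| + `|t2|)) <= eta.
  have q : (Num.sqrt n.+1%:R)^-1 <= eta / a.
    rewrite -sqrtrV//; apply: (le_trans (ler_wsqrtr n2)).
    by rewrite sqrtr_sqr ger0_norm// divr_ge0 ?ltW.
  have q0 : 0 <= (Num.sqrt n.+1%:R)^-1 :> R by rewrite invr_ge0 sqrtr_ge0.
  have : (Num.sqrt n.+1%:R)^-1 * a <= eta by rewrite -ler_pdivlMr.
  rewrite /a; lra.
apply: (le_trans (variance_cos (ltW eps0) cf c small)).
rewrite -/tt.
have -> : e = e / 2 + e / 2 by field.
apply: lerD; last first.
  have -> : e / 2 = 16 * (e / 32) by field.
  by rewrite ler_wpM2l.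
rewrite /eps.
have -> : 4 * (e / (8 * (tt + 1))) * tt = e / 2 * (tt / (tt + 1)).
  by field; rewrite gt_eqF// ltr_wpDl.
apply: ler_piMr; first by rewrite divr_ge0// ltW.
by rewrite ler_pdivrMr ?mul1r ?lerDl// ltr_wpDl.
Unshelve. all: by end_near. Qed.

End EmpiricalMean.

(** * Parseval identity and integrals against the empirical distribution *)

Section Parseval.
Variables (R : realType) (n : nat) (u : nat -> R).

(** The squared length of the vector of eigenvalues, which is the image of the first
    row under the Fourier matrix. *)
Lemma parseval : \sum_(j < n.+1)
    (complex.Re (scirc_ev n u j) ^+ 2 + complex.Im (scirc_ev n u j) ^+ 2) =
  n.+1%:R * \sum_(m < n.+1) u m ^+ 2.
Proof.
pose F := fourier_mx R n.
pose v : 'rV[R[i]]_n.+1 := \row_m (u m)%:C.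
have n0 : n.+1%:R != 0 :> R[i] by rewrite pnatr_eq0.
have FF : F *m map_mx Num.conj F^T = n.+1%:R%:M.
  have := mulmxV (fourier_unit R n); rewrite invmx_fourier -scalemxAr => h.
  by rewrite -[LHS](scalerKV n0) h scale_scalar_mx mulr1.
have vF j : (v *m F) 0 j = scirc_ev n u j.
  by rewrite mxE; apply: eq_bigr => m _; rewrite !mxE.
have E : (v *m F) *m map_mx Num.conj (v *m F)^T = n.+1%:R *: (v *m map_mx Num.conj v^T).
  by rewrite trmx_mul map_mxM mulmxA -(mulmxA v) FF mul_mx_scalar -scalemxAl.
have := congr1 (fun M : 'M[R[i]]_1 => complex.Re (M 0 0)) E.
rewrite !mxE raddf_sum /=.
rewrite (eq_bigr (fun j : 'I_n.+1 => complex.Re (scirc_ev n u j) ^+ 2 + complex.Im (scirc_ev n u j) ^+ 2)); last first.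
  move=> j _; rewrite [map_mx _ _ _ _]mxE [(_^T) _ _]mxE vF.
  by case: (scirc_ev n u j) => a b /=; ring.
move=> ->.
rewrite (eq_bigr (fun m : 'I_n.+1 => (u m ^+ 2)%:C)); last first.
  move=> m _; rewrite !mxE; apply/eqP; rewrite eq_complex /=.
  by apply/andP; split; apply/eqP; ring.
rewrite -rmorph_sum -[n.+1%:R in LHS](rmorph_nat (real_complex R)) -rmorphM//.
Qed.

End Parseval.

Section EsdIntegral.
Variables (R : realType) (n : nat).

Lemma esd_integral_ge0 (A : 'M[R[i]]_n.+1) (g : plane R -> R) : measurable_fun setT g ->
  (forall z, 0 <= g z) ->
  (\int[esd A]_z (g z)%:E = (n.+1%:R^-1 * \sum_(z <- eigenvalues A) g (esd_point z))%:E)%E.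
Proof.
move=> mg g0; rewrite /esd ge0_integral_mscale//; last 2 first.
- exact/measurable_EFinP.
- by move=> z _; rewrite lee_fin.
rewrite ge0_integral_measure_sum//; last 2 first.
- by move=> z _; rewrite lee_fin.
- exact/measurable_EFinP.
rewrite (eq_bigr (fun j : 'I_n.+1 => (g (esd_point (eigenvalues A)`_j))%:E)); last first.
  move=> j _; rewrite integral_dirac//; last exact/measurable_EFinP.
  by rewrite diracT mul1e.
rewrite sumEFin -EFinM; congr (_ * _)%:E.
by rewrite [in RHS](big_nth 0) size_eigenvalues big_mkord.
Qed.

Lemma esd_integral (A : 'M[R[i]]_n.+1) (f : plane R -> R) (M : R) : measurable_fun setT f ->
  (forall z, `|f z| <= M) ->
  \int[esd A]_z f z = n.+1%:R^-1 * \sum_(z <- eigenvalues A) f (esd_point z).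
Proof.
move=> mf fM.
have if_ := @bounded_integrable _ _ _ (esd A) f M mf fM.
have mg : measurable_fun setT (fun z => f z + M).
  by apply: measurable_funD => //; exact: measurable_cst.
have g0 z : 0 <= f z + M by have := fM z; rewrite ler_norml => /andP[? _]; lra.
have := esd_integral_ge0 A mg g0.
move=> /(congr1 fine) /=; rewrite -/(Rintegral _ _ _) RintegralD//; last first.
  exact: Mom_int (Mom_cst (esd A) M).
rewrite Rintegral_prob_cst big_split /= mulrDr big_const_seq count_predT size_eigenvalues.
rewrite iter_addr_0 -[M *+ _]mulr_natl mulrA mulVf ?pnatr_eq0// mul1r.
by move/addIr.
Qed.

Lemma scaled_ScircE (s : nat -> R) : scaled_Scirc n.+1 s =
  map_mx (real_complex R) (Scirc n.+1 (fun m => (Num.sqrt n.+1%:R)^-1 * s m)).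
Proof.
congr map_mx; apply/matrixP => i j; rewrite !mxE.
by case: ifP => // _; rewrite mulrN.
Qed.

Lemma esd_scirc (f : plane R -> R) (M : R) (s : nat -> R) : measurable_fun setT f ->
  (forall z, `|f z| <= M) ->
  \int[esd (scaled_Scirc n.+1 s)]_z f z = n.+1%:R^-1 *
   \sum_(j < n.+1) f (esd_point (scirc_ev n (fun m => (Num.sqrt n.+1%:R)^-1 * s m) j)).
Proof.
move=> mf fM; rewrite (esd_integral _ mf fM) scaled_ScircE; congr (_ * _).
rewrite (perm_big _ (eigenvalues_scirc _ _)) big_map.
by rewrite -(big_mkord xpredT (fun j => f (esd_point (scirc_ev n _ j)))) /index_iota subn0.
Qed.

End EsdIntegral.

(** * Convergence for continuous test functions *)

Section PlaneMeasurability.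
Variable R : realType.

Lemma trigpoly_measurable (p : R * R -> R) : trigpoly p ->
  measurable_fun setT (p : plane R -> R).
Proof.
elim=> [t1 t2 c|f g _ mf _ mg|k f _ mf].
- exact: plane_measurable_cos.
- exact: measurable_funD.
- by apply: measurable_funM => //; exact: measurable_cst.
Qed.

Lemma trigpoly_bounded (p : R * R -> R) : trigpoly p -> exists c, forall z, `|p z| <= c.
Proof.
elim=> [t1 t2 c|f g _ [a ha] _ [b hb]|k f _ [a ha]].
- by exists 1 => z; exact: cos_max.
- exists (a + b) => z; apply: (le_trans (ler_normD _ _)); exact: lerD.
- by exists (`|k| * a) => z; rewrite normrM ler_wpM2l.
Qed.

(** The trigonometric approximations also show that continuous functions are
    measurable for the product sigma-algebra. *)
Lemma bounded_continuous_measurable (f : R * R -> R) (M : R) : continuous f ->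
  (forall z, `|f z| <= M) -> measurable_fun setT (f : plane R -> R).
Proof.
move=> cf fM.
have H' k : exists p, [/\ trigpoly p, forall z, `|p z| <= M &
    forall z : R * R, `|z.1| <= k.+1%:R -> `|z.2| <= k.+1%:R -> `|p z - f z| <= k.+1%:R^-1].
  by apply: (trig_approx cf fM (ltr0Sn R k)); rewrite invr_gt0 ltr0Sn.
have [p hp] := choice H'.
apply: (@measurable_fun_cvg _ _ _ _ (p : nat -> plane R -> R)).
  by move=> k; apply: trigpoly_measurable; have [] := hp k.
move=> z _; apply/cvgrPdist_le => e e0.
near=> k.
rewrite distrC; have [_ _ h] := hp k.
have k1 : `|z.1| + `|z.2| <= k%:R by near: k; exact: nbhs_infty_ger.
have k2 : k%:R <= k.+1%:R :> R by rewrite ler_nat.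
have n1 := normr_ge0 z.1; have n2 := normr_ge0 z.2.
apply: (le_trans (h z _ _)); [lra|lra|].
apply: ltW; near: k; exact: (near_infty_natSinv_lt (PosNum e0)).
Unshelve. all: by end_near. Qed.

Definition clamp (M x : R) : R := Num.max (- M) (Num.min M x).

Lemma clamp_bound M x : 0 <= M -> `|clamp M x| <= M.
Proof.
move=> M0; rewrite /clamp ler_norml le_max lexx /= ge_max ge_min lexx /=.
by apply/andP; split => //; lra.
Qed.

Lemma clamp_id M x : `|x| <= M -> clamp M x = x.
Proof.
rewrite ler_norml => /andP[h1 h2]; rewrite /clamp (min_idPr h2).
by rewrite (max_idPr h1).
Qed.

Lemma clamp_dist M x : 0 < M -> `|x - clamp M x| <= x ^+ 2 / M.
Proof.
move=> M0; have [xM|Mx] := leP `|x| M.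
  by rewrite clamp_id// subrr normr0 divr_ge0 ?sqr_ge0// ltW.
have h : `|x - clamp M x| <= `|x|.
  rewrite /clamp; case: (leP M x) => h1.
    rewrite (max_idPr _); last by lra.
    rewrite ger0_norm ?subr_ge0// ger0_norm; last lra.
    lra.
  case: (leP (- M) x) => h2; first by rewrite subrr normr0.
  by rewrite !ler0_norm; lra.
apply: (le_trans h); rewrite ler_pdivlMr// -[x ^+ 2]real_normK ?num_real// expr2.
by rewrite ler_wpM2l// ltW.
Qed.

Lemma clamp_continuous (f : R * R -> R) M : continuous f -> continuous (fun z => clamp M (f z)).
Proof.
move=> cf z; apply: (@continuous_max _ _ (fun=> - M) (fun z => Num.min M (f z))).
  exact: cvg_cst.
apply: (@continuous_min _ _ (fun=> M) f); first exact: cvg_cst.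
exact: cf.
Qed.

Lemma continuous_plane_measurable (f : R * R -> R) : continuous f ->
  measurable_fun setT (f : plane R -> R).
Proof.
move=> cf.
apply: (@measurable_fun_cvg _ _ _ _ ((fun k z => clamp k%:R (f z)) : nat -> plane R -> R)).
  move=> k; apply: (@bounded_continuous_measurable _ k%:R); first exact: clamp_continuous.
  by move=> z; exact: clamp_bound.
move=> z _; apply: cvg_near_cst; near=> k.
apply: clamp_id; near: k; exact: nbhs_infty_ger.
Unshelve. all: by end_near. Qed.

End PlaneMeasurability.

Section Convergence.
Context d (T : measurableType d) (R : realType) (P : probability T R).
Variable (s : nat -> {RV P >-> R}).
Local Notation G := (gauss_XY R).
Local Notation emp := (emp s).

Definition cvg_mean (f : R * R -> R) : Prop := forall e : R, 0 < e ->
  \forall n \near \oo, \int[P]_w `|emp n f w - \int[G]_z f z| <= e.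

Lemma Mom_norm (X : T -> R) : Mom P X -> Mom P (fun w => `|X w|).
Proof.
move=> h; apply: (Mom_dom _ h); last by move=> w; rewrite normr_id.
by apply: measurableT_comp => //; exact: Mom_meas h.
Qed.

Hypothesis ind : independent_RVs s.
Hypothesis cf : forall eps : R, 0 < eps -> exists2 eta, 0 < eta & small_cf s eps eta.

(** For a cosine, convergence in mean follows from convergence in mean square; the
    property is linear in the test function. *)
Lemma trigpoly_cvg_mean (p : R * R -> R) : trigpoly p -> cvg_mean p.
Proof.
elim=> [t1 t2 c|f g tf hf tg hg|k f tf hf] e e0.
- have ee : 0 < e ^+ 2 by rewrite exprn_gt0.
  have := cos_L2 ind t1 t2 c cf ee; apply: filterS => n.
  rewrite gauss_XY_cos; set L := expR _ * _; set pc := fun z : R * R => _.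
  have Mp : Mom P (emp n pc).
    apply: (@emp_Mom _ _ _ _ _ _ _ 1); first exact: plane_measurable_cos.
    by move=> z; exact: cos_max.
  have MpL : Mom P (fun w => emp n pc w - L) by apply: MomB => //; exact: Mom_cst.
  move=> h.
  have Mr : Mom P (fun w => (2 * e)^-1 * (emp n pc w - L) ^+ 2) by apply: MomZ; exact: MomX.
  apply: (@le_trans _ _ (\int[P]_w (e / 2 + (2 * e)^-1 * (emp n pc w - L) ^+ 2))).
    apply: le_Rintegral => //.
    + exact: Mom_int (Mom_norm MpL).
    + by apply: Mom_int; apply: MomD => //; exact: Mom_cst.
    + move=> w _; set x := emp n pc w - L.
      rewrite -[x ^+ 2]real_normK ?num_real//.
      have := sqr_ge0 (`|x| - e) => q.
      rewrite -subr_ge0.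
      have -> : e / 2 + (2 * e)^-1 * `|x| ^+ 2 - `|x| = (2 * e)^-1 * (`|x| - e) ^+ 2.
        by field; rewrite gt_eqF.
      by rewrite mulr_ge0// invr_ge0 mulr_ge0// ltW.
  rewrite RintegralD//; [|exact: Mom_int (Mom_cst _ _)|exact: Mom_int].
  rewrite Rintegral_prob_cst RintegralZl//; last by apply: Mom_int; exact: MomX.
  have : (2 * e)^-1 * \int[P]_w (emp n pc w - L) ^+ 2 <= (2 * e)^-1 * e ^+ 2.
    by rewrite ler_wpM2l// invr_ge0 mulr_ge0// ltW.
  have -> : (2 * e)^-1 * e ^+ 2 = e / 2 by field; rewrite gt_eqF.
  lra.
- have e2 : 0 < e / 2 by rewrite divr_gt0.
  have [a fa] := trigpoly_bounded tf; have [b gb] := trigpoly_bounded tg.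
  have mf := trigpoly_measurable tf; have mg := trigpoly_measurable tg.
  have := hg _ e2; have := hf _ e2; apply: filterS2 => n h1 h2.
  have -> : \int[G]_z (f z + g z) = \int[G]_z f z + \int[G]_z g z.
    rewrite RintegralD//; first exact: (bounded_integrable G mf fa).
    exact: (bounded_integrable G mg gb).
  set If := \int[G]_z f z in h1 *; set Ig := \int[G]_z g z in h2 *.
  have Mf : Mom P (fun w => `|emp n f w - If|).
    by apply: Mom_norm; apply: MomB; [exact: emp_Mom mf fa|exact: Mom_cst].
  have Mg : Mom P (fun w => `|emp n g w - Ig|).
    by apply: Mom_norm; apply: MomB; [exact: emp_Mom mg gb|exact: Mom_cst].
  have Mfg : Mom P (fun w => `|emp n (fun z => f z + g z) w - (If + Ig)|).
    apply: Mom_norm; apply: MomB; last exact: Mom_cst.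
    apply: (@emp_Mom _ _ _ _ _ _ _ (a + b)); first exact: measurable_funD.
    by move=> z; apply: (le_trans (ler_normD _ _)); exact: lerD.
  apply: (@le_trans _ _ (\int[P]_w (`|emp n f w - If| + `|emp n g w - Ig|))).
    apply: le_Rintegral => //; [exact: Mom_int|exact: Mom_int (MomD Mf Mg)|].
    move=> w _; rewrite empD.
    have -> : emp n f w + emp n g w - (If + Ig) = (emp n f w - If) + (emp n g w - Ig) by ring.
    exact: ler_normD.
  rewrite RintegralD//; [|exact: Mom_int..].
  lra.
- have [a fa] := trigpoly_bounded tf; have mf := trigpoly_measurable tf.
  have k0 : 0 < `|k| + 1 by rewrite ltr_wpDl.
  have e2 : 0 < e / (`|k| + 1) by rewrite divr_gt0.
  have := hf _ e2; apply: filterS => n h.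
  rewrite RintegralZl//; last exact: (bounded_integrable G mf fa).
  set If := \int[G]_z f z in h *.
  have Mf : Mom P (fun w => `|emp n f w - If|).
    by apply: Mom_norm; apply: MomB; [exact: emp_Mom mf fa|exact: Mom_cst].
  rewrite (@eq_Rintegral _ _ _ P setT (fun w => `|k| * `|emp n f w - If|)); last first.
    by move=> w _; rewrite empZ -mulrBr normrM.
  rewrite RintegralZl//; last exact: Mom_int.
  have : `|k| * \int[P]_w `|emp n f w - If| <= `|k| * (e / (`|k| + 1)) by rewrite ler_wpM2l.
  move=> /le_trans; apply.
  by rewrite mulrA ler_pdivrMr// mulrC ler_wpM2l ?(ltW e0)// lerDl.
Qed.

Hypothesis s2i : forall j, P.-integrable setT (EFin \o (fun w => s j w ^+ 2)).
Hypothesis s2 : forall j, \int[P]_w (s j w ^+ 2) = 1.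

Definition sqr_mod (z : R * R) : R := z.1 ^+ 2 + z.2 ^+ 2.

Lemma ev_point_scirc n j w :
  esd_point (scirc_ev n (fun m => (Num.sqrt n.+1%:R)^-1 * s m w) j) = ev_point s n j w.
Proof. by rewrite esd_point_scirc. Qed.

Lemma emp_sqr_mod n w : emp n sqr_mod w = n.+1%:R^-1 * \sum_(m < n.+1) s m w ^+ 2.
Proof.
rewrite /emp; congr (_ * _).
have := parseval n (fun m => (Num.sqrt n.+1%:R)^-1 * s m w).
rewrite (eq_bigr (fun j : 'I_n.+1 => sqr_mod (ev_point s n j w))); last first.
  by move=> j _; rewrite -ev_point_scirc.
move=> ->; rewrite mulr_sumr; apply: eq_bigr => m _.
by rewrite exprMn exprVn sqr_sqrtr// mulrA mulfV ?mul1r// pnatr_eq0.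
Qed.

Lemma emp_sqr_mod_int n : P.-integrable setT (EFin \o emp n sqr_mod).
Proof.
rewrite (_ : emp n sqr_mod = fun w => n.+1%:R^-1 * \sum_(m < n.+1) s m w ^+ 2); last first.
  by apply/funext => w; exact: emp_sqr_mod.
apply: RintegrableZ; elim: (n.+1) => [|m IH].
  under eq_fun do rewrite big_ord0.
  exact: finite_measure_integrable_cst.
rewrite (_ : (fun w => _) = fun w => \sum_(i < m) s i w ^+ 2 + s m w ^+ 2).
  exact: RintegrableD.
by apply/funext => w; rewrite big_ord_recr.
Qed.

Lemma mean_emp_sqr_mod n : \int[P]_w emp n sqr_mod w = 1.
Proof.
rewrite (@eq_Rintegral _ _ _ P setT (fun w => n.+1%:R^-1 * \sum_(m < n.+1) s m w ^+ 2)); last first.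
  by move=> w _; exact: emp_sqr_mod.
have h := emp_sqr_mod_int n.
rewrite RintegralZl//; last first.
  have := RintegrableZ n.+1%:R h; congr (_.-integrable _ (EFin \o _)); apply/funext => w.
  by rewrite emp_sqr_mod mulrA mulfV ?mul1r// pnatr_eq0.
rewrite (@Rintegral_sum _ _ _ P _ _ (fun (m : 'I_n.+1) w => s m w ^+ 2))//.
rewrite (eq_bigr (fun=> 1)); last by move=> m _; exact: s2.
by rewrite sumr_const card_ord mulVf// pnatr_eq0.
Qed.

Lemma sqr_mod_ge0 z : 0 <= sqr_mod z.
Proof. by rewrite addr_ge0 ?sqr_ge0. Qed.

Lemma sqr_mod_Mom : Mom G (sqr_mod : plane R -> R).
Proof. by apply: MomD; apply: MomX; [exact: gauss_XY_Mom1|exact: gauss_XY_Mom2]. Qed.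

(** The trigonometric approximation of f is close to f on a large box and bounded
    everywhere; the error outside the box is controlled by the second moments,
    whose expectation is 1 for the empirical measures, by Parseval. *)
Lemma bounded_cvg_mean (f : R * R -> R) (M : R) : continuous f -> (forall z, `|f z| <= M) ->
  cvg_mean f.
Proof.
move=> cof fM e e0.
have M0 : 0 <= M by exact: le_trans (fM (0, 0)).
pose V := \int[G]_z sqr_mod z.
have V0 : 0 <= V by apply: Rintegral_ge0 => z _; exact: sqr_mod_ge0.
have B0 : 0 <= 8 * M * (1 + V) / e.
  by apply: divr_ge0; [apply: mulr_ge0; [exact: mulr_ge0|exact: addr_ge0]|exact: ltW].
pose L := 1 + 8 * M * (1 + V) / e.
have L1 : 1 <= L by rewrite lerDl.
have L0 : 0 < L by exact: lt_le_trans L1.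
pose K := 2 * M / L ^+ 2.
have K0 : 0 <= K by rewrite /K; apply: divr_ge0; [exact: mulr_ge0|exact: sqr_ge0].
have KV : K * (1 + V) <= e / 4.
  rewrite /K mulrAC ler_pdivrMr ?exprn_gt0//.
  have h1 : 8 * M * (1 + V) / e <= L ^+ 2.
    apply: (@le_trans _ _ L); first by rewrite lerDr.
    by rewrite expr2 ler_peMr// ltW.
  move: h1; rewrite ler_pdivrMr// => h1; lra.
have e8 : 0 < e / 8 by rewrite divr_gt0.
have [p [tp pM pf]] := trig_approx cof fM L0 e8.
have e4 : 0 < e / 4 by rewrite divr_gt0.
pose D (z : R * R) := e / 8 + K * sqr_mod z.
have fpD z : `|f z - p z| <= D z.
  have Ks : 0 <= K * sqr_mod z by rewrite mulr_ge0// sqr_mod_ge0.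
  have far : L ^+ 2 <= sqr_mod z -> `|f z - p z| <= D z.
    move=> h; apply: (@le_trans _ _ (2 * M)).
      by apply: (le_trans (ler_normB _ _)); have := fM z; have := pM z; lra.
    apply: (@le_trans _ _ (K * sqr_mod z)); last by rewrite lerDr ltW.
    rewrite /K mulrAC ler_pdivlMr ?exprn_gt0// ler_wpM2l// mulr_ge0//.
  have big (x : R) : L < `|x| -> L ^+ 2 <= x ^+ 2.
    move=> Lx; rewrite -[x ^+ 2]real_normK ?num_real//.
    by rewrite lerXn2r ?nnegrE ?ltW// (lt_trans L0).
  have [z1|/big h] := leP `|z.1| L; last first.
    by apply: far; apply: (le_trans h); rewrite /sqr_mod lerDl sqr_ge0.
  have [z2|/big h] := leP `|z.2| L; last first.
    by apply: far; apply: (le_trans h); rewrite /sqr_mod lerDr sqr_ge0.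
  by rewrite distrC; apply: (le_trans (pf z z1 z2)); rewrite lerDl.
have := trigpoly_cvg_mean tp e4; apply: filterS => n hp.
have mf := bounded_continuous_measurable cof fM.
have mp := trigpoly_measurable tp.
have iGf := bounded_integrable G mf fM; have iGp := bounded_integrable G mp pM.
have MD : Mom G (D : plane R -> R).
  by apply: MomD; [exact: Mom_cst|exact: MomZ sqr_mod_Mom].
have GD : `|\int[G]_z p z - \int[G]_z f z| <= e / 8 + K * V.
  rewrite -RintegralB//.
  have ifp : G.-integrable setT (EFin \o (fun z : plane R => p z - f z)).
    have := RintegrableD iGp (RintegrableZ (-1) iGf).
    by congr (_.-integrable _ (EFin \o _)); apply/funext => z; rewrite mulN1r.
  apply: (le_trans (le_normr_Rintegral _ ifp)) => //.
  apply: (@le_trans _ _ (\int[G]_z D z)).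
    apply: le_Rintegral => //; [exact: integrable_norm|exact: Mom_int MD|].
    by move=> z _; rewrite distrC; exact: fpD.
  rewrite RintegralD//; [|exact: Mom_int (Mom_cst _ _)|exact: Mom_int (MomZ _ sqr_mod_Mom)].
  by rewrite Rintegral_prob_cst RintegralZl//; exact: Mom_int sqr_mod_Mom.
set If := \int[G]_z f z in GD *; set Ip := \int[G]_z p z in hp GD.
have Mf : Mom P (fun w => `|emp n f w - If|).
  by apply: Mom_norm; apply: MomB; [exact: emp_Mom mf fM|exact: Mom_cst].
have Mp : Mom P (fun w => `|emp n p w - Ip|).
  by apply: Mom_norm; apply: MomB; [exact: emp_Mom mp pM|exact: Mom_cst].
have iD : P.-integrable setT (EFin \o (fun w => e / 8 + K * emp n sqr_mod w)).
  apply: RintegrableD; first exact: Mom_int (Mom_cst _ _).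
  exact: RintegrableZ (emp_sqr_mod_int n).
have iC : P.-integrable setT (EFin \o (fun w => `|emp n p w - Ip| + (e / 8 + K * V))).
  by apply: RintegrableD; [exact: Mom_int|exact: Mom_int (Mom_cst _ _)].
apply: (@le_trans _ _ (\int[P]_w ((e / 8 + K * emp n sqr_mod w) +
    (`|emp n p w - Ip| + (e / 8 + K * V))))).
  apply: le_Rintegral => //; [exact: Mom_int|exact: RintegrableD|].
  move=> w _.
  have -> : emp n f w - If = (emp n f w - emp n p w) + ((emp n p w - Ip) + (Ip - If)) by ring.
  apply: (le_trans (ler_normD _ _)); apply: lerD; last first.
    by apply: (le_trans (ler_normD _ _)); apply: lerD.
  have -> : emp n f w - emp n p w = emp n (fun z => f z + (-1) * p z) w.
    by rewrite empD empZ mulN1r.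
  apply: (le_trans (emp_norm _ _ _ _)).
  rewrite -empZ -[X in X + _](emp_cst s n (e / 8) w) -empD; apply: emp_le => z.
  by rewrite mulN1r; exact: fpD.
rewrite RintegralD//.
rewrite RintegralD//; [|exact: Mom_int (Mom_cst _ _)|exact: RintegrableZ (emp_sqr_mod_int n)].
rewrite [X in _ + X]RintegralD//; [|exact: Mom_int|exact: Mom_int (Mom_cst _ _)].
rewrite !Rintegral_prob_cst RintegralZl//; last exact: emp_sqr_mod_int.
rewrite mean_emp_sqr_mod.
lra.
Qed.

End Convergence.

(** * Test functions of polynomial growth and star-moments *)

Section PolynomialGrowth.
Context d (T : measurableType d) (R : realType) (P : probability T R).
Variable (s : nat -> {RV P >-> R}).
Local Notation G := (gauss_XY R).
Local Notation emp := (emp s).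
Hypothesis ind : independent_RVs s.
Hypothesis cf : forall eps : R, 0 < eps -> exists2 eta, 0 < eta & small_cf s eps eta.
Hypothesis smom : forall j, Mom P (s j).
Hypothesis s1 : forall j, \int[P]_w s j w = 0.
Hypothesis s2 : forall j, \int[P]_w (s j w ^+ 2) = 1.
Hypothesis sk : forall k, exists2 M : R, 0 <= M & forall j, \int[P]_w (s j w ^+ k.*2) <= M.

Definition weight (p : nat) (z : R * R) : R := (1 + sqr_mod z) ^+ p.

Lemma weight_ge0 p z : 0 <= weight p z.
Proof. by rewrite exprn_ge0// addr_ge0// sqr_mod_ge0. Qed.

Lemma weight_le p z : weight p z <= 3 ^+ p * (1 + z.1 ^+ p.*2 + z.2 ^+ p.*2).
Proof.
have [m [m1 ma mb mE]] : exists m : R, [/\ 1 <= m, z.1 ^+ 2 <= m, z.2 ^+ 2 <= m &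
    [\/ m = 1, m = z.1 ^+ 2 | m = z.2 ^+ 2]].
  exists (Num.max 1 (Num.max (z.1 ^+ 2) (z.2 ^+ 2))); rewrite !le_max !lexx !orbT; split=> //.
  rewrite /Num.max; case: ifP => _; last by constructor 1.
  by case: ifP => _; [constructor 3|constructor 2].
have a0 : 0 <= z.1 ^+ p.*2 by rewrite -normr_even exprn_ge0.
have b0 : 0 <= z.2 ^+ p.*2 by rewrite -normr_even exprn_ge0.
apply: (@le_trans _ _ ((3 * m) ^+ p)).
  have s0 := sqr_mod_ge0 z.
  apply: lerXn2r; rewrite ?nnegrE; [lra|lra|].
  by rewrite /sqr_mod; lra.
rewrite exprMn ler_wpM2l ?exprn_ge0//.
case: mE => ->.
- by rewrite expr1n; lra.
- by rewrite -exprM mul2n; lra.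
- by rewrite -exprM mul2n; lra.
Qed.

Lemma ev_point1 n j w : (ev_point s n j w).1 = lin_comb s (coeff 1 0 n j) n.+1 w.
Proof. by rewrite -ev_point_lin mul1r mul0r addr0. Qed.

Lemma ev_point2 n j w : (ev_point s n j w).2 = lin_comb s (coeff 0 1 n j) n.+1 w.
Proof. by rewrite -ev_point_lin mul1r mul0r add0r. Qed.

Lemma ev_point1_Mom n j : Mom P (fun w => (ev_point s n j w).1).
Proof. by under eq_fun do rewrite ev_point1; exact: lin_comb_Mom. Qed.

Lemma ev_point2_Mom n j : Mom P (fun w => (ev_point s n j w).2).
Proof. by under eq_fun do rewrite ev_point2; exact: lin_comb_Mom. Qed.

Lemma weight_Mom p n j : Mom P (fun w => weight p (ev_point s n j w)).
Proof.
apply: MomX; apply: MomD; first exact: Mom_cst.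
by apply: MomD; apply: MomX; [exact: ev_point1_Mom|exact: ev_point2_Mom].
Qed.

Lemma weight_gauss_Mom p : Mom G (weight p : plane R -> R).
Proof. by apply: MomX; apply: MomD; [exact: Mom_cst|exact: sqr_mod_Mom]. Qed.

Lemma emp_growth_Mom (f : R * R -> R) p n : measurable_fun setT (f : plane R -> R) ->
  (forall z, `|f z| <= weight p z) -> Mom P (emp n f).
Proof.
move=> mf fp; apply: MomZ; apply: Mom_sum => j.
apply: (@Mom_dom _ _ _ _ _ (fun w => weight p (ev_point s n j w))).
- exact: (@measurableT_comp _ _ _ _ _ _ (f : plane R -> R) _ _ mf (measurable_ev_point s n j)).
- exact: weight_Mom.
- by move=> w; rewrite (ger0_norm (weight_ge0 _ _)); exact: fp.
Qed.

Lemma coeff_small (t1 t2 : R) n j : `|t1| + `|t2| = 1 ->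
  (forall m, `|coeff t1 t2 n j m| <= 1) /\ \sum_(m < n.+1) coeff t1 t2 n j m ^+ 2 <= 1.
Proof.
move=> t12.
have b m : `|coeff t1 t2 n j m| <= (Num.sqrt n.+1%:R)^-1.
  by have := coeff_bound t1 t2 n j m; rewrite t12 mulr1.
have sq1 : 1 <= Num.sqrt n.+1%:R :> R.
  by rewrite -[leLHS]sqrtr1 ler_wsqrtr// ler1n.
split=> [m|].
  by apply: (le_trans (b m)); rewrite invf_le1// (lt_le_trans _ sq1).
apply: (@le_trans _ _ (\sum_(m < n.+1) n.+1%:R^-1)); last first.
  by rewrite sumr_const card_ord -[_ *+ _]mulr_natl mulfV// pnatr_eq0.
apply: ler_sum => m _; rewrite -[leLHS]real_normK ?num_real//.
have -> : n.+1%:R^-1 = (Num.sqrt n.+1%:R)^-1 ^+ 2 :> R by rewrite exprVn sqr_sqrtr.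
by rewrite lerXn2r ?nnegrE// invr_ge0 sqrtr_ge0.
Qed.

Lemma mean_weight_bound p : exists2 B : R, 0 <= B & forall n,
  \int[P]_w emp n (weight p) w <= B.
Proof.
have [C C0 HC] := moment_bound ind smom s1 s2 sk p.
pose B := 3 ^+ p * (1 + C + C).
exists B; first by rewrite mulr_ge0 ?exprn_ge0// !addr_ge0.
move=> n.
have M1 j : Mom P (fun w => weight p (ev_point s n j w)) by exact: weight_Mom.
rewrite RintegralZl//; last by apply: Mom_int; exact: Mom_sum.
rewrite Rintegral_sum; last by move=> j; exact: Mom_int.
rewrite mulrC ler_pdivrMr ?ltr0n//.
apply: (@le_trans _ _ (\sum_(j < n.+1) B)); last by rewrite sumr_const card_ord mulr_natr.
apply: ler_sum => j _.
have m1 : Mom P (fun w => (ev_point s n j w).1 ^+ p.*2) by apply: MomX; exact: ev_point1_Mom.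
have m2 : Mom P (fun w => (ev_point s n j w).2 ^+ p.*2) by apply: MomX; exact: ev_point2_Mom.
have m01 := MomD (Mom_cst P 1) m1.
apply: (@le_trans _ _ (\int[P]_w (3 ^+ p * (1 + (ev_point s n j w).1 ^+ p.*2 + (ev_point s n j w).2 ^+ p.*2)))).
  apply: le_Rintegral => //; [exact: Mom_int|exact: Mom_int (MomZ _ (MomD m01 m2))|].
  by move=> w _; exact: weight_le.
rewrite RintegralZl//; last exact: Mom_int (MomD m01 m2).
rewrite ler_wpM2l ?exprn_ge0//.
rewrite RintegralD//; [|exact: Mom_int|exact: Mom_int].
rewrite RintegralD//; [|exact: Mom_int (Mom_cst _ _)|exact: Mom_int].
rewrite Rintegral_prob_cst; apply: lerD; first rewrite lerD2l.
  have [c1 c2] := @coeff_small 1 0 n j ltac:(by rewrite normr1 normr0 addr0).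
  under eq_Rintegral do rewrite ev_point1.
  exact: HC.
have [c1 c2] := @coeff_small 0 1 n j ltac:(by rewrite normr1 normr0 add0r).
under eq_Rintegral do rewrite ev_point2.
exact: HC.
Qed.

Let s2i j : P.-integrable setT (EFin \o (fun w => s j w ^+ 2)).
Proof. exact: Mom_int (MomX _ (smom j)). Qed.

(** Uniform integrability extends the convergence of means from bounded to
    polynomially growing functions: truncate at level M. *)
Lemma growth_cvg_mean (f : R * R -> R) q : continuous f ->
  (forall z, `|f z| <= weight q z) ->
  \int[P]_w emp n f w @[n --> \oo] --> \int[G]_z f z.
Proof.
move=> cof fq; pose p := (q * 2)%N.
have [B1 B10 HB1] := mean_weight_bound p.
pose B2 := \int[G]_z weight p z.
have B20 : 0 <= B2 by apply: Rintegral_ge0 => z _; exact: weight_ge0.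
have mf := continuous_plane_measurable cof.
apply/cvgrPdist_le => e e0.
pose M := 4 * (B1 + B2) / e + 1.
have h0 : 0 <= 4 * (B1 + B2) / e.
  by apply: divr_ge0; [apply: mulr_ge0 => //; exact: addr_ge0|exact: ltW].
have M0 : 0 < M by rewrite ltr_wpDl.
have BM : M^-1 * (B1 + B2) <= e / 4.
  rewrite mulrC ler_pdivrMr//.
  have : 4 * (B1 + B2) / e <= M by rewrite lerDl.
  rewrite ler_pdivrMr//; lra.
pose g z := clamp M (f z).
have cg : continuous g by exact: clamp_continuous.
have gM z : `|g z| <= M by exact: clamp_bound (ltW M0).
have mg := bounded_continuous_measurable cg gM.
have fg z : `|f z - g z| <= M^-1 * weight p z.
  apply: (le_trans (clamp_dist _ M0)); rewrite mulrC ler_wpM2l ?invr_ge0 ?(ltW M0)//.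
  rewrite -[leLHS]real_normK ?num_real// /weight /p exprM.
  by rewrite lerXn2r ?nnegrE// ?weight_ge0// fq.
have gw z : `|g z| <= M * weight 0 z by rewrite /weight expr0 mulr1.
have e2 : 0 < e / 2 by rewrite divr_gt0.
have := bounded_cvg_mean ind cf s2i s2 cg gM e2; apply: filterS => n hn.
have MGf : Mom G (f : plane R -> R).
  apply: (Mom_dom mf (weight_gauss_Mom q)) => z.
  by rewrite (ger0_norm (weight_ge0 _ _)).
have MGg : Mom G (g : plane R -> R) by exact: (Mom_bounded G mg gM).
have MPf : Mom P (emp n f) by exact: emp_growth_Mom mf fq.
have MPg : Mom P (emp n g) by exact: emp_Mom mg gM.
have MGw := weight_gauss_Mom p.
have MPw : Mom P (emp n (weight p)).
  by apply: MomZ; apply: Mom_sum => j; exact: weight_Mom.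
have hG : `|\int[G]_z f z - \int[G]_z g z| <= M^-1 * B2.
  rewrite -RintegralB//; [|exact: Mom_int|exact: Mom_int].
  apply: (le_trans (le_normr_Rintegral _ (Mom_int (MomB MGf MGg)))) => //.
  rewrite -RintegralZl//; last exact: Mom_int.
  apply: le_Rintegral; [by []|exact: integrable_norm (Mom_int (MomB MGf MGg))|exact: Mom_int (MomZ _ MGw)|].
  by move=> z _; exact: fg.
have hP : `|\int[P]_w emp n f w - \int[P]_w emp n g w| <= M^-1 * B1.
  rewrite -RintegralB//; [|exact: Mom_int|exact: Mom_int].
  apply: (le_trans (le_normr_Rintegral _ (Mom_int (MomB MPf MPg)))) => //.
  apply: (@le_trans _ _ (\int[P]_w (M^-1 * emp n (weight p) w))).
    apply: le_Rintegral => //; [exact: integrable_norm (Mom_int (MomB MPf MPg))|exact: Mom_int (MomZ _ MPw)|].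
    move=> w _ /=.
    have -> : emp n f w - emp n g w = emp n (fun z => f z + (-1) * g z) w.
      by rewrite empD empZ mulN1r.
    apply: (le_trans (emp_norm _ _ _ _)); rewrite -empZ; apply: emp_le => z.
    by rewrite mulN1r; exact: fg.
  by rewrite RintegralZl//; [rewrite ler_wpM2l ?invr_ge0 ?(ltW M0)|exact: Mom_int].
have hg : `|\int[P]_w emp n g w - \int[G]_z g z| <= e / 2.
  apply: le_trans hn; rewrite -[X in _ - X](Rintegral_prob_cst P).
  rewrite -RintegralB//; [|exact: Mom_int|exact: Mom_int (Mom_cst _ _)].
  by apply: le_normr_Rintegral => //; exact: Mom_int (MomB MPg (Mom_cst _ _)).
set a := \int[G]_z f z in hG *; set b := \int[P]_w emp n f w in hP *.
set a' := \int[G]_z g z in hG hg; set b' := \int[P]_w emp n g w in hP hg.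
have -> : a - b = (a - a') - ((b - b') + (b' - a')) by ring.
apply: (le_trans (ler_normB _ _)).
have := ler_normD (b - b') (b' - a').
move: BM; rewrite mulrDr; lra.
Qed.

End PolynomialGrowth.

Lemma cvg_dist (C : numFieldType) (u : nat -> C) (l : C) :
  (forall e : C, 0 < e -> \forall n \near \oo, `|l - u n| <= e) ->
  u n @[n --> \oo] --> l.
Proof. by move=> h; apply/cvgrPdist_le. Qed.

Section StarMoments.
Variable R : realType.

Definition plane_mono (k l : nat) (z : R * R) : R[i] :=
  (z.1 +i* z.2) ^+ k * Num.conj (z.1 +i* z.2) ^+ l.

Let cc (f : R * R -> R[i]) :=
  continuous (fun z => complex.Re (f z)) /\ continuous (fun z => complex.Im (f z)).

Let ccM f g : cc f -> cc g -> cc (fun z => f z * g z).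
Proof.
move=> [fr fi] [gr gi]; split.
  rewrite (_ : (fun z => _) = fun z => complex.Re (f z) * complex.Re (g z) -
      complex.Im (f z) * complex.Im (g z)).
    by move=> z; apply: cvgB; apply: cvgM; [exact: fr|exact: gr|exact: fi|exact: gi].
  by apply/funext => z; case: (f z) (g z) => [? ?] [? ?].
rewrite (_ : (fun z => _) = fun z => complex.Re (f z) * complex.Im (g z) +
    complex.Im (f z) * complex.Re (g z)).
  by move=> z; apply: cvgD; apply: cvgM; [exact: fr|exact: gi|exact: fi|exact: gr].
by apply/funext => z; case: (f z) (g z) => [? ?] [? ?].
Qed.

Let ccX f k : cc f -> cc (fun z => f z ^+ k).
Proof.
move=> h; elim: k => [|k IH].
  by split => z; exact: cvg_cst.
under eq_fun do rewrite exprS.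
exact: ccM.
Qed.

Lemma plane_mono_continuous k l :
  continuous (fun z => complex.Re (plane_mono k l z)) /\
  continuous (fun z => complex.Im (plane_mono k l z)).
Proof.
apply: ccM; apply: ccX; split => z.
- exact: cvg_fst.
- exact: cvg_snd.
- exact: cvg_fst.
- by apply: cvgN; exact: cvg_snd.
Qed.

Lemma Re_le_normc (z : R[i]) : `|complex.Re z| <= normc z.
Proof.
by case: z => a b /=; rewrite -sqrtr_sqr ler_sqrt ?addr_ge0 ?sqr_ge0// lerDl sqr_ge0.
Qed.

Lemma Im_le_normc (z : R[i]) : `|complex.Im z| <= normc z.
Proof.
by case: z => a b /=; rewrite -sqrtr_sqr ler_sqrt ?addr_ge0 ?sqr_ge0// lerDr sqr_ge0.
Qed.

Lemma normc_conj (z : R[i]) : normc (Num.conj z) = normc z.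
Proof. by case: z => a b /=; rewrite sqrrN. Qed.

Lemma normc_le_ReIm (z : R[i]) : normc z <= `|complex.Re z| + `|complex.Im z|.
Proof.
case: z => a b /=; rewrite -[leRHS]ger0_norm ?addr_ge0// -sqrtr_sqr ler_sqrt ?sqr_ge0//.
rewrite sqrrD !real_normK ?num_real//.
have : 0 <= `|a| * `|b| by rewrite mulr_ge0.
lra.
Qed.

Lemma plane_mono_growth k l z : normc (plane_mono k l z) <= weight (k + l) z.
Proof.
have normcX (x : R[i]) m : normc (x ^+ m) = normc x ^+ m.
  elim: m => [|m IH]; first by rewrite !expr0 /= expr1n expr0n /= addr0 sqrtr1.
  by rewrite !exprS normcM IH.
rewrite /plane_mono normcM !normcX normc_conj -exprD.
have n0 := normc_ge0 (z.1 +i* z.2).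
rewrite /weight; apply: lerXn2r; [exact: n0|by rewrite nnegrE addr_ge0// sqr_mod_ge0|].
have h : normc (z.1 +i* z.2) ^+ 2 = sqr_mod z.
  by rewrite /= sqr_sqrtr// addr_ge0 ?sqr_ge0.
rewrite -h; have := sqr_ge0 (normc (z.1 +i* z.2) - 1); nra.
Qed.

(** The convergence of star-moments takes place in the topology that a
    numClosedFieldType derives from its norm, whence the abstraction over the
    field in the conclusion. *)
Lemma cvg_complex (u : nat -> R[i]) (l : R[i]) :
  complex.Re (u n) @[n --> \oo] --> complex.Re l ->
  complex.Im (u n) @[n --> \oo] --> complex.Im l ->
  (fun (C : numClosedFieldType) (u : nat -> C) (l : C) => u n @[n --> \oo] --> l) R[i] u l.
Proof.
move=> hr hi; apply: cvg_dist => e e0.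
have eR : e = (complex.Re e)%:C.
  by move: e0; case: e => a b; rewrite ltcE /= => /andP[/eqP -> _].
have er0 : 0 < complex.Re e by move: e0; rewrite {1}eR ltcR.
have e2 : 0 < complex.Re e / 2 by rewrite divr_gt0.
move/cvgrPdist_le : hr => /(_ _ e2) hr; move/cvgrPdist_le : hi => /(_ _ e2) hi.
near=> n.
rewrite eR [leLHS](_ : _ = (normc (l - u n))%:C)// lecR.
apply: (le_trans (normc_le_ReIm _)).
have h1 : `|complex.Re l - complex.Re (u n)| <= complex.Re e / 2 by near: n.
have h2 : `|complex.Im l - complex.Im (u n)| <= complex.Re e / 2 by near: n.
rewrite !raddfB; lra.
Unshelve. all: by end_near. Qed.

End StarMoments.

Section RandomMatrixMonomial.
Context d (T : measurableType d) (R : realType) (P : probability T R) (n : nat).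

Lemma rmx_eval_monomial (Q : seq bool) (a : rmx_ncp P n) w :
  (eval_monomial Q a : rmx P n) w =
  \big[mulmx/1%:M]_(b <- Q)
    (if b then map_mx Num.conj ((a : rmx P n) w)^T else (a : rmx P n) w).
Proof.
rewrite /eval_monomial; elim: Q => [|b Q IH]; first by rewrite !big_nil.
by rewrite !big_cons [LHS]rmx_mulE IH; case: b.
Qed.

Lemma scaled_Scirc_rmx (s : nat -> {RV P >-> R}) : (forall j, Mom P (s j)) ->
  (fun w => scaled_Scirc n.+1 (fun j => s j w)) \in @rmx_pred _ T R P n.
Proof.
move=> smom; rewrite inE => i j.
rewrite (_ : (fun w => _) = fun w => ((Num.sqrt n.+1%:R)^-1 *
   (if (i <= j)%N then s (j - i)%N w else - s (n.+1 + j - i)%N w))%:C); last first.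
  by apply/funext => w; rewrite !mxE.
apply: (@MomZ _ _ _ P); case: (i <= j)%N; first exact: smom.
by have := MomZ (-1) (smom (n.+1 + j - i)%N); under eq_fun do rewrite mulN1r.
Qed.

End RandomMatrixMonomial.

Section Limit.
Variable R : realType.
Local Notation G := (gauss_XY R).

Lemma gauss_rmx_subproof :
  (fun z : plane R => (gauss_G z)%:M : 'M[R[i]]_1) \in @rmx_pred _ _ R G 0.
Proof.
rewrite inE => i j; rewrite (_ : (fun w => _) = @gauss_G R).
  exact: gauss_G_finite_moments.
by apply/funext => z; rewrite !ord1 mxE eqxx mulr1n.
Qed.

(** The limit is realised as the complex Gaussian variable itself, a random
    matrix of size one. *)
Definition gauss_rmx : rmx_ncp G 0 := Rmx gauss_rmx_subproof.

Lemma gauss_rmx_star z : (star gauss_rmx : rmx G 0) z = (Num.conj (gauss_G z))%:M.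
Proof.
apply/matrixP => i j; rewrite [LHS]rmx_starE !ord1 /= !mxE eqxx !mulr1n//.
Qed.

Lemma scalar_mx1_eval_monomial (Q : seq bool) z :
  (eval_monomial Q gauss_rmx : rmx G 0) z =
  (gauss_G z ^+ count negb Q * Num.conj (gauss_G z) ^+ count id Q)%:M.
Proof.
rewrite rmx_eval_monomial; elim: Q => [|b Q IH]; first by rewrite big_nil mulr1.
rewrite big_cons IH; case: b => /=.
  rewrite (_ : map_mx _ _ = (Num.conj (gauss_G z))%:M); last exact: gauss_rmx_star.
  by rewrite -scalar_mxM exprS mulrCA.
by rewrite -scalar_mxM exprS mulrA.
Qed.

Lemma phi_gauss (X : rmx_ncp G 0) (f : plane R -> R[i]) :
  (forall z, (X : rmx G 0) z = (f z)%:M) -> phi X = cexpectation G f.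
Proof.
move=> h; rewrite [LHS]/(rmx_state _) /rmx_state invr1 mul1r; congr cexpectation.
by apply/funext => z; rewrite h mxtrace_scalar mulr1n.
Qed.

Lemma gauss_rmx_std : std_complex_gaussian gauss_rmx.
Proof.
split.
  apply: rmx_funP => z; rewrite !rmx_mulE gauss_rmx_star /=.
  by rewrite -!scalar_mxM mulrC.
move=> k l; apply: phi_gauss => z.
have -> : gauss_rmx ^+ k * star gauss_rmx ^+ l =
    eval_monomial (nseq k false ++ nseq l true) gauss_rmx.
  by rewrite /eval_monomial big_cat !big_nseq -!Monoid.iteropE /=; congr (_ * _);
     rewrite /GRing.exp.
rewrite scalar_mx1_eval_monomial !count_cat !count_nseq /= !mul0n !mul1n add0n addn0.
by [].
Qed.

End Limit.

(** * Weak convergence, star-convergence and the theorem *)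

Section Final.
Context d (T : measurableType d) (R : realType) (P : probability T R).
Variable (s : nat -> {RV P >-> R}).
Local Notation G := (gauss_XY R).

Lemma markov_mean (Y : T -> R) (a : R) : Mom P Y -> (forall w, 0 <= Y w) -> 0 < a ->
  (P [set w | (a <= Y w)%R] <= (a^-1 * \int[P]_w Y w)%R%:E)%E.
Proof.
move=> MY Y0 a0; pose A := [set w | a <= Y w].
have mA : measurable A.
  rewrite -[A]setTI (_ : A = Y @^-1` `[a, +oo[%classic); last first.
    by apply/seteqP; split => w; rewrite /A /= in_itv /= andbT.
  by apply: (Mom_meas MY) => //; exact: measurable_itv.
have -> : P A = (\int[P]_w (\1_A w)%:E)%E by rewrite integral_indic// setIT.
have M1 : Mom P (\1_A : T -> R).
  apply: (@Mom_bounded _ _ _ P _ 1); first exact: measurable_indic.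
  by move=> w; rewrite indicE; case: (_ \in _); rewrite /= ?normr1 ?normr0.
rewrite -[leLHS]fineK; last by apply: integrable_fin_num => //; exact: Mom_int M1.
rewrite lee_fin -RintegralZl//; last exact: Mom_int.
apply: le_Rintegral; [by []|exact: Mom_int|exact: Mom_int (MomZ _ MY)|].
move=> w _; rewrite indicE; case: (boolP (w \in A)) => /=.
  by rewrite inE /A /= => h; rewrite ler_pdivlMl// mulr1.
by rewrite mulr_ge0// invr_ge0 ltW.
Qed.

Lemma Rintegral_bivariate_normal (f : plane R -> R) :
  \int[bivariate_normal 0 (2^-1)%:M]_z f z = \int[G]_z f z.
Proof.
rewrite /Rintegral; congr fine; apply: eq_measure_integral => A mA _.
exact: bivariate_normal_gauss_XY.
Qed.

Lemma esd_emp n (f : R * R -> R) (M : R) w : continuous f -> (forall z, `|f z| <= M) ->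
  \int[esd (scaled_Scirc n.+1 (fun j => s j w))]_z f z = emp s n f w.
Proof.
move=> cf fM; rewrite (esd_scirc n _ (bounded_continuous_measurable cf fM) fM).
by congr (_ * _); apply: eq_bigr => j _; rewrite -ev_point_scirc.
Qed.

Lemma small_cf_moments (delta : R) : 0 < delta ->
  (forall j, 'E_P[s j] = 0)%E ->
  (forall j, 'E_P[fun w => (s j w ^+ 2)%R] = 1)%E ->
  (ereal_sup (range (fun j => 'E_P[fun w => (`|s j w| `^ (2 + delta))%R])) < +oo)%E ->
  forall eps : R, 0 < eps -> exists2 eta, 0 < eta & small_cf s eps eta.
Proof.
move=> d0 s1 s2 hs eps e0.
have [|M M0 HM] := sup_bound _ hs.
  by move=> j; apply: expectation_ge0 => w; exact: powR_ge0.
exact: cf_expansion d0 e0 s1 s2 HM M0.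
Qed.

Lemma weak_convergence (delta : R) : 0 < delta -> independent_RVs s ->
  (forall j, 'E_P[s j] = 0)%E ->
  (forall j, 'E_P[fun w => (s j w ^+ 2)%R] = 1)%E ->
  (ereal_sup (range (fun j => 'E_P[fun w => (`|s j w| `^ (2 + delta))%R])) < +oo)%E ->
  weak_cvg_in_probability P
     (fun n w => esd (scaled_Scirc n.+1 (fun j => s j w)))
     (bivariate_normal 0 (2^-1)%:M).
Proof.
move=> d0 ind s1 s2 hs f cof [M fM] eps e0.
have cf := small_cf_moments d0 s1 s2 hs.
have s2i j : P.-integrable setT (EFin \o (fun w => s j w ^+ 2)).
  by have [] := standard_moments (measurable_funP (s j)) (s1 j) (s2 j).
have s2E j : \int[P]_w (s j w ^+ 2) = 1.
  by have [] := standard_moments (measurable_funP (s j)) (s1 j) (s2 j).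
rewrite Rintegral_bivariate_normal.
have mf := bounded_continuous_measurable cof fM.
have MY n : Mom P (fun w => `|emp s n f w - \int[G]_z f z|).
  by apply: Mom_norm; apply: MomB; [exact: emp_Mom mf fM|exact: Mom_cst].
pose u n := eps^-1 * \int[P]_w `|emp s n f w - \int[G]_z f z|.
have u0 : u n @[n --> \oo] --> 0.
  apply/cvgrPdist_le => e ee0.
  have ee : 0 < eps * e by rewrite mulr_gt0.
  have := bounded_cvg_mean ind cf s2i s2E cof fM ee; apply: filterS => n hn.
  have I0 : 0 <= \int[P]_w `|emp s n f w - \int[G]_z f z|.
    by apply: Rintegral_ge0.
  rewrite sub0r normrN ger0_norm; last by rewrite mulr_ge0// invr_ge0 ltW.
  by rewrite ler_pdivrMl.
apply: (@squeeze_cvge _ _ _ _ (fun=> 0%E) _ (fun n => (u n)%:E)).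
- apply: nearW => n; rewrite measure_ge0 /=.
  have := markov_mean (MY n) (fun w => normr_ge0 _) e0.
  rewrite (_ : [set w | _] = [set w | eps <= `|emp s n f w - \int[G]_z f z|])//.
  by apply/seteqP; split => w /=; rewrite (esd_emp n w cof fM).
- exact: cvg_cst.
- by apply: cvg_EFin; [exact: nearW|exact: u0].
Qed.

Lemma scirc_ev_plane n j w :
  scirc_ev n (fun m => (Num.sqrt n.+1%:R)^-1 * s m w) j =
  (ev_point s n j w).1 +i* (ev_point s n j w).2.
Proof. by rewrite -ev_point_scirc; case: scirc_ev. Qed.

(** Both sides are normalised sums over the eigenvalues: the trace of a word in a
    normal matrix is the empirical integral of a monomial. *)
Lemma phi_scirc n (Q : seq bool) (X : rmx_ncp P n) :
  (forall j, Mom P (s j)) ->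
  (forall w, (X : rmx P n) w = scaled_Scirc n.+1 (fun j => s j w)) ->
  phi (eval_monomial Q X) =
  (\int[P]_w emp s n (fun z => complex.Re (plane_mono (count negb Q) (count id Q) z)) w) +i*
  (\int[P]_w emp s n (fun z => complex.Im (plane_mono (count negb Q) (count id Q) z)) w).
Proof.
move=> smom hX; set k := count negb Q; set l := count id Q.
rewrite [LHS]/(rmx_state _) /rmx_state.
have trE w : \tr ((eval_monomial Q X : rmx P n) w) =
    \sum_(j < n.+1) plane_mono k l (ev_point s n j w).
  rewrite rmx_eval_monomial hX scaled_ScircE trace_word.
  by apply: eq_bigr => j _; rewrite scirc_ev_plane.
have [cr ci] := plane_mono_continuous R k l.
have Mr : Mom P (emp s n (fun z => complex.Re (plane_mono k l z))).
  apply: (@emp_growth_Mom _ _ _ _ s smom _ (k + l)%N).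
    exact: continuous_plane_measurable.
  by move=> z; apply: (le_trans (Re_le_normc _)); exact: plane_mono_growth.
have Mi : Mom P (emp s n (fun z => complex.Im (plane_mono k l z))).
  apply: (@emp_growth_Mom _ _ _ _ s smom _ (k + l)%N).
    exact: continuous_plane_measurable.
  by move=> z; apply: (le_trans (Im_le_normc _)); exact: plane_mono_growth.
have n0 : n.+1%:R != 0 :> R by rewrite pnatr_eq0.
have -> : cexpectation P (fun w => \tr ((eval_monomial Q X : rmx P n) w)) =
   (n.+1%:R)%:C * ((\int[P]_w emp s n (fun z => complex.Re (plane_mono k l z)) w) +i*
   (\int[P]_w emp s n (fun z => complex.Im (plane_mono k l z)) w)).
  rewrite /cexpectation; simpc; congr (_ +i* _).
    rewrite -RintegralZl//; last exact: Mom_int.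
    by apply: eq_Rintegral => w _; rewrite trE raddf_sum /emp mulrA mulfV ?mul1r.
  rewrite -RintegralZl//; last exact: Mom_int.
  by apply: eq_Rintegral => w _; rewrite trE raddf_sum /emp mulrA mulfV ?mul1r.
by rewrite mulrA -[n.+1%:R in X in X * _](rmorph_nat (real_complex R)) -fmorphV -rmorphM mulVf// mul1r.
Qed.

End Final.

Theorem theorem3p1 (R : realType) (d : measure_display) (T : measurableType d)
    (P : probability T R) (s : nat -> {RV P >-> R}) :
  (independent_RVs s ->
   (forall j, 'E_P[s j] = 0)%E ->
   (forall j, 'E_P[fun w => (s j w ^+ 2)%R] = 1)%E ->
   (forall k : nat, (1 <= k)%N ->
      (ereal_sup (range (fun j => 'E_P[fun w => (`|s j w| ^+ k)%R])) < +oo)%E) ->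
   exists S_ : forall n : nat, rmx_ncp P n,
     (forall n w,
        (S_ n : rmx P n) w = scaled_Scirc n.+1 (fun j => s j w)) /\
     exists (A : ncp R[i]) (a : A),
       std_complex_gaussian a /\ cvg_star_distribution S_ a)
  /\
  (independent_RVs s ->
   (forall j, 'E_P[s j] = 0)%E ->
   (forall j, 'E_P[fun w => (s j w ^+ 2)%R] = 1)%E ->
   (exists2 delta : R, 0 < delta &
      (ereal_sup (range (fun j => 'E_P[fun w => (`|s j w| `^ (2 + delta))%R]))
         < +oo)%E) ->
   weak_cvg_in_probability P
     (fun n w => esd (scaled_Scirc n.+1 (fun j => s j w)))
     (bivariate_normal 0 (2^-1)%:M)).
Proof.
split=> [ind s1 s2 hk|ind s1 s2 [delta d0 hs]]; last first.
  exact: weak_convergence d0 ind s1 s2 hs.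
have pos k j : (0 <= 'E_P[fun w => (`|s j w| ^+ k)%R])%E.
  by apply: expectation_ge0 => w; exact: exprn_ge0.
have smom j : Mom P (s j).
  apply/MomP; split; first exact: measurable_funP.
  case=> [|k]; first by under eq_fun do rewrite expr0; rewrite (@expectation_cst _ _ _ P 1) ltry.
  have [M M0 HM] := sup_bound (pos k.+1) (hk k.+1 isT).
  by apply: le_lt_trans (HM j) _; exact: ltry.
have sk k : exists2 M : R, 0 <= M & forall j, \int[P]_w (s j w ^+ k.*2) <= M.
  case: k => [|k].
    by exists 1 => // j; under eq_Rintegral do rewrite expr0; rewrite Rintegral_prob_cst.
  have [M M0 HM] := sup_bound (pos k.+1.*2) (hk k.+1.*2 isT).
  exists M => // j.
  rewrite -lee_fin /Rintegral fineK; last first.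
    by apply: integrable_fin_num => //; exact: Mom_int (MomX _ (smom j)).
  apply: le_trans (HM j); rewrite expectation.unlock.
  rewrite (eq_integral (fun w => (`|s j w| ^+ k.+1.*2)%:E))// => w _.
  by rewrite (normr_even _ k.+1).
have hs : (ereal_sup (range (fun j => 'E_P[fun w => (`|s j w| `^ (2 + 1))%R])) < +oo)%E.
  rewrite (_ : (fun j => _) = fun j => 'E_P[fun w => (`|s j w| ^+ 3)%R]%E); first exact: hk.
  apply/funext => j; congr expectation; apply/funext => w.
  by rewrite (_ : 2 + 1 = 3%:R) ?powR_mulrn//; ring.
have cf := small_cf_moments ltr01 s1 s2 hs.
have s1E j : \int[P]_w s j w = 0.
  by have [] := standard_moments (measurable_funP (s j)) (s1 j) (s2 j).
have s2E j : \int[P]_w (s j w ^+ 2) = 1.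
  by have [] := standard_moments (measurable_funP (s j)) (s1 j) (s2 j).
pose S_ n : rmx_ncp P n := Rmx (scaled_Scirc_rmx n smom).
exists S_; split=> //; exists (rmx_ncp (gauss_XY R) 0), (gauss_rmx R).
split; first exact: gauss_rmx_std.
move=> Q; set k := count negb Q; set l := count id Q.
have [cr ci] := plane_mono_continuous R k l.
rewrite (phi_gauss (scalar_mx1_eval_monomial Q)).
under eq_cvg do rewrite (@phi_scirc _ _ _ _ s _ Q (S_ _) smom (fun w => erefl)).
apply: cvg_complex => /=.
- apply: (growth_cvg_mean ind cf smom s1E s2E sk cr (q := (k + l)%N)) => z.
  by apply: (le_trans (Re_le_normc _)); exact: plane_mono_growth.
- apply: (growth_cvg_mean ind cf smom s1E s2E sk ci (q := (k + l)%N)) => z.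
  by apply: (le_trans (Im_le_normc _)); exact: plane_mono_growth.
Qed.
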